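(* For each $n\in\mathbb{N}$, let $\mathcal{S}=\{\mathcal{P}_1,\mathcal{P}_2,c^{-1}\mathcal{P}_2,\dots,c^{-2n+1}\mathcal{P}_2,c^{-2n}r\mathcal{P}_1\}$. Then the tiling $\mathcal{T}_n=\Gamma_n\cdot\bigcup\{\mathcal{P}\in\mathcal{S}\}$ of $\mathbb{H}^3$, whose top-dimensional tiles are the $\Gamma_n$-translates of the members of $\mathcal{S}$, is the canonical tiling for $\mathrm{Comm}(\Gamma_n)$.
   Context: $\mathrm{PSL}_2(\mathbb{C})$ acts on upper half-space $\mathbb{H}^3$ (matrices represent elements up to sign). Write $\Gamma^y=y\Gamma y^{-1}$, and let $\overline{\Gamma}$ be obtained from $\Gamma$ by complex-conjugating matrix entries. Let $s=f=\begin{pmatrix}1&0\\-1&1\end{pmatrix}$, $t=\begin{pmatrix}2i&2-i\\ i&1-i\end{pmatrix}$, $g=\begin{pmatrix}-1+i\sqrt2&1-2i\sqrt2\\-2&3-i\sqrt2\end{pmatrix}$, $h=\begin{pmatrix}2i\sqrt2&-3-i\sqrt2\\-3+i\sqrt2&-3i\sqrt2\end{pmatrix}$, $c=\begin{pmatrix}1&i\sqrt2\\0&1\end{pmatrix}$. Set $\Gamma_S=\langle s,t\rangle$, $\Gamma_{T_0}=\langle f,g,h\rangle$, $\Gamma_T=\langle\Gamma_{T_0},(\overline{\Gamma}_{T_0})^{c^{-2}}\rangle$, $\Gamma_T^{(i)}=\Gamma_T^{c^{-2(i-1)}}$ for $i\ge1$, and $\Gamma_n=\langle\Gamma_S,\Gamma_T^{(1)},\dots,\Gamma_T^{(n)},(\overline{\Gamma}_S)^{c^{-2n}}\rangle$.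 $\Gamma_n$ is discrete, non-arithmetic, with finite covolume. $r$ is reflection in the plane with ideal boundary $\mathbb{R}\cup\{\infty\}$ (complex conjugation on $\mathbb{C}$). $\mathcal{P}_1$ is the regular ideal octahedron with ideal vertices $\infty,0,1,i,1+i,\frac{1+i}{2}$. $\mathcal{P}_2$ is the right-angled ideal cuboctahedron with ideal vertices $\infty$, $0$, $1$, $-i\sqrt2$, $1-i\sqrt2$, $-\frac{i\sqrt2}{2}$, $1-\frac{i\sqrt2}{2}$, $\frac{1-i\sqrt2}{2}$, and the four points $\frac{a-b\,i\sqrt2}{3}$ with $a,b\in\{1,2\}$. $\mathrm{Comm}(\Gamma)$ is the group of $x\in\mathrm{Isom}(\mathbb{H}^3)$ such that $\Gamma\cap x\Gamma x^{-1}$ has finite index in both $\Gamma$ and $x\Gamma x^{-1}$. $\mathrm{Comm}(\Gamma_n)$ is discrete, and $\mathbb{H}^3/\mathrm{Comm}(\Gamma_n)$ has exactly one cusp. Canonical tiling: in the hyperboloid model, $\mathbb{H}^3=\{v\in\mathbb{R}^4\mid\langle v,v\rangle=-1,v_4>0\}$ with $\langle v,w\rangle=v_1w_1+v_2w_2+v_3w_3-v_4w_4$, and $L^+=\{v\mid\langle v,v\rangle=0,v_4\ge0\}$. Choose $v\in L^+-\{0\}$ fixed by a peripheral (parabolic) element of $\Gamma_n$, let $V_n=\mathrm{Comm}(\Gamma_n)\cdot v$, and let $C_n$ be the convex hull of $V_n$ in $\mathbb{R}^4$. By Epstein–Penner, $\partial C_n$ consists of countably many 3-dimensional faces that are finite-sided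 Euclidean polyhedra, and projecting these along straight lines through the origin gives a $\mathrm{Comm}(\Gamma_n)$-invariant tiling of $\mathbb{H}^3$ by ideal polyhedra, independent of the choice of $v$. This is the canonical tiling for $\mathrm{Comm}(\Gamma_n)$. *)

(* Defs.v *)
From HB Require Import structures.
From mathcomp Require Import all_boot all_order all_algebra.
From mathcomp Require Import all_classical all_reals all_analysis.
From mathcomp Require Import complex ring lra.

Set Implicit Arguments.
Unset Strict Implicit.
Unset Printing Implicit Defensive.

Import Order.TTheory GRing.Theory Num.Theory.
Import numFieldNormedType.Exports.

Local Open Scope classical_set_scope.
Local Open Scope ring_scope.
Local Open Scope complex_scope.

Section Hyperboloid.
Variable R : realType.

(* Coordinates v_1, ..., v_4 are stored at the indices 0, ..., 3. *)
Definition vec4 (a b c d : R) : 'cV[R]_4 := \col_i [:: a; b; c; d]`_i.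

Definition mink (v w : 'cV[R]_4) : R :=
  v 0 0 * w 0 0 + v 1 0 * w 1 0 + v 2 0 * w 2 0 - v 3 0 * w 3 0.

Definition H3 : set 'cV[R]_4 := [set v | mink v v = -1 /\ 0 < v 3 0].

Definition Lplus : set 'cV[R]_4 := [set v | mink v v = 0 /\ 0 <= v 3 0].

(* Isom(H^3), acting on H^3 by M *m v: cosh d(v, w) = - mink v w, and every
   distance-preserving self-map of the hyperboloid is the restriction of exactly
   one such M; see isom3_of_isometry and isom3_inj. *)
Definition isom3 : set 'M[R]_4 :=
  [set M | (forall v w, mink (M *m v) (M *m w) = mink v w) /\
           (forall v, H3 v -> H3 (M *m v))].

Definition move (M : 'M[R]_4) (P : set 'cV[R]_4) : set 'cV[R]_4 :=
  [set M *m x | x in P].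

(* The Hermitian model of R^{3,1}: \det (herm v) = - mink v v, and A in SL_2(C)
   acts by X |-> A X A^*.  This identifies the hyperboloid with the upper
   half-space (lorentz_uhs) and the light rays with C u {oo} (lorentz_ideal). *)
Definition mx2 (T : Type) (a b c d : T) : 'M[T]_2 :=
  \matrix_(i, j) (if i == 0 then (if j == 0 then a else b)
                  else (if j == 0 then c else d)).

(* The library's 'i and z^* would be read as the operations of numClosedFieldType. *)
Definition iC : R[i] := 0 +i* 1.

Definition herm (v : 'cV[R]_4) : 'M[R[i]]_2 :=
  mx2 (v 3 0 + v 2 0)%:C   (v 0 0 +i* v 1 0)
      (v 0 0 -i* v 1 0)    (v 3 0 - v 2 0)%:C.

Definition unherm (X : 'M[R[i]]_2) : 'cV[R]_4 :=
  vec4 (complex.Re (X 0 1)) (complex.Im (X 0 1))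
       ((complex.Re (X 0 0) - complex.Re (X 1 1)) / 2)
       ((complex.Re (X 0 0) + complex.Re (X 1 1)) / 2).

Definition barmx (A : 'M[R[i]]_2) : 'M[R[i]]_2 := map_mx (@conjc R) A.

(* The isometry of H^3 given by (plus or minus) A in SL_2(C). *)
Definition lorentz (A : 'M[R[i]]_2) : 'M[R]_4 :=
  \matrix_(i, j) unherm (A *m herm (delta_mx j 0) *m (barmx A)^T) i 0.

(* None is the ideal point oo. *)
Definition ideal_vec (z : option R[i]) : 'cV[R]_4 :=
  unherm (if z is Some z then mx2 (z * conjc z) z (conjc z) 1 else mx2 1 0 0 0).

(* The point of H^3 corresponding to (z, t) in the upper half-space C x (0, oo). *)
Definition uhs (z : R[i]) (t : R) : 'cV[R]_4 :=
  unherm ((t^-1)%:C *: mx2 (z * conjc z + (t ^+ 2)%:C) z (conjc z) 1).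

(* Reflection in the plane with ideal boundary R u {oo}; see refl_ideal. *)
Definition refl : 'M[R]_4 := diag_mx (\row_j (if j == 1 then -1 else 1)).

End Hyperboloid.

Section Groups.

Inductive generated (G : unitRingType) (S : set G) : set G :=
| generated_incl x of S x : generated S x
| generated_one : generated S 1
| generated_mul x y of generated S x & generated S y : generated S (x * y)
| generated_inv x of generated S x : generated S x^-1.

Definition conj_by (G : unitRingType) (y : G) (S : set G) : set G :=
  [set y * x * y^-1 | x in S].

Definition finite_index (G : unitRingType) (H K : set G) :=
  finite_set [set [set h * k | k in K] | h in H].

Variable R : realType.

Definition Comm (Gam : set 'M[R]_4) : set 'M[R]_4 :=
  [set x | [/\ @isom3 R x,
               finite_index Gam (Gam `&` conj_by x Gam) &
               finite_index (conj_by x Gam) (Gam `&` conj_by x Gam)]].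

(* For Gam = Comm (PGamma R n) this holds by Margulis' theorem, Gamma n being
   nonarithmetic; it enters the main statement as a standing assumption. *)
Definition discrete_group (Gam : set 'M[R]_4) := Gam `<=` isolated Gam.

Definition ideal_fix (M : 'M[R]_4) (v : 'cV[R]_4) :=
  [/\ Lplus v, v != 0 & exists k : R, M *m v = k *: v].

Definition parabolic (M : 'M[R]_4) :=
  [/\ isom3 M,
      (forall x, H3 x -> M *m x <> x) &
      exists2 v, ideal_fix M v &
        forall w, ideal_fix M w -> exists k : R, w = k *: v].

Definition peripheral_vec (Gam : set 'M[R]_4) (v : 'cV[R]_4) :=
  [/\ Lplus v, v != 0 &
      exists M, [/\ Gam M, parabolic M & M *m v = v]].

End Groups.

Section Tilings.
Variable R : realType.
Implicit Types (C F P Q V : set 'cV[R]_4) (T : set (set 'cV[R]_4)).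

Definition chull V : set 'cV[R]_4 :=
  [set x | exists m (a : 'I_m -> R) (p : 'I_m -> 'cV[R]_4),
     [/\ forall k, 0 <= a k, \sum_k a k = 1, forall k, V (p k) &
         x = \sum_k a k *: p k]].

(* Four affinely independent points. *)
Definition affdim_ge3 F :=
  exists p : 'I_4 -> 'cV[R]_4, (forall k, F (p k)) /\
    \rank (\matrix_(k, j) (p k j 0 - p 0 j 0)) = 3.

(* F lies in a hyperplane, so its dimension is exactly 3. *)
Definition face3 C : set (set 'cV[R]_4) :=
  [set F | exists (l : 'rV[R]_4) (a : R),
     [/\ l != 0,
         forall x, C x -> a <= (l *m x) 0 0,
         F = C `&` [set x | (l *m x) 0 0 = a] &
         affdim_ge3 F]].

Definition radial F : set 'cV[R]_4 :=
  [set x | H3 x /\ exists2 k : R, 0 < k & F (k *: x)].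

(* Hyperbolic convex hull of finitely many ideal points. *)
Definition ideal_polyhedron (s : seq (option R[i])) : set 'cV[R]_4 :=
  radial (chull [set ideal_vec z | z in [set` s]]).

(* Top-dimensional tiles of the Epstein-Penner tiling determined by the orbit
   Gam v.  The 3-dimensional faces of the boundary of the hull are its facets. *)
Definition canonical_tiles (Gam : set 'M[R]_4) (v : 'cV[R]_4) :
    set (set 'cV[R]_4) :=
  [set radial F | F in face3 (chull [set M *m v | M in Gam])].

(* l = 0 yields P itself, and any l that is positive on H3 the empty face. *)
Definition is_face P Q :=
  exists l : 'rV[R]_4, (forall x, P x -> 0 <= (l *m x) 0 0) /\
    Q = P `&` [set x | (l *m x) 0 0 = 0].

Definition is_tiling T :=
  [/\ \bigcup_(P in T) P = @H3 R,
      forall x, H3 x ->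
        exists2 U, nbhs x U & finite_set [set P | T P /\ P `&` U !=set0] &
      forall P Q, T P -> T Q -> is_face P (P `&` Q) /\ is_face Q (P `&` Q)].

End Tilings.

Section Example.
Variable R : realType.

Definition isqrt2 : R[i] := 0 +i* Num.sqrt 2.

Definition mx_s : 'M[R[i]]_2 := mx2 1 0 (-1) 1.
Definition mx_t : 'M[R[i]]_2 := mx2 (2 * iC R) (2 - iC R) (iC R) (1 - iC R).
Definition mx_f : 'M[R[i]]_2 := mx_s.
Definition mx_g : 'M[R[i]]_2 :=
  mx2 (-1 + isqrt2) (1 - 2 * isqrt2) (-2) (3 - isqrt2).
Definition mx_h : 'M[R[i]]_2 :=
  mx2 (2 * isqrt2) (-3 - isqrt2) (-3 + isqrt2) (-3 * isqrt2).
Definition mx_c : 'M[R[i]]_2 := mx2 1 isqrt2 0 1.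

(* All groups below are subgroups of SL_2(C); lorentz maps them to Isom(H^3). *)
Definition GammaS : set 'M[R[i]]_2 := generated [set mx_s; mx_t].

Definition GammaT0 : set 'M[R[i]]_2 := generated [set mx_f; mx_g; mx_h].

Definition bar (Gam : set 'M[R[i]]_2) : set 'M[R[i]]_2 :=
  [set barmx A | A in Gam].

Definition GammaT : set 'M[R[i]]_2 :=
  generated (GammaT0 `|` conj_by (mx_c ^- 2) (bar GammaT0)).

Definition GammaTi (k : nat) : set 'M[R[i]]_2 :=
  conj_by (mx_c ^- (2 * (k - 1))) GammaT.

Definition Gamma (n : nat) : set 'M[R[i]]_2 :=
  generated (GammaS
         `|` \bigcup_(k in [set k | (1 <= k <= n)%N]) GammaTi k
         `|` conj_by (mx_c ^- (2 * n)) (bar GammaS)).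

Definition PGamma (n : nat) : set 'M[R]_4 := [set lorentz A | A in Gamma n].

Definition P1 : set 'cV[R]_4 :=
  ideal_polyhedron
    [:: None; Some 0; Some 1; Some (iC R); Some (1 + iC R);
         Some ((1 + iC R) / 2)].

Definition P2 : set 'cV[R]_4 :=
  ideal_polyhedron
    ([:: None; Some 0; Some 1; Some (- isqrt2); Some (1 - isqrt2);
         Some (- isqrt2 / 2); Some (1 - isqrt2 / 2); Some ((1 - isqrt2) / 2)]
     ++ [seq Some ((a%:R - b%:R * isqrt2) / 3) | a <- [:: 1; 2]%N, b <- [:: 1; 2]%N]).

Definition prototiles (n : nat) : set (set 'cV[R]_4) :=
  [set P1]
  `|` [set move (lorentz (mx_c ^- k)) P2 | k in [set k | (k < 2 * n)%N]]
  `|` [set move (lorentz (mx_c ^- (2 * n)) *m @refl R) P1].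

Definition tiles (n : nat) : set (set 'cV[R]_4) :=
  [set move M P | M in PGamma n & P in prototiles n].

End Example.

Arguments PGamma R n : clear implicits.
Arguments tiles R n : clear implicits.

(* Checks of the conventions: the identifications with the upper half-space and
   its ideal boundary, Isom(H^3), Gamma n in SL_2(C), existence of peripheral
   vectors. *)
Section Checks.
Variable R : realType.
Local Notation lorentz := (@lorentz R).

Let inord4 (P : 'I_4 -> Prop) : P 0 -> P 1 -> P 2 -> P 3 -> forall i, P i.
Proof.
move=> p0 p1 p2 p3 [[|[|[|[|//]]]] h].
- by have -> : Ordinal h = 0 by exact: val_inj.
- by have -> : Ordinal h = 1 by exact: val_inj.
- by have -> : Ordinal h = 2 by exact: val_inj.
- by have -> : Ordinal h = 3 by exact: val_inj.
Qed.

Let inord2 (P : 'I_2 -> Prop) : P 0 -> P 1 -> forall i, P i.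
Proof.
move=> p0 p1 [[|[|//]] h].
- by have -> : Ordinal h = 0 by exact: val_inj.
- by have -> : Ordinal h = 1 by exact: val_inj.
Qed.

Let sum4 (T : nmodType) (F : 'I_4 -> T) : \sum_i F i = F 0 + F 1 + F 2 + F 3.
Proof.
rewrite !big_ord_recl big_ord0 addr0 !addrA.
by congr (_ + F _ + F _ + F _); exact: val_inj.
Qed.

Let sum2 (T : nmodType) (F : 'I_2 -> T) : \sum_i F i = F 0 + F 1.
Proof.
rewrite !big_ord_recl big_ord0 addr0.
by congr (_ + F _); exact: val_inj.
Qed.

Let vec4_eta (v : 'cV[R]_4) : v = vec4 (v 0 0) (v 1 0) (v 2 0) (v 3 0).
Proof. by apply/matrixP => i j; rewrite (ord1 j); move: i; apply: inord4; rewrite mxE. Qed.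

Let mx2_eta (T : Type) (A : 'M[T]_2) : A = mx2 (A 0 0) (A 0 1) (A 1 0) (A 1 1).
Proof. by apply/matrixP => i j; move: i j; apply: inord2; apply: inord2; rewrite mxE. Qed.

Let mx2M (T : pzSemiRingType) (a b c d a' b' c' d' : T) :
  mx2 a b c d *m mx2 a' b' c' d' =
  mx2 (a * a' + b * c') (a * b' + b * d') (c * a' + d * c') (c * b' + d * d').
Proof.
apply/matrixP => i j; move: i j; apply: inord2; apply: inord2;
by rewrite !mxE sum2 !mxE.
Qed.

Let mx2T (T : Type) (a b c d : T) : (mx2 a b c d)^T = mx2 a c b d.
Proof. by apply/matrixP => i j; move: i j; apply: inord2; apply: inord2; rewrite !mxE. Qed.

Let barmx2 a b c d : @barmx R (mx2 a b c d) = mx2 (conjc a) (conjc b) (conjc c) (conjc d).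
Proof. by apply/matrixP => i j; move: i j; apply: inord2; apply: inord2; rewrite !mxE. Qed.

Lemma unhermK (v : 'cV[R]_4) : unherm (herm v) = v.
Proof.
rewrite [RHS]vec4_eta /unherm /herm !mxE /=.
congr vec4; lra.
Qed.

Let act A (v : 'cV[R]_4) := unherm (A *m herm v *m (barmx A)^T).

Let det_mx2 (T : comPzRingType) (a b c d : T) : \det (mx2 a b c d) = a * d - b * c.
Proof.
rewrite (expand_det_row _ 0) sum2 /cofactor !det_mx11 !mxE /=.
by rewrite expr0 expr1 mul1r mulN1r mulrN.
Qed.

Lemma det_herm (v : 'cV[R]_4) : \det (herm v) = (- mink v v)%:C.
Proof.
rewrite det_mx2 /mink; apply/eqP; rewrite eq_complex /=; apply/andP; split; apply/eqP; ring.
Qed.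

Lemma lorentzE A v : lorentz A *m v = act A v.
Proof.
rewrite [A]mx2_eta; case: (A 0 0) (A 0 1) (A 1 0) (A 1 1) => [a a'] [b b'] [c c'] [d d'].
apply/matrixP => i j; rewrite (ord1 j) mxE sum4 /act /herm barmx2 mx2T !mx2M /unherm.
do 4 rewrite [lorentz _ _ _]mxE /herm barmx2 mx2T !mx2M /unherm.
rewrite !mxE /=; move: i; apply: inord4 => /=; try ring; field.
Qed.

Lemma lorentz_mink A v w :
  \det A = 1 -> mink (lorentz A *m v) (lorentz A *m w) = mink v w.
Proof.
rewrite [A]mx2_eta; case: (A 0 0) (A 0 1) (A 1 0) (A 1 1) => [a a'] [b b'] [c c'] [d d'].
rewrite det_mx2 => /eqP; rewrite eq_complex /= => /andP[/eqP h1 /eqP h2].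
rewrite !lorentzE /act /herm barmx2 mx2T !mx2M /unherm /mink !mxE /=.
set dr := (X in X = 1) in h1; set di := (X in X = 0) in h2.
transitivity ((dr ^+ 2 + di ^+ 2) * mink v w); last by rewrite h1 h2 /mink; ring.
by rewrite /mink /dr /di; field.
Qed.

Let conjCE (z : R[i]) : z * conjc z = (complex.Re z ^+ 2 + complex.Im z ^+ 2)%:C.
Proof.
case: z => x y; apply/eqP; rewrite eq_complex /=; apply/andP; split; apply/eqP; ring.
Qed.

Let hermK (x : R) y (w : R) :
  herm (unherm (mx2 x%:C y (conjc y) w%:C)) = mx2 x%:C y (conjc y) w%:C.
Proof.
case: y => y y'; rewrite /herm /unherm !mxE /=; congr mx2; apply/eqP;
  rewrite eq_complex /=; apply/andP; split; apply/eqP; lra.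
Qed.

Let scaler_mx2 (k a b c d : R[i]) : k *: mx2 a b c d = mx2 (k * a) (k * b) (k * c) (k * d).
Proof. by apply/matrixP => i j; move: i j; apply: inord2; apply: inord2; rewrite !mxE. Qed.

Let conjcM (x y : R[i]) : conjc (x * y) = conjc x * conjc y.
Proof. exact: rmorphM. Qed.
Let conjcD (x y : R[i]) : conjc (x + y) = conjc x + conjc y.
Proof. exact: rmorphD. Qed.
Let conjcR (x : R) : conjc x%:C = x%:C.
Proof. exact: conjc_real. Qed.
Let conjcB (x y : R[i]) : conjc (x - y) = conjc x - conjc y.
Proof. exact: rmorphB. Qed.
Let conjcV (x : R[i]) : conjc x^-1 = (conjc x)^-1.
Proof. exact: fmorphV. Qed.

Let scaler_unherm (k : R) X : unherm (k%:C *: X) = k *: unherm X.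
Proof.
apply/matrixP => i j; rewrite (ord1 j) /unherm !mxE.
case: (X 0 0) (X 0 1) (X 1 1) => [x x'] [y y'] [w w'].
by move: i; apply: inord4 => /=; field.
Qed.

Lemma lorentz_ideal (a b c d z : R[i]) : a * d - b * c = 1 -> c * z + d != 0 ->
  exists2 k : R, 0 < k &
  lorentz (mx2 a b c d) *m ideal_vec (Some z) =
    k *: ideal_vec (Some ((a * z + b) / (c * z + d))).
Proof.
move=> ad1 nz; exists (complex.Re (c * z + d) ^+ 2 + complex.Im (c * z + d) ^+ 2).
  have := nz; rewrite eq_complex /= negb_and lt0r addr_ge0 ?sqr_ge0// andbT.
  by rewrite paddr_eq0 ?sqr_ge0// !sqrf_eq0 negb_and.
have nz' : conjc (c * z + d) != 0 by rewrite conjc_eq0.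
rewrite lorentzE /act /ideal_vec conjCE hermK -conjCE barmx2 mx2T !mx2M.
rewrite -scaler_unherm -conjCE scaler_mx2 !conjcM !conjcD !conjcM conjcV.
move: nz'; rewrite conjcD conjcM => nz'.
congr unherm; congr mx2; field; rewrite ?nz ?nz'//.
Qed.

Let conjCT (z : R[i]) (T : R) :
  z * conjc z + T%:C = (complex.Re z ^+ 2 + complex.Im z ^+ 2 + T)%:C.
Proof. by rewrite conjCE [RHS]rmorphD. Qed.

Lemma lorentz_uhs (a b c d z : R[i]) (t : R) : 0 < t -> a * d - b * c = 1 ->
  let N := (c * z + d) * conjc (c * z + d) + c * conjc c * (t ^+ 2)%:C in
  0 < complex.Re N /\
  lorentz (mx2 a b c d) *m uhs z t =
  uhs (((a * z + b) * conjc (c * z + d) + a * conjc c * (t ^+ 2)%:C) / N)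
      (t / complex.Re N).
Proof.
move=> t0 ad1 N; set n := complex.Re N.
have NE : N = n%:C by rewrite /n /N !conjCE -rmorphM -rmorphD.
have n_gt0 : 0 < n.
  have : (c * z + d != 0) || (c != 0).
    rewrite -negb_and; apply/andP => -[/eqP e /eqP c0]; move: e ad1.
    by rewrite c0 mul0r add0r => ->; rewrite mulr0 mulr0 subrr => /esym/eqP; rewrite oner_eq0.
  have sq (x : R[i]) : x != 0 -> 0 < complex.Re x ^+ 2 + complex.Im x ^+ 2.
    rewrite eq_complex negb_and lt0r addr_ge0 ?sqr_ge0// andbT.
    by rewrite paddr_eq0 ?sqr_ge0// !sqrf_eq0 negb_and.
  have nn (x : R[i]) : 0 <= complex.Re x ^+ 2 + complex.Im x ^+ 2 by rewrite addr_ge0 ?sqr_ge0.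
  rewrite /n /N !conjCE -rmorphM -rmorphD -[complex.Re _]/(_ + _).
  have t2 : 0 < t ^+ 2 by rewrite exprn_gt0.
  case/orP => /sq h.
    by apply: ltr_pwDl => //; rewrite mulr_ge0// ltW.
  by apply: ltr_wpDl => //; rewrite mulr_gt0.
split=> //.
have N0 : N != 0 by rewrite NE -(rmorph0 (real_complex R)) (inj_eq (@complexI R)) gt_eqF.
have NJ : conjc N = N by rewrite NE conjcR.
have tN : t != 0 by rewrite gt_eqF.
have nN : n != 0 by rewrite gt_eqF.
have NX : N = (c * z + d) * (conjc c * conjc z + conjc d) + c * conjc c * (t ^+ 2)%:C.
  by rewrite /N conjcD conjcM.
clearbody n N.
rewrite /uhs !scaler_unherm -scalemxAr invf_div -[n / t]mulrC -scalerA; congr (_ *: _).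
rewrite -scaler_unherm -NE lorentzE /act conjCT hermK -conjCT.
rewrite barmx2 mx2T !mx2M scaler_mx2.
have -> : ((t / n) ^+ 2)%:C = (t ^+ 2)%:C / N ^+ 2.
  by rewrite NE expr_div_n -rmorphXn -fmorphV -rmorphM.
have aJ : conjc a * conjc d - conjc b * conjc c = 1 by rewrite -!conjcM -conjcB ad1 rmorph1.
rewrite !(conjcM, conjcD, conjcV, conjcR, conjcK) NJ {NE NJ}.
move: ((t ^+ 2)%:C) NX => T NX.
move: N0 NX aJ ad1; move: (conjc a) (conjc b) (conjc c) (conjc d) (conjc z) => a' b' c' d' z' N0 NX aJ ad1.
congr unherm; rewrite -[1%:C]/(1 : R[i]); congr mx2.
- set M := (_ + a * c' * T); set M' := (_ + a' * c * T).
  transitivity ((M * M' + T * (a * d - b * c) * (a' * d' - b' * c')) / N).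
    by apply: (mulIf N0); rewrite divfK// [X in _ * X]NX /M /M'; ring.
  by rewrite ad1 aJ; field.
- by rewrite [RHS]mulrC divfK//; ring.
- by rewrite [RHS]mulrC divfK//; ring.
- by rewrite NX; ring.
Qed.

Let scaler_vec4 k a b c d :
  k *: vec4 a b c d = vec4 (k * a) (k * b) (k * c) (k * d) :> 'cV[R]_4.
Proof.
by apply/matrixP => i j; rewrite (ord1 j) mxE; move: i; apply: inord4; rewrite !mxE.
Qed.

Lemma uhs_H3 (z : R[i]) (t : R) : 0 < t -> H3 (uhs z t).
Proof.
move=> t0; have tN : t != 0 by rewrite gt_eqF.
rewrite /uhs scaler_unherm conjCT; case: z => x y.
rewrite /unherm scaler_vec4 /H3 /mink /= !mxE /=; split; first by field.
by rewrite mulr_gt0 ?invr_gt0// divr_gt0// ltr_wpDl// addr_ge0 ?sqr_ge0// addr_ge0 ?sqr_ge0.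
Qed.

Lemma uhs_surj (x : 'cV[R]_4) : H3 x -> exists z, exists2 t, 0 < t & x = uhs z t.
Proof.
rewrite (vec4_eta x); move: (x 0 0) (x 1 0) (x 2 0) (x 3 0) => a b c d.
rewrite /H3 /mink /= !mxE /= => -[e d0].
have cd : 0 < d - c by nra.
exists ((a / (d - c)) +i* (b / (d - c))), (d - c)^-1; first by rewrite invr_gt0.
have dN : d - c != 0 by rewrite gt_eqF.
have q : a * a + b * b + 1 = (d - c) * (d + c) by lra.
rewrite /uhs scaler_unherm conjCT invrK /unherm scaler_vec4.
apply/matrixP => i j; rewrite (ord1 j); move: i; apply: inord4; rewrite !mxE /=.
- by field.
- by field.
- transitivity (((a * a + b * b + 1) / (d - c) - (d - c)) / 2); last by field.
  by rewrite q; field.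
- transitivity (((a * a + b * b + 1) / (d - c) + (d - c)) / 2); last by field.
  by rewrite q; field.
Qed.

Lemma lorentz_isom3 A : \det A = 1 -> isom3 (lorentz A).
Proof.
move=> dA; split => [v w|x /uhs_surj[z [t t0 ->]]]; first exact: lorentz_mink.
move: dA; rewrite [A]mx2_eta det_mx2 => dA.
have [N0 ->] := lorentz_uhs z t0 dA.
by apply: uhs_H3; rewrite divr_gt0.
Qed.

Let J : 'M[R]_4 := diag_mx (\row_j (if j == 3 then -1 else 1)).

Let minkE (v w : 'cV[R]_4) : mink v w = (v^T *m J *m w) 0 0.
Proof.
rewrite mxE sum4 /J /mink mul_mx_diag !mxE /=; ring.
Qed.

Let mink_mx (A B : 'M[R]_4) i j : (A^T *m J *m B) i j = mink (col i A) (col j B).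
Proof.
rewrite /mink /J mul_mx_diag !mxE sum4 !mxE /=; ring.
Qed.

Let P : 'M[R]_4 := \matrix_(i, j) (if i == j then 1 else if i == 3 then Num.sqrt 2 else 0).

Let P_unit : P \in unitmx.
Proof.
rewrite unitmxE det_trig; last first.
  apply/is_trig_mxP => i j ij; rewrite mxE; case: eqP => [e|_]; first by rewrite e ltnn in ij.
  by case: eqP => // e; move: ij (ltn_ord j); rewrite e /= => h1 h2; have := leq_trans h1 h2.
by rewrite big1 ?unitr1// => i _; rewrite mxE eqxx.
Qed.

Let P_H3 j : H3 (col j P).
Proof.
have s2 : Num.sqrt 2 * Num.sqrt 2 = 2 :> R by rewrite -expr2 sqr_sqrtr.
have s0 : 0 < Num.sqrt 2 :> R by rewrite sqrtr_gt0.
by move: j; apply: inord4; rewrite /H3 /= /mink !mxE /=; split; rewrite ?s2 //; ring.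
Qed.

Let J_unit : J \in unitmx.
Proof.
rewrite unitmxE det_diag.
by rewrite rpred_prod// => i _; rewrite mxE; case: ifP; rewrite ?unitrN unitr1.
Qed.

Lemma isom3_inj (M N : 'M[R]_4) : (forall x, H3 x -> M *m x = N *m x) -> M = N.
Proof.
move=> MN; apply: (can_inj (mulmxK P_unit)); apply/matrixP => i j.
have /(congr1 (fun v : 'cV[R]_4 => v i 0)) := MN _ (P_H3 j); rewrite !mxE => h.
etransitivity; [|etransitivity; [exact: h|]]; apply: eq_bigr => k _; rewrite !mxE//.
Qed.

Lemma isom3_of_isometry (f : 'cV[R]_4 -> 'cV[R]_4) :
  (forall x, H3 x -> H3 (f x)) ->
  (forall x y, H3 x -> H3 y -> mink (f x) (f y) = mink x y) ->
  exists2 M, isom3 M & forall x, H3 x -> f x = M *m x.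
Proof.
move=> fH fm; pose Q : 'M[R]_4 := \matrix_(i, j) f (col j P) i 0.
have colQ j : col j Q = f (col j P) by apply/matrixP => i k; rewrite !mxE (ord1 k).
have QPJ : Q^T *m J *m Q = P^T *m J *m P.
  by apply/matrixP => i j; rewrite !mink_mx !colQ fm.
have QJ_unit : Q^T *m J \in unitmx.
  have : Q^T *m J *m Q \in unitmx by rewrite QPJ !unitmx_mul unitmx_tr P_unit J_unit.
  by rewrite unitmx_mul => /andP[].
pose M := invmx (Q^T *m J) *m (P^T *m J).
have MP : M *m P = Q by rewrite /M -mulmxA -QPJ mulKmx.
have fM x : H3 x -> f x = M *m x.
  move=> Hx; apply: (can_inj (mulKmx QJ_unit)); rewrite /M !mulmxA mulmxV// mul1mx.
  apply/matrixP => i j; rewrite (ord1 j).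
  have := fm _ _ (P_H3 i) Hx; rewrite !minkE -colQ.
  rewrite [in LHS]mxE [in RHS]mxE => h; rewrite [LHS]mxE [RHS]mxE.
  etransitivity; [|etransitivity; [exact: h|]]; apply: eq_bigr => k _.
    by congr (_ * _); rewrite !mxE; apply: eq_bigr => l _; rewrite !mxE.
  by congr (_ * _); rewrite !mxE; apply: eq_bigr => l _; rewrite !mxE.
have MJ : M^T *m J *m M = J.
  clearbody M; apply: (can_inj (mulmxK P_unit)).
  have PT : P^T \in unitmx by rewrite unitmx_tr.
  apply: (can_inj (mulKmx PT)).
  by move: QPJ; rewrite -MP trmx_mul !mulmxA => ->.
exists M => //; split => [v w|v Hv]; last by rewrite -fM//; exact: fH.
by rewrite !minkE trmx_mul -[in RHS]MJ !mulmxA.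
Qed.

Lemma refl_ideal (z : option R[i]) : refl R *m ideal_vec z = ideal_vec (omap (@conjc R) z).
Proof.
rewrite /refl mul_diag_mx; apply/matrixP => i j; rewrite (ord1 j).
case: z => [[x y]|]; move: i; apply: inord4; rewrite !mxE /=; ring.
Qed.
Lemma refl_isom3 : isom3 (refl R).
Proof.
have E v : refl R *m v = vec4 (v 0 0) (- v 1 0) (v 2 0) (v 3 0).
  rewrite /refl mul_diag_mx; apply/matrixP => i j; rewrite (ord1 j).
  by move: i; apply: inord4; rewrite !mxE /= ?mul1r ?mulN1r.
split => [v w|v]; first by rewrite !E /mink !mxE /=; ring.
by rewrite E /H3 /mink /= !mxE /= !mulrNN.
Qed.

Lemma generated_det (S : set 'M[R[i]]_2) :
  (forall A, S A -> \det A = 1) -> forall A, generated S A -> \det A = 1.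
Proof.
move=> S1 A; elim=> {A} [A /S1//||A B _ A1 _ B1|A _ A1]; first exact: det1.
  by rewrite -[A * B]/(A *m B) det_mulmx A1 B1 mulr1.
by rewrite -[A^-1]/(invmx A) det_inv A1 invr1.
Qed.

Lemma conj_by_det (B : 'M[R[i]]_2) (S : set 'M[R[i]]_2) : \det B = 1 ->
  (forall A, S A -> \det A = 1) -> forall A, conj_by B S A -> \det A = 1.
Proof.
move=> B1 S1 _ [A /S1 A1 <-].
rewrite -[B * A / B]/((B *m A) *m invmx B) !det_mulmx det_inv A1 B1.
by rewrite invr1 !mulr1.
Qed.

Lemma bar_det (S : set 'M[R[i]]_2) :
  (forall A, S A -> \det A = 1) -> forall A, bar S A -> \det A = 1.
Proof.
move=> S1 _ [A /S1 A1 <-].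
by rewrite /barmx (det_map_mx (@conjc R)) A1 rmorph1.
Qed.

Lemma Gamma_det n (A : 'M[R[i]]_2) : Gamma n A -> \det A = 1.
Proof.
have s2 : Num.sqrt 2 * Num.sqrt 2 = 2 :> R by rewrite -expr2 sqr_sqrtr.
have q2 : isqrt2 R * isqrt2 R = - 2.
  apply/eqP; rewrite eq_complex /=; apply/andP; split; apply/eqP; first by lra.
  by ring.
have i2 : iC R * iC R = - 1.
  apply/eqP; rewrite eq_complex /=; apply/andP; split; apply/eqP; ring.
have ds : \det (mx_s R) = 1 by rewrite det_mx2; ring.
have dt : \det (mx_t R) = 1.
  rewrite det_mx2; transitivity (- (iC R * iC R)); last by rewrite i2 opprK.
  by ring.
have dg : \det (mx_g R) = 1.
  rewrite det_mx2; transitivity (- (isqrt2 R * isqrt2 R) - 1); last by rewrite q2; ring.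
  by ring.
have dh : \det (mx_h R) = 1.
  rewrite det_mx2; transitivity (- 5 * (isqrt2 R * isqrt2 R) - 9); last by rewrite q2; ring.
  by ring.
have dc : \det (mx_c R) = 1 by rewrite det_mx2; ring.
have dcn k : \det (mx_c R ^- k) = 1.
  apply: (@generated_det [set mx_c R]) => [_ ->//|]; apply: generated_inv.
  elim: k => [|k IH]; first exact: generated_one.
  by rewrite exprS; apply: generated_mul => //; exact: generated_incl.
have dS (B : 'M[R[i]]_2) : GammaS B -> \det B = 1.
  by move=> H; apply: (generated_det _ H) => _ [->|->].
have dT0 (B : 'M[R[i]]_2) : GammaT0 B -> \det B = 1.
  by move=> H; apply: (generated_det _ H) => _ [[->|->]|->].
have dT (B : 'M[R[i]]_2) : GammaT B -> \det B = 1.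
  move=> H; apply: (generated_det _ H) => {H} {}B [/dT0//|H].
  by apply: (conj_by_det _ _ H) => //; exact: bar_det.
move=> H; apply: (generated_det _ H) => {H} {}A [[/dS//|[k _ H]]|H].
  by apply: (conj_by_det _ _ H).
by apply: (conj_by_det _ _ H) => //; exact: bar_det.
Qed.

Lemma PGamma_isom3 n : PGamma R n `<=` @isom3 R.
Proof. by move=> _ [A /Gamma_det A1 <-]; exact: lorentz_isom3. Qed.

Lemma peripheral_vec0 n : peripheral_vec (PGamma R n) (ideal_vec (Some 0)).
Proof.
pose M := lorentz (mx_s R).
have GM : PGamma R n M.
  exists (mx_s R) => //; apply: generated_incl; left; left.
  by apply: generated_incl; left.
have ME a b c d : M *m vec4 a b c d =
    vec4 (a - c - d) b (a - (d - c) / 2) (c + d - a + (d - c) / 2).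
  rewrite lorentzE /act /herm barmx2 mx2T !mx2M /unherm !mxE /=.
  by congr vec4; field.
have v0E : ideal_vec (Some 0) = vec4 0 0 (- 1 / 2) (1 / 2) :> 'cV[R]_4.
  by rewrite /ideal_vec /unherm !mxE /=; congr vec4; field.
have Mv0 : M *m ideal_vec (Some 0) = ideal_vec (Some 0).
  by rewrite v0E ME; congr vec4; field.
have Lv0 : Lplus (ideal_vec (Some 0) : 'cV[R]_4).
  by rewrite v0E /Lplus /mink /= !mxE /=; split; [field|lra].
have v0N : (ideal_vec (Some 0) : 'cV[R]_4) != 0.
  apply/eqP => /(congr1 (fun v : 'cV[R]_4 => v 3 0)); rewrite v0E !mxE /= => /eqP.
  by rewrite mulf_eq0 oner_eq0 invr_eq0 pnatr_eq0.
have vec4_inj (a b c d a' b' c' d' : R) : vec4 a b c d = vec4 a' b' c' d' ->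
    [/\ a = a', b = b', c = c' & d = d'].
  move=> /matrixP h; have := (h 0 0, h 1 0, h 2 0, h 3 0).
  by rewrite !mxE /= => -[[[-> ->] ->] ->].
split=> //; exists M; split=> //; split; first exact: (PGamma_isom3 GM).
  move=> x; rewrite (vec4_eta x); move: (x 0 0) (x 1 0) (x 2 0) (x 3 0) => a b c d.
  rewrite /H3 /mink /= !mxE /= => -[e d0]; rewrite ME => /vec4_inj[h1 h2 h3 h4].
  have cd : c = - d by lra.
  by move: e; rewrite cd; nra.
exists (ideal_vec (Some 0)); first by split=> //; exists 1; rewrite scale1r.
move=> w; rewrite (vec4_eta w); move: (w 0 0) (w 1 0) (w 2 0) (w 3 0) => a b c d.
rewrite /ideal_fix /Lplus /mink /= !mxE /= => -[[e d0] _ [k]].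
rewrite ME scaler_vec4 => /vec4_inj[h1 h2 h3 h4].
have cd : c + d = 0.
  have hk : (k - 1) * (c + d) = 0 by lra.
  have /eqP := hk; rewrite mulf_eq0 => /orP[/eqP k1|/eqP//].
  have k1' : k = 1 by lra.
  by move: h1; rewrite k1'; lra.
have cE : c = - d by lra.
exists (2 * d); rewrite v0E scaler_vec4 cE.
have ab : a ^+ 2 + b ^+ 2 = 0 by move: e; rewrite cE => <-; ring.
have /andP[/eqP a0 /eqP b0] : (a == 0) && (b == 0).
  by move/eqP: ab; rewrite paddr_eq0 ?sqr_ge0// !sqrf_eq0.
by rewrite a0 b0; congr vec4; field.
Qed.

End Checks.

(* Main.v *)
(* Let W be the group generated by the reflections in the walls of the polyhedron
   0 <= Re z <= 1/2, -2n sqrt 2 - 1/2 <= Im z <= 1/2, |z + k i sqrt 2|^2 + t^2 >= 1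
   (0 <= k <= 2n).  The Gram matrix of the walls has off-diagonal entries 0, -1/2 or
   at most -1, so positive roots have coefficients 0 or at least 1, and a W-orbit
   stays away from the products attained on the polyhedron by a definite gap.
   Applied to the normal N of a prototile and to the light-like vector of oo, the gap
   says that <N, .> = -1 on the vertices of the tile and <= -2 on the rest of the orbit
   V of oo: N supports a facet of the hull of V, and the prototiles cover the polyhedron.
   A finite computation with words in the generators shows Gamma_n <= W and
   W = Gamma_n D_k for the (finite) symmetry group D_k of the k-th prototile, so the
   Gamma_n-translates of the prototiles are the W-translates, and W lies in
   Comm(Gamma_n).  Conversely, the gap forces every parabolic of W to fix a ray of V;
   hence Comm(Gamma_n) preserves the rays of V, and, being discrete, V itself.  So the
   canonical tiling comes from the hull of a multiple of V. *)

Require Import Defs.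
From mathcomp Require Import all_boot all_order all_algebra.
From mathcomp Require Import all_classical all_reals all_analysis.
From mathcomp Require Import complex ring lra zify.

Set Implicit Arguments.
Unset Strict Implicit.
Unset Printing Implicit Defensive.

Import Order.TTheory GRing.Theory Num.Theory.
Import numFieldNormedType.Exports.

Local Open Scope classical_set_scope.
Local Open Scope ring_scope.
Local Open Scope complex_scope.

(** * Reflections of Minkowski space *)

Section Minkowski.
Variable R : realType.
Implicit Types (u v w e : 'cV[R]_4) (k : R) (M : 'M[R]_4).

(** The words are found once for all n because every level is a copy of one of two base groups,
    moved by a vertical translation, possibly composed with complex conjugation. Neighbouring levels
    are linked through the group U_k generated by the three walls orthogonal to the plane Im = - k
    sqrt 2 between tiles k and k+1: D_k and D_(k+1) both lie in Gamma_n U_k, and U_k lies in Gamma_n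
    D_k and in Gamma_n D_(k+1). Hence all the sets Gamma_n D_k coincide, and this common set is
    closed under every wall.

    The gap also yields discreteness: timelike orbits are separated by a definite Euclidean
    distance, which gives local finiteness and a chamber nearest to a given point. Linear forms on
    the hull are controlled by a parabolic: a form bounded below on V is nonnegative on V. Finally,
    the polyhedron lies above height 1/2, so every point p has a v in V with - <p, v> <= 1. If p
    approaches the fixed point of a parabolic of W, this v is moved so little that the gap forces it
    to be fixed. *)

Lemma vec4_ext u v : u 0 0 = v 0 0 -> u 1 0 = v 1 0 -> u 2 0 = v 2 0 ->
  u 3 0 = v 3 0 -> u = v.
Proof.
move=> h0 h1 h2 h3; apply/matrixP => i j; rewrite (ord1 j).
case: i => [[|[|[|[|//]]]] hi].
- by have -> : Ordinal hi = 0 by exact: val_inj.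
- by have -> : Ordinal hi = 1 by exact: val_inj.
- by have -> : Ordinal hi = 2 by exact: val_inj.
- by have -> : Ordinal hi = 3 by exact: val_inj.
Qed.

Lemma minkC u v : mink u v = mink v u.
Proof. by rewrite /mink; ring. Qed.

Lemma minkDl u v w : mink (u + v) w = mink u w + mink v w.
Proof. by rewrite /mink !mxE; ring. Qed.

Lemma minkZl k u v : mink (k *: u) v = k * mink u v.
Proof. by rewrite /mink !mxE; ring. Qed.

Lemma minkDr u v w : mink w (u + v) = mink w u + mink w v.
Proof. by rewrite /mink !mxE; ring. Qed.

Lemma minkZr k u v : mink u (k *: v) = k * mink u v.
Proof. by rewrite /mink !mxE; ring. Qed.

Lemma minkNl u v : mink (- u) v = - mink u v.
Proof. by rewrite /mink !mxE; ring. Qed.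

Lemma minkNr u v : mink u (- v) = - mink u v.
Proof. by rewrite /mink !mxE; ring. Qed.

Lemma mink0l v : mink 0 v = 0.
Proof. by rewrite /mink !mxE; ring. Qed.

Definition minkE := (minkDl, minkDr, minkNl, minkNr, minkZl, minkZr).

Lemma mink_suml (J : Type) (r : seq J) (P : pred J) (F : J -> 'cV[R]_4) v :
  mink (\sum_(j <- r | P j) F j) v = \sum_(j <- r | P j) mink (F j) v.
Proof.
apply: (big_morph (fun u => mink u v)) => [x y|]; [exact: minkDl|exact: mink0l].
Qed.

Definition rfl e : 'M[R]_4 :=
  \matrix_(i, j) (delta_mx j 0 - (2 * mink (delta_mx j 0) e) *: e) i 0.

Lemma mulmx4E m (M : 'M[R]_(m, 4)) v i :
  (M *m v) i 0 = M i 0 * v 0 0 + M i 1 * v 1 0 + M i 2 * v 2 0 + M i 3 * v 3 0.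
Proof.
rewrite mxE !big_ord_recl big_ord0 addr0 !addrA.
by congr (_ + M _ _ * v _ _ + M _ _ * v _ _ + M _ _ * v _ _);
  exact: val_inj.
Qed.

Lemma rflE e v : rfl e *m v = v - (2 * mink v e) *: e.
Proof.
by apply: vec4_ext; rewrite mulmx4E !mxE /mink !mxE /=; ring.
Qed.

Lemma mulmx_inj4 M N : (forall v : 'cV[R]_4, M *m v = N *m v) -> M = N.
Proof.
move=> MN; apply/matrixP => i j.
have := congr1 (fun u : 'cV[R]_4 => u i 0) (MN (delta_mx j 0)).
by rewrite -!colE !mxE.
Qed.

Lemma rfl_mink e v w : mink e e = 1 ->
  mink (rfl e *m v) (rfl e *m w) = mink v w.
Proof.
move=> e1; rewrite !rflE !minkE e1 (minkC e w); ring.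
Qed.

Lemma rflK e : mink e e = 1 -> rfl e *m rfl e = 1%:M.
Proof.
move=> e1; apply: mulmx_inj4 => v; rewrite -mulmxA mul1mx !rflE !minkE e1.
by rewrite -addrA -opprD -scalerDl [X in X *: _](_ : _ = 0) ?scale0r ?subr0//; ring.
Qed.

(* \det (1 - u v) = 1 - v u, read off two factorisations of [[1, u], [v, 1]]. *)
Lemma rfl_det e : mink e e = 1 -> \det (rfl e) = -1.
Proof.
move=> e1.
pose f : 'rV[R]_4 := \row_j (2 * mink (delta_mx j 0) e).
have rE : rfl e = 1%:M - e *m f.
  apply: mulmx_inj4 => v; rewrite rflE mulmxBl mul1mx -mulmxA; congr (_ - _).
  have -> : f *m v = (2 * mink v e)%:M.
    apply/matrixP => i j; rewrite !ord1 mulmx4E /f !mxE /mink !mxE /=; ring.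
  by rewrite mul_mx_scalar.
have fe : f *m e = 2%:M.
  apply/matrixP => i j; rewrite !ord1 mulmx4E /f.
  transitivity (2 * mink e e); last by rewrite e1 mulr1 mxE.
  by rewrite !mxE /mink !mxE /=; ring.
have f1 : block_mx 1%:M 0 f 1%:M *m block_mx 1%:M e 0 (1%:M - f *m e) =
    block_mx 1%:M e f 1%:M.
  by rewrite mulmx_block !mul1mx !mulmx1 ?mul0mx ?mulmx0 ?addr0 addrC subrK.
have f2 : block_mx (1%:M - e *m f) e 0 1%:M *m block_mx 1%:M 0 f 1%:M =
    block_mx 1%:M e f 1%:M.
  by rewrite mulmx_block !mul1mx !mulmx1 ?mul0mx ?mulmx0 ?add0r ?addr0 subrK.
move: (congr1 determinant f1); rewrite -f2.
rewrite !det_mulmx !det_lblock !det_ublock !det1 !mulr1 !mul1r rE => <-.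
by rewrite fe det_mx11 !mxE /=; ring.
Qed.

(** Cauchy-Schwarz for the spatial parts, obtained from Lagrange's identity. *)
Lemma mink_causal_le0 u v : mink u u <= 0 -> 0 <= u 3 0 ->
  mink v v <= 0 -> 0 <= v 3 0 -> mink u v <= 0.
Proof.
rewrite /mink.
move: (u 0 0) (u 1 0) (u 2 0) (u 3 0) => a b c d.
move: (v 0 0) (v 1 0) (v 2 0) (v 3 0) => a' b' c' d' h1 h2 h3 h4.
have dd : 0 <= d * d' by rewrite mulr_ge0.
have le : (a * a' + b * b' + c * c') ^+ 2 <= (d * d') ^+ 2.
  apply: (@le_trans _ _ ((a * a + b * b + c * c) * (a' * a' + b' * b' + c' * c'))).
    rewrite -subr_ge0.
    rewrite [leRHS](_ : _ = (a * b' - b * a') ^+ 2 + (a * c' - c * a') ^+ 2 +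
      (b * c' - c * b') ^+ 2); last by ring.
    by rewrite !addr_ge0 ?sqr_ge0.
  rewrite exprMn !expr2; apply: ler_pM; try lra.
    by rewrite -!expr2 !addr_ge0 ?sqr_ge0.
  by rewrite -!expr2 !addr_ge0 ?sqr_ge0.
rewrite subr_le0; move: (_ + _ + _) (d * d') dd le => x y y0.
by case: (lerP x y) => // yx; rewrite !expr2; nra.
Qed.

End Minkowski.

(** * Orbits of Coxeter groups *)

Section Coxeter.
Variables (R : realType) (I : Type) (e : I -> 'cV[R]_4).

(** The alternative [e i = e j] covers the diagonal, [I] being a bare type. The other three
    correspond to products of two reflections of order 2, 3 and infinity. *)
Definition cox_roots := (forall i, mink (e i) (e i) = 1) /\
  (forall i j, [\/ e i = e j, mink (e i) (e j) = 0, mink (e i) (e j) = - (1 / 2) |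
                   mink (e i) (e j) <= -1]).

Hypothesis eP : cox_roots.

Let e1 i : mink (e i) (e i) = 1. Proof. by case: eP. Qed.

Local Notation r i := (rfl (e i)).

Definition wd (s : seq I) : 'M[R]_4 := \prod_(i <- s) r i.
Definition wgrp : set 'M[R]_4 := range wd.

Definition haslen (w : 'M[R]_4) (k : nat) : bool :=
  `[< exists2 s, size s = k & wd s = w >].
(** Word length in the simple reflections; 0 is a default value outside the group. *)
Definition len (w : 'M[R]_4) : nat :=
  if pselect (exists k, haslen w k) is left h then ex_minn h else 0%N.

Lemma wd_cat s t : wd (s ++ t) = wd s * wd t.
Proof. by rewrite /wd big_cat. Qed.

Lemma wd_rcons s i : wd (rcons s i) = wd s * r i.
Proof. by rewrite -cats1 wd_cat /wd big_seq1. Qed.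

Lemma wd_cons s i : wd (i :: s) = r i * wd s.
Proof. by rewrite /wd big_cons. Qed.

Lemma rr i : r i * r i = 1.
Proof. exact: rflK. Qed.

Lemma mulrr w i : w * r i * r i = w.
Proof. by rewrite -mulrA rr mulr1. Qed.

Lemma wgrp1 : wgrp 1.
Proof. by exists [::] => //; rewrite /wd big_nil. Qed.

Lemma wgrpM w w' : wgrp w -> wgrp w' -> wgrp (w * w').
Proof. by move=> [s _ <-] [t _ <-]; exists (s ++ t); rewrite ?wd_cat. Qed.

Lemma wgrp_r i : wgrp (r i).
Proof. by exists [:: i] => //; rewrite /wd big_seq1. Qed.

Lemma wdV s : wd s * wd (rev s) = 1.
Proof.
elim: s => [|i s IH]; first by rewrite /wd !big_nil mulr1.
by rewrite wd_cons rev_cons wd_rcons mulrA -(mulrA (r i)) IH mulr1 rr.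
Qed.

Lemma wd_inv s : (wd s)^-1 = wd (rev s).
Proof.
have h := wdV (rev s); rewrite revK in h.
have u : wd s \is a GRing.unit by apply/unitrP; exists (wd (rev s)); split; rewrite ?wdV.
by apply: (mulrI u); rewrite divrr// wdV.
Qed.

Lemma wgrpV w : wgrp w -> wgrp w^-1.
Proof. by move=> [s _ <-]; rewrite wd_inv; exists (rev s). Qed.

Lemma wgrp_unit w : wgrp w -> w \is a GRing.unit.
Proof.
move=> [s _ <-]; have h := wdV (rev s); rewrite revK in h.
by apply/unitrP; exists (wd (rev s)); split; rewrite ?wdV.
Qed.

Lemma wgrp_ind (P : 'M[R]_4 -> Prop) :
  P 1 -> (forall w i, wgrp w -> P w -> P (w * r i)) -> forall w, wgrp w -> P w.
Proof.
move=> P1 Pr _ [s _ <-]; elim/last_ind: s => [|s i IH]; first by rewrite /wd big_nil.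
by rewrite wd_rcons; apply: Pr => //; exists s.
Qed.

Lemma wgrp_mink w u v : wgrp w -> mink (w *m u) (w *m v) = mink u v.
Proof.
move=> W; elim/wgrp_ind: w / W u v => [|w i _ IH] u v; first by rewrite !mul1mx.
by rewrite -!mulmxA IH rfl_mink.
Qed.

Lemma lenP w : wgrp w -> exists2 s, size s = len w & wd s = w.
Proof.
move=> [s _ <-]; rewrite /len; case: pselect => [h|[]]; last first.
  by exists (size s); apply/asboolP; exists s.
by case: ex_minnP => k /asboolP.
Qed.

Lemma len_le s : (len (wd s) <= size s)%N.
Proof.
rewrite /len; case: pselect => // h; case: ex_minnP => k _; apply.
by apply/asboolP; exists s.
Qed.

Lemma len_mulr w i : wgrp w -> (len (w * r i) <= (len w).+1)%N.
Proof.
by move=> /lenP[s <- <-]; rewrite -wd_rcons -(size_rcons s i) len_le.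
Qed.

Lemma det_len w : wgrp w -> \det w = (-1) ^+ len w.
Proof.
move=> /lenP[s <- <-]; elim: s => [|i s IH]; first by rewrite /wd big_nil det1.
by rewrite wd_cons det_mulmx IH rfl_det// exprS.
Qed.

(** The length changes by at most one, and the determinant, which has the parity of the length,
    excludes equality. *)
Lemma len_step w i : wgrp w ->
  len (w * r i) = (len w).+1 \/ len w = (len (w * r i)).+1.
Proof.
move=> Ww; have Wr := wgrpM Ww (wgrp_r i).
have h1 := len_mulr i Ww.
have := len_mulr i Wr; rewrite mulrr => h2.
have ne : len (w * r i) <> len w.
  move=> eq; have := det_len Wr; rewrite eq -det_len// det_mulmx rfl_det//.
  move=> d; have : \det w = 0 by lra.
  by apply/eqP; rewrite det_len// signr_eq0.
by move: (len _) (len _) h1 h2 ne => a b; lia.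
Qed.

(** Combinations of simple roots with all coefficients at least 1. They are built as lists in which
    a root may recur, so that a sum is a concatenation and indices need not be compared. *)
Inductive pos : 'cV[R]_4 -> Prop :=
| pos0 : pos 0
| posS c i x of 1 <= c & pos x : pos (c *: e i + x).

Lemma posD x y : pos x -> pos y -> pos (x + y).
Proof.
elim=> [|c i z c1 _ IH] py; first by rewrite add0r.
by rewrite -addrA; apply: posS => //; exact: IH.
Qed.

Lemma posZ c x : 1 <= c -> pos x -> pos (c *: x).
Proof.
move=> c1; elim=> [|d i z d1 _ IH]; first by rewrite scaler0; exact: pos0.
by rewrite scalerDr scalerA; apply: posS => //; rewrite -[leLHS]mulr1 ler_pM.
Qed.

Lemma pos_e i : pos (e i).
Proof. by rewrite -[e i]scale1r -[_ *: _]addr0; apply: posS => //; exact: pos0. Qed.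

Let re i j : r i *m e j = e j - (2 * mink (e i) (e j)) *: e i.
Proof. by rewrite rflE minkC. Qed.

Let rei i : r i *m e i = - e i.
Proof.
rewrite re e1 mulr1 -[X in X - _]scale1r -scalerBl -[RHS]scaleN1r; congr (_ *: _); ring.
Qed.

(** Descent in the infinite dihedral group of x and y. If w ends in [r y], then w = (w [r y]) [r y],
    and [r y] turns the coefficients a >= b of [e x], [e y] into a for [e x] and - 2 <e y, e x> a -
    b >= a for [e y]. The situation recurs for a shorter element with x and y exchanged; k bounds
    the number of rounds. *)
Lemma dihedral_infinite N :
  (forall w i, wgrp w -> (len w < N)%N -> (len w < len (w * r i))%N -> pos (w *m e i)) ->
  forall k w x y (a b : R), (len w < k)%N -> wgrp w -> (len w < N)%N ->
  mink (e x) (e y) <= -1 -> (len w < len (w * r x))%N -> 1 <= b -> b <= a ->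
  pos (w *m (a *: e x + b *: e y)).
Proof.
move=> IHN; elim=> // k IH w x y a b wk Ww wN g lx b1 ba.
have a1 : 1 <= a by apply: le_trans ba.
case: (len_step y Ww) => ly.
  rewrite mulmxDr -!scalemxAr.
  by apply: posD; apply: posZ => //; apply: IHN; rewrite ?ly.
have Wy := wgrpM Ww (wgrp_r y).
rewrite -[w](mulrr _ y) -[_ * _ *m _]mulmxA mulmxDr -!scalemxAr rei re.
rewrite (_ : _ + _ = (- (2 * mink (e y) (e x)) * a - b) *: e y + a *: e x); last first.
  by apply: vec4_ext; rewrite !mxE; ring.
apply: IH => //; try by rewrite ?mulrr; lia.
- by rewrite minkC.
- by rewrite minkC; nra.
Qed.

(* Deodhar's lemma, after Humphreys, Reflection groups and Coxeter groups, 5.4.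
   The coefficients of a positive root are even 0 or >= 1, because the
   off-diagonal Gram entries lie in {0, -1/2} u (-oo, -1]. *)
Lemma pos_root w i : wgrp w -> (len w < len (w * r i))%N -> pos (w *m e i).
Proof.
move: {2}(len w) (leqnn (len w)) => N; elim: N w i => [|N IH] w i wN Ww li.
  have [s] := lenP Ww; move: wN; rewrite leqn0 => /eqP -> /size0nil -> <-.
  by rewrite /wd big_nil mul1mx; exact: pos_e.
have {}IH w' j : wgrp w' -> (len w' < N.+1)%N -> (len w' < len (w' * r j))%N ->
  pos (w' *m e j) by move=> Ww' h; exact: IH.
have [s] := lenP Ww; case/lastP: s => [_|s j].
  by rewrite /wd big_nil => <-; rewrite mul1mx; exact: pos_e.
rewrite size_rcons wd_rcons => ls ws.
have Ws : wgrp (wd s) by exists s.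
have wj : w * r j = wd s by rewrite -ws mulrr.
have lj : (len (wd s) < len w)%N by rewrite -ls ltnS len_le.
move: (wd s) Ws ws wj lj => v Wv vw wv lv {s ls}.
have vN : (len v < N.+1)%N by apply: leq_trans wN.
have vj : (len v < len (v * r j))%N by rewrite vw.
have lw : len w = (len v).+1 by case: (len_step j Wv); rewrite vw; lia.
rewrite -vw -[_ * _ *m _]mulmxA re.
case: eP => _ /(_ j i)[eji|g|g|g].
- have : v = w * r i by rewrite -eji -vw mulrr.
  by move=> h; rewrite -h in li; lia.
- rewrite g mulr0 scale0r subr0.
  have comm : r j * r i = r i * r j.
    apply: mulmx_inj4 => x; rewrite -[LHS]mulmxA -[RHS]mulmxA !rflE !minkE g (minkC (e i)) g.
    by apply: vec4_ext; rewrite !mxE; ring.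
  apply: IH => //; case: (len_step i Wv) => [->//|h].
  have Wvi := wgrpM Wv (wgrp_r i).
  have : (len (w * r i) <= (len (v * r i)).+1)%N.
    by rewrite -vw -mulrA comm mulrA len_mulr.
  by lia.
- rewrite g (_ : e i - _ = e j + e i); last by apply: vec4_ext; rewrite !mxE; field.
  case: (len_step i Wv) => h.
    by rewrite mulmxDr; apply: posD; apply: IH => //; rewrite h.
  (* If v also ends in [r i], then w maps [e i] to the image of [e j] under v [r i]. By the braid
     relation, a descent of v [r i] at j would make w [r i] shorter than w. *)
  have Wvi := wgrpM Wv (wgrp_r i).
  rewrite -[v](mulrr _ i) -[_ * _ *m _]mulmxA mulmxDr rei re minkC g.
  rewrite (_ : e j - _ - _ = e j); last by apply: vec4_ext; rewrite !mxE; field.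
  have braid : r i * (r j * r i) = r j * (r i * r j).
    apply: mulmx_inj4 => x; rewrite -[LHS]mulmxA -[X in _ *m X]mulmxA -[RHS]mulmxA.
    rewrite -[X in _ = _ *m X]mulmxA !rflE !minkE !e1 (minkC (e i) (e j)) g.
    by apply: vec4_ext; rewrite !mxE; field.
  apply: IH => //; first by lia.
  case: (len_step j Wvi) => [->//|h'].
  have Wvij := wgrpM Wvi (wgrp_r j).
  have : (len (w * r i) <= (len (v * r i * r j)).+2)%N.
    have -> : w * r i = v * r i * r j * r i * r j.
      by rewrite -vw -{1}[v](mulrr _ i) -!mulrA braid.
    apply: (leq_trans (len_mulr j _)); first exact: wgrpM (wgrp_r _).
    by rewrite ltnS len_mulr.
  by lia.
- rewrite (_ : e i - _ = (- (2 * mink (e j) (e i))) *: e j + 1 *: e i); last first.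
    by apply: vec4_ext; rewrite !mxE; ring.
  by apply: (dihedral_infinite (N := N.+1) IH (ltnSn _)) => //; lra.
Qed.

(** A vector of the closed chamber whose nonzero products with simple roots are at least m; by
    [pos_dom] the same bound holds for all positive roots. *)
Definition dom (m : R) (x : 'cV[R]_4) :=
  forall i, mink x (e i) = 0 \/ 0 <= m /\ m <= mink x (e i).

Definition dominant (x : 'cV[R]_4) := forall i, 0 <= mink x (e i).

Lemma pos_dom m x u : dom m x -> pos u -> mink x u = 0 \/ 0 <= m /\ m <= mink x u.
Proof.
move=> xm; elim=> [|c i y c1 _ IH]; first by left; rewrite minkC mink0l.
rewrite minkDr minkZr; case: (xm i) => [->|[m0 hi]]; first by rewrite mulr0 add0r.
by right; split=> //; case: IH => [->|[_ IH]]; nra.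
Qed.

(** Applying the letters of a reduced word one at a time, each reflection lowers the product with y
    by 2 <x, b> <y, e i>, where b is a positive root. Each factor is 0 or at least m, respectively
    m', so a strict drop is at least 2 m m'. Without a drop, each letter either fixes the current
    vector or is a mirror through y. *)
Lemma orbit_gap m m' x y w : dom m x -> dom m' y -> 0 <= m -> 0 <= m' -> wgrp w ->
  (mink (w *m x) y = mink x y /\
   exists2 u, generated [set r i | i in [set i | mink y (e i) = 0]] u &
     w *m x = u *m x)
  \/ mink (w *m x) y <= mink x y - 2 * (m * m').
Proof.
move=> dx dy m0 m'0 Ww.
(* The reduced word is that of the inverse of w: its prefixes s are then the elements whose images
   of simple roots have to be positive. *)
have [s ls ws] := lenP (wgrpV Ww).
have {ls} Hs : len (wd s) = size s by rewrite ws.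
have -> : w = wd (rev s) by rewrite -wd_inv ws invrK.
elim/last_ind: s Hs {ws w Ww} => [|s i IH].
  move=> _; left; rewrite /wd big_nil mul1mx; split=> //.
  by exists 1; [exact: generated_one|rewrite mul1mx].
have Ws : wgrp (wd s) by exists s.
rewrite size_rcons wd_rcons rev_rcons wd_cons => Hs.
have Hs' : len (wd s) = size s.
  by have := len_mulr i Ws; have := len_le s; lia.
have /(pos_dom dx) p : pos (wd s *m e i) by apply: pos_root => //; lia.
have pE : mink (wd (rev s) *m x) (e i) = mink x (wd s *m e i).
  have Wr : wgrp (wd (rev s)) by exists (rev s).
  rewrite -(wgrp_mink x _ Wr) mulmxA.
  by have := wdV (rev s); rewrite revK => /(congr1 (fun M => M *m e i)) /=;
    rewrite mul1mx => ->.
rewrite -mulmxA.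
have st : mink (r i *m (wd (rev s) *m x)) y =
    mink (wd (rev s) *m x) y - 2 * (mink x (wd s *m e i) * mink y (e i)).
  by rewrite rflE minkDl minkNl minkZl pE (minkC (e i)); ring.
rewrite st; case: (IH Hs') => [[eq [u Gu uE]]|le]; last first.
  right; case: p => [->|[_ p]]; first by rewrite mul0r mulr0 subr0.
  by case: (dy i) => [->|[_ d]]; [rewrite mulr0 mulr0 subr0|nra].
rewrite eq; case: (dy i) => [yi|[_ d]].
  left; rewrite yi !mulr0 subr0; split=> //.
  exists (r i * u); last by rewrite uE mulmxA.
  by apply: generated_mul => //; apply: generated_incl; exists i.
case: p => [p|[_ p]]; last by right; nra.
left; rewrite p mul0r mulr0 subr0; split=> //; exists u => //.
by rewrite rflE pE p mulr0 scale0r subr0.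
Qed.

End Coxeter.

(** * Hulls of light-like orbits *)

Section Cones.
Variable R : realType.
Implicit Types (S V : set 'cV[R]_4) (u v x y N : 'cV[R]_4) (l : 'rV[R]_4).

(** Nonnegative combinations of S together with their total weight w. Weight 1 gives the convex
    hull, arbitrary weight the cone, and the homogeneity in [wconeZ] passes between the two. *)
Inductive wcone S : R -> 'cV[R]_4 -> Prop :=
| wcone0 : wcone S 0 0
| wconeS c v w x of 0 <= c & S v & wcone S w x : wcone S (c + w) (c *: v + x).

Lemma wcone_ge0 S w x : wcone S w x -> 0 <= w.
Proof. by elim=> // c v w' x' c0 _ _ IH; rewrite addr_ge0. Qed.

Lemma wconeD S w x w' x' : wcone S w x -> wcone S w' x' -> wcone S (w + w') (x + x').
Proof.
move=> h1 h; elim: h1 => [|c v w0 x0 c0 Sv _ IH]; first by rewrite !add0r.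
by rewrite -!addrA; exact: wconeS.
Qed.

Lemma wcone1 S v : S v -> wcone S 1 v.
Proof.
by move=> Sv; have := wconeS ler01 Sv (wcone0 S); rewrite scale1r !addr0.
Qed.

Lemma wconeZ S k w x : 0 <= k -> wcone S w x -> wcone S (k * w) (k *: x).
Proof.
move=> k0; elim=> [|c v w' x' c0 Sv _ IH]; first by rewrite mulr0 scaler0; exact: wcone0.
by rewrite mulrDr scalerDr scalerA; apply: wconeS => //; rewrite mulr_ge0.
Qed.

Lemma wcone_map S S' k k' (f : 'cV[R]_4 -> 'cV[R]_4) :
  (forall c x y, f (c *: x + y) = c *: f x + f y) -> 0 <= k ->
  (forall v, S v -> wcone S' k (k' *: f v)) ->
  forall w x, wcone S w x -> wcone S' (k * w) (k' *: f x).
Proof.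
move=> fl k0 SS' w x; elim=> [|c v w' x' c0 Sv _ IH].
  (* Linearity at these arguments is what gives [f 0 = 0]. *)
  have := fl (-1) 0 0; rewrite scaler0 addr0 scaleN1r addNr => ->.
  by rewrite mulr0 scaler0; exact: wcone0.
rewrite fl mulrDr scalerDr; apply: wconeD => //.
by rewrite scalerA (mulrC k') -scalerA (mulrC k); apply: wconeZ => //; exact: SS'.
Qed.

Lemma wcone_sub S S' w x : S `<=` S' -> wcone S w x -> wcone S' w x.
Proof.
by move=> SS'; elim=> [|c v w' x' c0 /SS' Sv _ IH]; [exact: wcone0|exact: wconeS].
Qed.

Lemma wcone_w0 S w x : wcone S w x -> w = 0 -> x = 0.
Proof.
elim=> // c v w' x' c0 _ h IH e.
have w'0 := wcone_ge0 h.
have c'0 : c = 0 by lra.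
have e' : w' = 0 by lra.
by rewrite IH// c'0 scale0r add0r.
Qed.

Lemma chullP S x : chull S x <-> wcone S 1 x.
Proof.
split.
  move=> [m [a [p [a0 <- pS ->]]]].
  elim: m a p a0 pS => [|m IH] a p a0 pS; first by rewrite !big_ord0; exact: wcone0.
  by rewrite !big_ord_recl; apply: wconeS => //; exact: IH.
suff : forall w, wcone S w x -> exists m (a : 'I_m -> R) (p : 'I_m -> 'cV[R]_4),
   [/\ forall k, 0 <= a k, \sum_k a k = w, forall k, S (p k) & x = \sum_k a k *: p k].
  by move=> h /h.
move=> w; elim=> {x} [|c v w' x c0 Sv _ [m [a [p [a0 <- pS ->]]]]].
  exists 0%N, (fun=> 0), (fun=> 0); split=> //; try by case.
    by rewrite big_ord0.
  by rewrite big_ord0.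
exists m.+1, (fun i => if unlift ord0 i is Some j then a j else c),
  (fun i => if unlift ord0 i is Some j then p j else v); split.
- by move=> i; case: unliftP.
- rewrite big_ord_recl unlift_none; congr (_ + _).
  by apply: eq_bigr => i _; rewrite liftK.
- by move=> i; case: unliftP.
- rewrite big_ord_recl unlift_none; congr (_ + _).
  by apply: eq_bigr => i _; rewrite liftK.
Qed.

Lemma radialP S x :
  radial (chull S) x <-> H3 x /\ exists2 w, 0 < w & wcone S w x.
Proof.
split=> [[Hx [k k0 /chullP h]]|[Hx [w w0 h]]]; split=> //.
  exists k^-1; first by rewrite invr_gt0.
  have k1 : 0 <= k^-1 by rewrite invr_ge0 ltW.
  have := wconeZ k1 h.
  by rewrite mulr1 scalerA mulVf ?scale1r// gt_eqF.
exists w^-1; first by rewrite invr_gt0.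
apply/chullP; rewrite -[1](@mulVf _ w) ?gt_eqF//.
by apply: wconeZ => //; rewrite invr_ge0 ltW.
Qed.

Lemma H3_neq0 x : H3 x -> x <> 0.
Proof. by move=> [_ x0] x0'; move: x0; rewrite x0' mxE ltxx. Qed.

Lemma radialP0 S x : radial (chull S) x <-> H3 x /\ exists w, wcone S w x.
Proof.
rewrite radialP; split=> [[Hx [w _ h]]|[Hx [w h]]]; split=> //; exists w => //.
rewrite lt0r (wcone_ge0 h) andbT; apply/eqP => w0.
exact: H3_neq0 Hx (wcone_w0 h w0).
Qed.

Lemma wcone_mink S N w x : (forall v, S v -> mink N v = -1) -> wcone S w x ->
  mink N x = - w.
Proof.
move=> SN; elim=> [|c v w' x' _ /SN Sv _ IH]; first by rewrite minkC mink0l oppr0.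
by rewrite minkDr minkZr Sv IH; ring.
Qed.

Lemma wcone_mink_le S N w x : (forall v, S v -> mink N v <= -1) -> wcone S w x ->
  mink N x <= - w.
Proof.
move=> SN; elim=> [|c v w' x' c0 /SN Sv _ IH]; first by rewrite minkC mink0l oppr0.
by rewrite minkDr minkZr; nra.
Qed.

(** The inequality holds summand by summand, so equality for the sum leaves no weight on vectors off
    the face. *)
Lemma wcone_face S N w x : (forall v, S v -> mink N v <= -1) -> wcone S w x ->
  mink N x = - w -> wcone [set v | S v /\ mink N v = -1] w x.
Proof.
move=> SN; elim=> [_|c v w' x' c0 Sv h IH]; first exact: wcone0.
have Nv := SN _ Sv; have Nx := wcone_mink_le SN h.
rewrite minkDr minkZr => e.
have e' : mink N x' = - w' by nra.
have : c * (mink N v + 1) = 0 by nra.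
move/eqP; rewrite mulf_eq0 => /orP[/eqP c00|/eqP Nv1].
  by rewrite c00 scale0r !add0r; exact: IH.
by apply: wconeS; [|split=> //; lra|exact: IH].
Qed.

Lemma wcone_causal S w x : S `<=` @Lplus R -> wcone S w x ->
  mink x x <= 0 /\ 0 <= x 3 0.
Proof.
move=> SL; elim=> [|c v w' x' c0 /SL[v0 v3] _ [xx x3]].
  by rewrite mink0l mxE.
split; last by rewrite !mxE addr_ge0// mulr_ge0.
have : mink v x' <= 0 by apply: mink_causal_le0 => //; rewrite v0.
by rewrite !minkE v0 (minkC x'); nra.
Qed.

(** Subtracting from v the multiple of u with the same time coordinate leaves a purely spatial
    vector of norm 0. *)
Lemma lightlike_orth u v : Lplus u -> Lplus v -> mink u v = 0 -> u != 0 ->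
  0 < u 3 0 /\ v = (v 3 0 / u 3 0) *: u.
Proof.
move=> [uu u3] [vv v3] uv u0.
have u3p : 0 < u 3 0.
  rewrite lt0r u3 andbT; apply: contra u0 => /eqP u30; apply/eqP.
  move: uu; rewrite /mink u30 => h.
  have h' : (u 0 0) ^+ 2 + (u 1 0) ^+ 2 + (u 2 0) ^+ 2 = 0 by rewrite !expr2; lra.
  move/eqP: h'; rewrite paddr_eq0 ?addr_ge0 ?sqr_ge0//.
  rewrite paddr_eq0 ?sqr_ge0// !sqrf_eq0 => /andP[/andP[/eqP ? /eqP ?] /eqP ?].
  by apply: vec4_ext; rewrite mxE.
split=> //; set k := _ / _.
have kE : v 3 0 = k * u 3 0 by rewrite /k divfK ?gt_eqF.
have : mink (v - k *: u) (v - k *: u) = 0.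
  by rewrite !minkE vv uu (minkC v) uv; ring.
rewrite /mink !mxE -kE subrr mulr0 subr0 -!expr2 => /eqP.
rewrite paddr_eq0 ?addr_ge0 ?sqr_ge0//.
rewrite paddr_eq0 ?sqr_ge0// !sqrf_eq0 !subr_eq0 => /andP[/andP[/eqP ? /eqP ?] /eqP ?].
by apply: vec4_ext; rewrite mxE.
Qed.

Definition lrow N : 'rV[R]_4 := \row_j mink N (delta_mx j 0).

Lemma lrowE N x : (lrow N *m x) 0 0 = mink N x.
Proof. by rewrite mulmx4E !mxE /mink !mxE /=; ring. Qed.

Lemma row_mulD l x y : (l *m (x + y)) 0 0 = (l *m x) 0 0 + (l *m y) 0 0.
Proof. by rewrite mulmxDr [LHS]mxE. Qed.

Lemma row_mulZ l c x : (l *m (c *: x)) 0 0 = c * (l *m x) 0 0.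
Proof. by rewrite -scalemxAr [LHS]mxE. Qed.

(** Openness of the future cone in the direction d, with an explicit step. *)
Lemma timelike_perturb b d : mink b b < 0 -> 0 < b 3 0 ->
  exists2 k : R, 0 < k & mink (b + k *: d) (b + k *: d) < 0 /\ 0 < (b + k *: d) 3 0.
Proof.
move=> bb b3.
have small (s D : R) : 0 < s -> 0 <= D ->
    exists2 k, 0 < k <= 1 & forall k', 0 < k' -> k' <= k -> k' * D < s.
  move=> s0 D0; have sD : 0 < s + D by rewrite ltr_wpDr.
  exists (s / (s + D)) => [|k' k'0].
    by rewrite divr_gt0//= ler_pdivrMr// mul1r lerDl.
  rewrite ler_pdivlMr// => h.
  rewrite mulrDr in h; nra.
have D0 : 0 <= 2 * `|mink b d| + `|mink d d|.
  by rewrite addr_ge0 ?mulr_ge0.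
have [k /andP[k0 k1] kP] := small (- mink b b) _ ltac:(lra) D0.
have [k' /andP[k'0 k'1] k'P] := small (b 3 0) `|d 3 0| b3 (normr_ge0 _).
exists (Num.min k k'); first by rewrite lt_min k0.
have m0 : 0 < Num.min k k' by rewrite lt_min k0.
have mk : Num.min k k' <= k by rewrite ge_min lexx.
have mk' : Num.min k k' <= k' by rewrite ge_min lexx orbT.
have := k'P _ m0 mk'; have := kP _ m0 mk.
have m1 : Num.min k k' <= 1 by rewrite ge_min k1.
move: (Num.min k k') m0 m1 {mk mk'} => m m0 m1 h h'.
have hd := lerNnormlW (lexx `|d 3 0|).
have h1 := ler_norm (mink b d); have h2 := ler_norm (mink d d).
split; last by rewrite !mxE; nra.
have n2 : 0 <= `|mink d d| by [].
rewrite !minkE (minkC d b).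
have e1 : m * (m * mink d d) <= m * `|mink d d|.
  by rewrite ler_pM2l//; nra.
have e2 : m * mink b d <= m * `|mink b d| by rewrite ler_pM2l.
lra.
Qed.

End Cones.

(** * Facets of a hull, recovered from a family of normals *)

Section EpsteinPenner.
Variables (R : realType) (V NN : set 'cV[R]_4).

Definition face_verts (N : 'cV[R]_4) : set 'cV[R]_4 :=
  [set u | V u /\ mink N u = -1].

Definition tile_of (N : 'cV[R]_4) : set 'cV[R]_4 := radial (chull (face_verts N)).

(* NN consists of the normals of the facets of the hull of V. *)
Definition facet_normals :=
  [/\ V `<=` @Lplus R,
      forall N u, NN N -> V u -> mink N u <= -1,
      forall x, H3 x -> exists2 N, NN N & exists w, wcone (face_verts N) w x,
      forall N, NN N -> affdim_ge3 (face_verts N) &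
      forall (l : 'rV[R]_4) a, (forall u, V u -> a <= (l *m u) 0 0) ->
        forall u, V u -> 0 <= (l *m u) 0 0].

Hypothesis VN : facet_normals.

Let tile_ofP N x : tile_of N x <-> H3 x /\ exists w, wcone (face_verts N) w x.
Proof. exact: radialP0. Qed.

Let fvE N w x : wcone (face_verts N) w x -> mink N x = - w.
Proof. by apply: wcone_mink => v []. Qed.

Let fv_le N N' w x : NN N' -> wcone (face_verts N) w x -> mink N' x <= - w.
Proof. by case: VN => _ h _ _ _ N'N; apply: wcone_mink_le => v [Vv _]; exact: h. Qed.

(** A point of weight w in the first tile has product - w with N and at most - w with N'. So the
    form N - N' is nonnegative there and vanishes exactly on the common part. *)
Let face_tile N N' : NN N -> NN N' -> is_face (tile_of N) (tile_of N `&` tile_of N').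
Proof.
move=> NNN NNN'; exists (lrow (N - N')).
have lE x : (lrow (N - N') *m x) 0 0 = mink N x - mink N' x.
  by rewrite lrowE minkDl minkNl.
split=> [x /tile_ofP[Hx [w xw]]|].
  by rewrite lE (fvE xw); have := fv_le NNN' xw; lra.
apply/seteqP; split=> x /= [/tile_ofP[Hx [w xw]] h]; (split; first by apply/tile_ofP; split=> //; exists w).
  move: h => /tile_ofP[_ [w' xw']].
  rewrite lE (fvE xw) (fvE xw').
  have := fv_le NNN xw'; have := fv_le NNN' xw.
  by rewrite (fvE xw) (fvE xw'); lra.
move: h; rewrite lE => h; apply/tile_ofP; split=> //; exists w.
have e : mink N' x = - w by have := fvE xw; lra.
have le v : face_verts N v -> mink N' v <= -1.
  by case: VN => _ h' _ _ _ [Vv _]; exact: h'.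
by apply: wcone_sub (wcone_face le xw e) => v [[Vv _] ?].
Qed.

(** On the tile of N, the product with N is the largest among all normals. Comparing it with one
    fixed normal N0 is therefore a necessary condition for the tile of N to come near x. *)
Definition normals_locally_finite := forall N0 x, NN N0 -> H3 x ->
  exists2 U, nbhs x U &
    finite_set [set N | NN N /\ exists2 p, U p /\ H3 p & mink N0 p <= mink N p].

Lemma tiling_of_normals : normals_locally_finite -> is_tiling [set tile_of N | N in NN].
Proof.
move=> lf; have [_ h2 h3 _ _] := VN; split.
- apply/seteqP; split=> [x [_ [N _ <-]] /tile_ofP[]//|x Hx].
  have [N NNN xN] := h3 _ Hx; exists (tile_of N); first by exists N.
  by apply/tile_ofP.
- move=> x Hx; have [N0 NN0 _] := h3 _ Hx.
  have [U xU fU] := lf _ _ NN0 Hx; exists U => //.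
  apply: sub_finite_set (finite_image tile_of fU).
  move=> _ [[N NNN <-] [p [/tile_ofP[Hp [w pw]] Up]]].
  exists N => //; split=> //; exists p => //.
  by rewrite (fvE pw); exact: fv_le pw.
- move=> _ _ [N NNN <-] [N' NNN' <-]; split; first exact: face_tile.
  by rewrite setIC; exact: face_tile.
Qed.

Let fl_id (c : R) (x y : 'cV[R]_4) : idfun (c *: x + y) = c *: idfun x + idfun y.
Proof. by []. Qed.

Let chull_scale (k : R) x : 0 < k -> chull [set k *: u | u in V] x <-> wcone V k x.
Proof.
move=> k0; rewrite chullP; split=> h.
  have := @wcone_map _ _ V k 1 idfun fl_id (ltW k0) _ _ _ h.
  rewrite mulr1 scale1r; apply=> _ [u Vu <-]; rewrite scale1r /= -[X in wcone _ X]mulr1.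
  by apply: wconeZ (ltW k0) _; exact: wcone1.
have k'0 : 0 <= k^-1 by rewrite invr_ge0 ltW.
have := @wcone_map _ _ [set k *: u | u in V] k^-1 1 idfun fl_id k'0 _ _ _ h.
rewrite mulVf ?gt_eqF// scale1r; apply=> u Vu; rewrite scale1r /= -[k^-1]mulr1.
rewrite -[u](@scalerK _ _ k) ?gt_eqF//.
by apply: wconeZ => //; apply: wcone1; exists u.
Qed.

Let hull k := chull [set k *: u | u in V].

Let facet k N : hull k `&` [set x | mink N x = - k] = hull k `&` [set x | (- lrow N *m x) 0 0 = k].
Proof.
by apply/seteqP; split=> x /= [h e]; split=> //; move: e; rewrite mulNmx mxE lrowE => ?; lra.
Qed.

Let radial_facet (k : R) N : 0 < k -> NN N ->
  radial (hull k `&` [set x | mink N x = - k]) = tile_of N.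
Proof.
move=> k0 NNN; have [_ h2 _ _ _] := VN.
apply/seteqP; split=> x.
  move=> [Hx [c c0 [/(chull_scale _ k0) h /= e]]]; apply/tile_ofP; split=> //.
  exists (c^-1 * k); rewrite -[x](@scalerK _ _ c) ?gt_eqF//.
  apply: wconeZ; first by rewrite invr_ge0 ltW.
  by apply: (wcone_face _ h) => // v; exact: h2.
move=> /radialP[Hx [w w0 h]]; split=> //; exists (k / w); first by rewrite divr_gt0.
split; last by rewrite /= minkZr (fvE h); field; rewrite gt_eqF.
apply/chull_scale => //; rewrite -[X in wcone _ X](@divfK _ w) ?gt_eqF//.
apply: wconeZ; first by rewrite ltW// divr_gt0.
by apply: wcone_sub h => v [].
Qed.

Let affdim_facet (k : R) N : 0 < k -> NN N ->
  affdim_ge3 (hull k `&` [set x | mink N x = - k]).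
Proof.
move=> k0 NNN; have [_ _ _ h4 _] := VN; have [p [pN rk]] := h4 _ NNN.
exists (fun i => k *: p i); split.
  move=> i; have [Vp Np] := pN i; split; last by rewrite /= minkZr Np; ring.
  by apply/chull_scale => //; rewrite -[X in wcone _ X]mulr1; apply: wconeZ (ltW k0) _; exact: wcone1.
rewrite -rk -[RHS](mxrank_scale_nz _ (_ : k != 0)) ?gt_eqF//; congr mxrank.
by apply/matrixP => i j; rewrite !mxE mulrBr.
Qed.

Let rank1 (p : 'I_4 -> 'cV[R]_4) (c : 'I_4 -> R) d : (forall i, p i = c i *: d) ->
  \rank (\matrix_(k, j) (p k j 0 - p 0 j 0)) <> 3.
Proof.
move=> pE rk.
suff : (\rank (\matrix_(k, j) (p k j 0 - p 0 j 0))%R <= 1)%N by rewrite rk.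
rewrite (_ : \matrix_(k, j) _ = (\col_k (c k - c 0)) *m d^T); last first.
  by apply/matrixP => i j; rewrite !mxE big_ord1 !pE !mxE; ring.
exact: leq_trans (mxrankM_maxl _ _) (rank_leq_col _).
Qed.

Let hull_causal (k : R) x : 0 < k -> hull k x -> mink x x <= 0 /\ 0 <= x 3 0.
Proof. by move=> k0 /(chull_scale _ k0); case: VN => VL _ _ _ _; exact: wcone_causal. Qed.

(** The points are causal, so all mutual products are at most 0. If their sum were null, all these
    products would vanish and the points would be null and proportional to one vector, leaving
    affine rank at most 1. *)
Let bary_timelike (k : R) (p : 'I_4 -> 'cV[R]_4) : 0 < k -> (forall i, hull k (p i)) ->
  \rank (\matrix_(k, j) (p k j 0 - p 0 j 0)) = 3 ->
  mink (\sum_i p i) (\sum_i p i) < 0 /\ 0 < (\sum_i p i) 3 0.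
Proof.
move=> k0 pC rk; set b := \sum_i p i.
have pp i j : mink (p i) (p j) <= 0.
  have [? ?] := hull_causal k0 (pC i); have [? ?] := hull_causal k0 (pC j).
  exact: mink_causal_le0.
have pb i : mink (p i) b <= 0.
  by rewrite minkC mink_suml; apply: sumr_le0 => j _.
have bb : mink b b = \sum_i mink (p i) b by rewrite {1}/b mink_suml.
have bb0 : mink b b <= 0 by rewrite bb; apply: sumr_le0.
have p3 i : 0 <= p i 3 0 by have [] := hull_causal k0 (pC i).
have b3E : b 3 0 = \sum_i p i 3 0 by rewrite /b summxE.
have b3 : 0 <= b 3 0 by rewrite b3E; apply: sumr_ge0.
have bbN : ~ (mink b b = 0).
  move=> b0; have pb0 i : mink (p i) b = 0.
    apply/eqP; rewrite -oppr_eq0; move: b0; rewrite bb => /eqP.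
    by rewrite -oppr_eq0 -sumrN psumr_eq0 => [/allP/(_ i (mem_index_enum _))//|j _]; rewrite oppr_ge0.
  have ppi i : mink (p i) (p i) = 0.
    apply/eqP; rewrite -oppr_eq0; move: (pb0 i); rewrite minkC mink_suml => /eqP.
    rewrite -oppr_eq0 -sumrN psumr_eq0 => [/allP/(_ i (mem_index_enum _))//|j _].
    by rewrite oppr_ge0.
  have [b00|bn] := eqVneq b 0.
    apply: (rank1 (c := fun=> 0) (d := 0) _ rk) => i; rewrite scaler0.
    apply/eqP; apply: contraTT isT => pn; have Lp : Lplus (p i) by split.
    have [h _] := lightlike_orth Lp Lp (ppi i) pn.
    have : \sum_j p j 3 0 = 0 by rewrite -b3E b00 mxE.
    move/eqP; rewrite psumr_eq0 => [/allP/(_ i (mem_index_enum _))/=/eqP e|j _//].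
    by rewrite e ltxx in h.
  apply: (rank1 (c := fun i => p i 3 0 / b 3 0) (d := b) _ rk) => i.
  have Lb : Lplus b by split.
  have Lp : Lplus (p i) by split.
  have bp : mink b (p i) = 0 by rewrite minkC.
  by have [_] := lightlike_orth Lb Lp bp bn.
have b3n : b 3 0 <> 0.
  move=> b30; apply: bbN; move: bb0; rewrite /mink b30.
  have := sqr_ge0 (b 0 0); have := sqr_ge0 (b 1 0); have := sqr_ge0 (b 2 0).
  by rewrite !expr2; lra.
by rewrite !lt_neqAle bb0 b3 !andbT; split; apply/eqP => // /esym.
Qed.

Let timelike_cover b : mink b b < 0 -> 0 < b 3 0 ->
  exists2 N, NN N & exists w, wcone (face_verts N) w b.
Proof.
move=> bb b3; have [_ _ h3 _ _] := VN.
set s := Num.sqrt (- mink b b).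
have s0 : 0 < s by rewrite sqrtr_gt0 oppr_gt0.
have sN : s != 0 by rewrite gt_eqF.
have ss : s * s = - mink b b by rewrite -expr2 sqr_sqrtr// oppr_ge0 ltW.
have [|N NNN [w h]] := h3 (s^-1 *: b).
  split; last by rewrite mxE mulr_gt0 ?invr_gt0.
  by rewrite !minkE -[mink b b]opprK -ss; field.
exists N => //; exists (s * w).
by rewrite -[b](@scalerKV _ _ s)//; apply: wconeZ h; exact: ltW.
Qed.

Let l_timelike (l : 'rV[R]_4) b : (forall u, V u -> 0 <= (l *m u) 0 0) ->
  mink b b < 0 -> 0 < b 3 0 -> 0 <= (l *m b) 0 0.
Proof.
move=> l0 bb b3; have [N _ [w h]] := timelike_cover bb b3.
elim: h => [|c v w' x c0 [Vv _] _ IH]; first by rewrite mulmx0 mxE.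
by rewrite row_mulD row_mulZ addr_ge0// mulr_ge0//; exact: l0.
Qed.

(** The affine span of the four points lies in the hyperplane l = a, which misses the origin, so
    affine independence becomes linear independence. In matrix terms: were l' nonzero, the rows of P
    would span the same space as their differences, on which l vanishes. *)
Let indep (p : 'I_4 -> 'cV[R]_4) (l l' : 'rV[R]_4) a : a != 0 ->
  (forall i, (l *m p i) 0 0 = a) -> (forall i, (l' *m p i) 0 0 = 0) ->
  \rank (\matrix_(k, j) (p k j 0 - p 0 j 0)) = 3 -> l' = 0.
Proof.
move=> a0 la l'0; set D := \matrix_(_, _) _ => rk.
pose P : 'M[R]_4 := \matrix_(k, j) p k j 0.
have Pm (m : 'rV[R]_4) i : (P *m m^T) i 0 = (m *m p i) 0 0.
  by rewrite !mxE; apply: eq_bigr => j _; rewrite !mxE mulrC.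
have DP : (D <= P)%MS.
  apply/row_subP => i; rewrite (_ : row i D = row i P - row 0 P).
    by rewrite addmx_sub ?eqmx_opp ?row_sub.
  by apply/rowP => j; rewrite !mxE.
apply/eqP; apply: contraTT isT => l'N.
have rP : (\rank P <= 3)%N.
  have : (\rank P < 4)%N; last by [].
  rewrite ltn_neqAle rank_leq_row andbT; apply: contra l'N => /eqP rP4.
  have Pu : P \in unitmx by rewrite -row_free_unit /row_free rP4.
  have : P *m l'^T = 0 by apply/matrixP => i j; rewrite ord1 Pm l'0 mxE.
  by move/(congr1 (mulmx (invmx P))); rewrite mulKmx// mulmx0 => /(congr1 trmx);
    rewrite trmxK trmx0 => ->.
have PD : (P <= D)%MS.
  by have := mxrank_leqif_eq DP => -[]; rewrite rk => h; rewrite eqn_leq rP h => /esym/andP[].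
have /submxP[x xE] : (row 0 P <= D)%MS by apply: submx_trans PD; exact: row_sub.
have Dl : D *m l^T = 0.
  apply/matrixP => i j; rewrite ord1 [RHS]mxE.
  have -> : (D *m l^T) i 0 = (P *m l^T) i 0 - (P *m l^T) 0 0.
    by rewrite !mxE -sumrB; apply: eq_bigr => k _; rewrite !mxE; ring.
  by rewrite !Pm !la subrr.
have : (row 0 P *m l^T) 0 0 = a by rewrite -row_mul mxE Pm la.
by rewrite xE -mulmxA Dl mulmx0 mxE => e; rewrite -e eqxx in a0.
Qed.

(** A facet l = a contains four affinely independent points, whose sum is timelike and so lies in
    the cone over the tile of some N. Comparing weights there forces all four points onto the facet
    of N, and then l is a multiple of the form of N. The facets scale along with V, so every k > 0
    is treated at once. *)
Lemma facets_of_normals (k : R) : 0 < k ->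
  [set radial F | F in face3 (chull [set k *: u | u in V])] = [set tile_of N | N in NN].
Proof.
move=> k0; have [VL h2 h3 h4 h5] := VN; apply/seteqP; split; last first.
  move=> _ [N NNN <-]; exists (hull k `&` [set x | mink N x = - k]); last exact: radial_facet.
  exists (- lrow N), k; split.
  - rewrite oppr_eq0; apply/eqP => l0; have [p [/(_ 0)[_ Np] _]] := h4 _ NNN.
    by move: Np; rewrite -lrowE l0 mul0mx mxE; lra.
  - move=> x /(chull_scale _ k0) h; rewrite mulNmx mxE lrowE.
    by have := wcone_mink_le (h2 _ ^~ NNN) h; lra.
  - by rewrite facet.
  - exact: affdim_facet.
move=> _ [F [l [a [l0 la -> [p [pF rk]]]]] <-].
have pC i : hull k (p i) by have [] := pF i.
have lp i : (l *m p i) 0 0 = a by have [] := pF i.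
have [bb b3] := bary_timelike k0 pC rk.
have lV u : V u -> a / k <= (l *m u) 0 0.
  move=> Vu; have : hull k (k *: u).
    apply/chull_scale => //; rewrite -[X in wcone _ X]mulr1.
    by apply: wconeZ (ltW k0) _; exact: wcone1.
  by move/la; rewrite row_mulZ ler_pdivrMr// mulrC.
have lV0 := h5 _ _ lV.
have lcone w x : wcone V w x -> w * (a / k) <= (l *m x) 0 0 /\ 0 <= (l *m x) 0 0.
  elim=> [|c v w' x' c0 Vv _ [IH IH']]; first by rewrite mul0r mulmx0 mxE.
  have := lV _ Vv; have := lV0 _ Vv; rewrite row_mulD row_mulZ.
  by move=> ? ?; split; nra.
have [N NNN [w bw]] := timelike_cover bb b3.
have lb : (l *m \sum_i p i) 0 0 = 4 * a.
  rewrite mulmx_sumr summxE (eq_bigr (fun=> a)) // sumr_const card_ord.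
  by rewrite mulr_natl.
have a0 : 0 <= a.
  by have /(chull_scale _ k0)/lcone := pC 0; rewrite lp => -[].
(* If a = 0, then l vanishes at the sum of the points, which is interior to the future cone, where l
   is nonnegative. Moving in the directions d and - d then gives l = 0. *)
have {a0} a0 : 0 < a.
  rewrite lt0r a0 andbT; apply/eqP => a00; case/eqP: l0.
  apply/rowP => j; rewrite mxE.
  pose d : 'cV[R]_4 := delta_mx j 0.
  have -> : l 0 j = (l *m d) 0 0 by rewrite -colE mxE.
  have [e e0 [e1 e2]] := timelike_perturb d bb b3.
  have [e' e'0 [e'1 e'2]] := timelike_perturb (- d) bb b3.
  have := l_timelike lV0 e1 e2; have := l_timelike lV0 e'1 e'2.
  rewrite -scaleN1r !row_mulD !row_mulZ lb a00 mulr0 !add0r => u1 u2.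
  rewrite pmulr_rge0// in u2; rewrite pmulr_rge0// in u1.
  by apply/eqP; rewrite eq_le u2 andbT; lra.
have pN i : mink N (p i) <= - k.
  by have /(chull_scale _ k0) := pC i; apply: wcone_mink_le => v; exact: h2.
(* The sum has weight w over the vertices of N, and l bounds w by 4 k. So the four products, each at
   most - k, add up to at least - 4 k. *)
have pNk i : mink N (p i) = - k.
  have bN := fvE bw; rewrite minkC mink_suml in bN.
  have lw : w * (a / k) <= 4 * a.
    by rewrite -lb; apply: (lcone w _ _).1; apply: wcone_sub bw => v [].
  have {lw} lw : w <= 4 * k.
    by move: lw; rewrite mulrA ler_pdivrMr// => ?; nra.
  have : \sum_i (- k - mink N (p i)) <= 0.
    rewrite sumrB sumr_const card_ord (eq_bigr (fun i => mink (p i) N)).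
      by rewrite bN -mulr_natl; lra.
    by move=> j _; rewrite minkC.
  move=> s; have : \sum_i (- k - mink N (p i)) = 0.
    by apply/eqP; rewrite eq_le s; apply: sumr_ge0 => j _; have := pN j; lra.
  move/eqP; rewrite psumr_eq0; last by move=> j _; have := pN j; lra.
  by move=> /allP/(_ i (mem_index_enum _))/=; rewrite subr_eq0 => /eqP.
have /eqP : k *: l + a *: lrow N = 0.
  apply: (indep (lt0r_neq0 a0) lp _ rk) => i.
  by rewrite mulmxDl -!scalemxAl mxE [in X in X + _]mxE lp [in X in _ + X]mxE lrowE pNk; ring.
rewrite addr_eq0 => /eqP lN.
have lNx x : k * (l *m x) 0 0 = - (a * mink N x).
  have := congr1 (fun m : 'rV_4 => (m *m x) 0 0) lN.
  by rewrite /= mulNmx -!scalemxAl mxE => ->; rewrite mxE [in X in - X]mxE lrowE.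
exists N => //; rewrite -(radial_facet k0 NNN); congr radial.
apply/seteqP; split=> x /= [xC e]; split=> //; have := lNx x.
  rewrite e => h.
  by apply: (mulfI (lt0r_neq0 k0)); lra.
rewrite e => h.
by apply: (mulfI (lt0r_neq0 a0)); lra.
Qed.

End EpsteinPenner.

(** * Discreteness of orbits *)

Section FiniteSets.

Lemma finite_set_max (T : choiceType) (R : realType) (S : set T) (f : T -> R) :
  finite_set S -> S !=set0 -> exists2 x, S x & forall y, S y -> f y <= f x.
Proof.
move=> /finite_seqP[s ->] [x0 x0s].
suff : exists2 x, x \in s & forall y, y \in s -> f y <= f x by [].
elim: s x0 x0s => [//|a s IH] _ _.
case: s IH => [_|b s IH]; first by exists a; rewrite ?inE// => y; rewrite inE => /eqP->.
have [|x xs xmax] := IH b; first by rewrite /= inE eqxx.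
case: (lerP (f a) (f x)) => h.
  by exists x => [|y]; rewrite inE ?xs ?orbT// => /orP[/eqP->//|/xmax].
exists a => [|y]; rewrite inE ?eqxx// => /orP[/eqP->//|/xmax yx].
by apply: le_trans yx _; exact: ltW.
Qed.

(** Pigeonhole on a cubic grid: two points of O never share a cell. *)
Lemma finite_separated (R : realType) (O : set 'cV[R]_4) (d M : R) : 0 < d ->
  (forall u i, O u -> `|u i 0| <= M) ->
  (forall u v, O u -> O v -> u <> v -> d <= \sum_i (u i 0 - v i 0) ^+ 2) ->
  finite_set O.
Proof.
move=> d0 OM Od.
(* A cell of side 1 / K has squared diameter 4 / K^2, which this choice makes smaller than d. *)
pose K := 4 / d + 4; have K0 : 0 < K by rewrite addr_gt0 ?divr_gt0.
have Kd : 4 < K ^+ 2 * d.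
  rewrite (_ : K ^+ 2 * d = 16 / d + 16 * d + 32); last first.
    by rewrite /K; field; rewrite gt_eqF.
  by have := divr_gt0 (ltr0n R 16) d0; lra.
pose B := (Num.truncn (2 * M * K)).+1.
pose f (u : 'cV[R]_4) : {ffun 'I_4 -> 'I_B.+1} :=
  [ffun i => inord (Num.truncn ((u i 0 + M) * K))].
have nn u i : O u -> 0 <= (u i 0 + M) * K.
  by move=> /(OM _ i); rewrite ler_norml => /andP[? ?]; rewrite mulr_ge0; lra.
have bd u i : O u -> (Num.truncn ((u i 0 + M) * K)%R < B.+1)%N.
  move=> Ou; rewrite ltnS leqW//; apply: le_truncn.
  by have := OM _ i Ou; rewrite ler_norml => /andP[? ?]; rewrite ler_pM2r//; lra.
have finj u v : O u -> O v -> f u = f v -> u = v.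
  move=> Ou Ov fuv; apply: contrapT => /(Od _ _ Ou Ov) h.
  have c i : K ^+ 2 * (u i 0 - v i 0) ^+ 2 <= 1.
    have := congr1 (fun g : {ffun 'I_4 -> 'I_B.+1} => nat_of_ord (g i)) fuv.
    rewrite !ffunE !inordK ?bd// => e.
    have /andP[] := truncn_itv (nn _ i Ou); have /andP[] := truncn_itv (nn _ i Ov).
    rewrite e -!natr1.
    move: (Num.truncn _)%:R => t h1 h2 h3 h4.
    have z1 : -1 <= K * (u i 0 - v i 0) by lra.
    have z2 : K * (u i 0 - v i 0) <= 1 by lra.
    by rewrite -exprMn expr2; move: (K * _) z1 z2 => z; nra.
  have : K ^+ 2 * \sum_i (u i 0 - v i 0) ^+ 2 <= 4.
    rewrite mulr_sumr; apply: le_trans (_ : \sum_(i < 4) 1 <= 4); last first.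
      by rewrite sumr_const card_ord.
    by apply: ler_sum => i _; exact: c.
  by apply/negP; rewrite -ltNge; apply: lt_le_trans Kd _; rewrite ler_pM2l// exprn_gt0.
pose g y := xget 0 [set u | O u /\ f u = y].
apply: (@sub_finite_set _ _ (range g)) => [u Ou|]; last exact: finite_image.
exists (f u) => //; rewrite /g; case: xgetP => [v _ [Ov fv]|/(_ u)[]//].
exact: finj.
Qed.

End FiniteSets.

(** * Isometries and the future cone *)

Section Isometries.
Variable R : realType.
Implicit Types (M : 'M[R]_4) (p u : 'cV[R]_4).

(** Strictness comes from the slack of p: it stays in the future cone after a small move down the
    time axis. *)
Lemma mink_lt0 p u : mink p p < 0 -> 0 < p 3 0 -> mink u u <= 0 -> 0 < u 3 0 ->
  mink p u < 0.
Proof.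
move=> pp p3 uu u3.
have [e' e'0 [e'1 e'2]] := timelike_perturb (- (delta_mx 3 0 : 'cV_4)) pp p3.
have := mink_causal_le0 (ltW e'1) (ltW e'2) uu (ltW u3).
rewrite !minkE (_ : mink (delta_mx 3 0) u = - u 3 0); last by rewrite /mink !mxE /=; ring.
by move=> h; have := mulr_gt0 e'0 u3; lra.
Qed.

Lemma H3_exists : exists p : 'cV[R]_4, H3 p.
Proof. by exists (vec4 0 0 0 1); rewrite /H3 /mink /= !mxE /=; split; lra. Qed.

(** Membership in [isom3] only controls the hyperboloid. The time direction of any other causal
    vector is read off its product with a point of the hyperboloid, which M preserves. *)
Lemma isom3_future M u : isom3 M -> mink u u <= 0 -> 0 <= u 3 0 -> 0 <= (M *m u) 3 0.
Proof.
move=> [Mm MH] uu u3; have [p Hp] := H3_exists.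
have [pp p3] := MH _ Hp; have [pp' p3'] := Hp.
case: (lerP 0 ((M *m u) 3 0)) => // h.
have un0 : 0 < u 3 0.
  rewrite lt0r u3 andbT; apply/eqP => u30.
  have u0 : u = 0.
    move: uu; rewrite /mink u30 => hu.
    have : (u 0 0) ^+ 2 + (u 1 0) ^+ 2 + (u 2 0) ^+ 2 = 0.
      have := sqr_ge0 (u 0 0); have := sqr_ge0 (u 1 0); have := sqr_ge0 (u 2 0).
      by rewrite !expr2; lra.
    move/eqP; rewrite paddr_eq0 ?addr_ge0 ?sqr_ge0//.
    rewrite paddr_eq0 ?sqr_ge0// !sqrf_eq0 => /andP[/andP[/eqP ? /eqP ?] /eqP ?].
    by apply: vec4_ext; rewrite mxE.
  by move: h; rewrite u0 mulmx0 mxE ltxx.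
have h1 : mink (M *m p) (M *m u) < 0.
  by rewrite Mm; apply: mink_lt0 => //; rewrite pp'; lra.
have : mink (M *m p) (- (M *m u)) <= 0.
  apply: mink_causal_le0; first by rewrite pp; lra.
  - exact: ltW.
  - by rewrite !minkE opprK Mm.
  - by rewrite mxE oppr_ge0 ltW.
by rewrite minkE; lra.
Qed.

Lemma isom3_Lplus M u : isom3 M -> Lplus u -> Lplus (M *m u).
Proof.
move=> iM [uu u3]; split; first by case: iM => ->.
by apply: isom3_future => //; rewrite uu.
Qed.

Lemma isom3M M M' : isom3 M -> isom3 M' -> isom3 (M * M').
Proof.
move=> [h1 h2] [h3 h4]; split => [v w|v Hv]; first by rewrite -!mulmxA h1 h3.
by rewrite -mulmxA; apply: h2; exact: h4.
Qed.

Lemma isom3_1 : @isom3 R 1.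
Proof. by split => [v w|v]; rewrite !mul1mx. Qed.

Lemma isom3_unit M : isom3 M -> M \is a GRing.unit.
Proof.
move=> [h _]; have : row_free M^T.
  apply/inj_row_free => v vM.
  have Mv : M *m v^T = 0 by rewrite -[RHS]trmx0 -vM trmx_mul trmxK.
  have z w : mink v^T w = 0 by rewrite -h Mv mink0l.
  apply: trmx_inj; rewrite trmx0; apply: vec4_ext; rewrite [RHS]mxE.
  - by have := z (delta_mx 0 0); rewrite /mink !mxE /=; lra.
  - by have := z (delta_mx 1 0); rewrite /mink !mxE /=; lra.
  - by have := z (delta_mx 2 0); rewrite /mink !mxE /=; lra.
  - by have := z (delta_mx 3 0); rewrite /mink !mxE /=; lra.
by rewrite row_free_unit unitmx_tr.
Qed.

Lemma isom3_mulVK M u : isom3 M -> M^-1 *m (M *m u) = u.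
Proof. by move=> /isom3_unit Mu; rewrite mulmxA -[_ *m M]/(M^-1 * M) mulVr// mul1mx. Qed.

Lemma isom3_mulKV M u : isom3 M -> M *m (M^-1 *m u) = u.
Proof. by move=> /isom3_unit Mu; rewrite mulmxA -[_ *m M^-1]/(M / M) divrr// mul1mx. Qed.

Lemma timelike_sign p q : mink p p < 0 -> 0 < p 3 0 -> mink q q < 0 ->
  mink p q < 0 -> 0 < q 3 0.
Proof.
move=> pp p3 qq pq; case: (ltrP 0 (q 3 0)) => // q3.
have : mink p (- q) <= 0.
  apply: mink_causal_le0; [exact: ltW|exact: ltW| |by rewrite mxE oppr_ge0].
  by rewrite !minkE opprK ltW.
by rewrite minkE; lra.
Qed.

Lemma isom3V M : isom3 M -> isom3 M^-1.
Proof.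
move=> iM; have [h1 h2] := iM; split => [v w|v [v1 v2]].
  by rewrite -h1 !isom3_mulKV.
have e : mink (M^-1 *m v) (M^-1 *m v) = -1 by rewrite -h1 isom3_mulKV.
split=> //; have [p Hp] := H3_exists.
have [pp p3] := Hp; have [Mp Mp3] := h2 _ Hp.
apply: (@timelike_sign p); rewrite ?pp ?e//; try lra.
rewrite -h1 isom3_mulKV//; apply: mink_lt0; rewrite ?Mp ?v1//; lra.
Qed.

Lemma rfl_isom3 e : mink e e = 1 -> isom3 (rfl e : 'M[R]_4).
Proof.
move=> e1; split=> [v w|v [vv v3]]; first exact: rfl_mink.
have h : mink (rfl e *m v) (rfl e *m v) = -1 by rewrite rfl_mink.
split=> //; apply: (@timelike_sign v) => //; rewrite ?vv ?h; try lra.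
rewrite rflE !minkE vv; have := sqr_ge0 (mink v e); rewrite expr2; lra.
Qed.

Lemma sum_sqr_mink u : mink u u <= \sum_i (u i 0) ^+ 2.
Proof.
rewrite !big_ord_recl big_ord0 addr0 /mink.
have -> : lift ord0 (ord0 : 'I_3) = 1 by exact: val_inj.
have -> : lift ord0 (lift ord0 (ord0 : 'I_2)) = 2 by exact: val_inj.
have -> : lift ord0 (lift ord0 (lift ord0 (ord0 : 'I_1))) = 3 by exact: val_inj.
by have := sqr_ge0 (u 3 0); rewrite !expr2; lra.
Qed.

Lemma causal_coord u i : mink u u <= 0 -> 0 <= u 3 0 -> `|u i 0| <= u 3 0.
Proof.
rewrite /mink => uu u3; rewrite ler_norml.
have h : (u i 0) ^+ 2 <= (u 3 0) ^+ 2.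
  have := sqr_ge0 (u 0 0); have := sqr_ge0 (u 1 0); have := sqr_ge0 (u 2 0).
  have [->|->|->|->] : [\/ i = 0, i = 1, i = 2 | i = 3].
    by case: i => [[|[|[|[|//]]]] hi]; [constructor 1|constructor 2|constructor 3|constructor 4]; exact: val_inj.
  1-4: by rewrite !expr2; lra.
by apply/andP; split; move: h; rewrite !expr2; nra.
Qed.

End Isometries.

(** * Chambers and discreteness for Coxeter groups *)

Section CoxeterAction.
Variables (R : realType) (I : Type) (e : I -> 'cV[R]_4).
Hypothesis eP : cox_roots e.
Local Notation W := (wgrp e).

Lemma wgrp_isom3 w : W w -> isom3 w.
Proof.
move=> Ww; elim/wgrp_ind: w / Ww => [|w i _ IH]; first exact: isom3_1.
by apply: isom3M => //; apply: rfl_isom3; case: eP.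
Qed.

Lemma generated_fix (S : set 'M[R]_4) (y : 'cV[R]_4) u :
  (forall s, S s -> s *m y = y) -> generated S u -> u *m y = y.
Proof.
move=> Sy; elim=> {u} [u /Sy//||u v _ hu _ hv|u _ hu]; first by rewrite mul1mx.
  by rewrite -mulmxA hv hu.
(* For a non-unit, the library inverse is the element itself. *)
case: (boolP (u \is a GRing.unit)) => uu; last by rewrite invr_out.
by rewrite -{1}hu mulmxA -[_ *m u]/(u^-1 * u) mulVr// mul1mx.
Qed.

(** [orbit_gap] with both vectors equal: the mirrors through x fix x, so its first alternative
    becomes equality of the two orbit points. *)
Lemma orbit_gap_pair m x y w w' : dom e m x -> 0 <= m -> W w -> W w' -> y = x ->
  w *m x = w' *m y \/ mink (w *m x) (w' *m y) <= mink x x - 2 * (m * m).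
Proof.
move=> dx m0 Ww Ww' ->.
have Wv := wgrpM (wgrpV eP Ww') Ww.
have e1 : mink (w *m x) (w' *m x) = mink ((w'^-1 * w) *m x) x.
  by rewrite -[RHS](wgrp_mink eP _ _ Ww') -!mulmxA isom3_mulKV//; exact: wgrp_isom3.
case: (orbit_gap eP dx dx m0 m0 Wv) => [[_ [u Gu uE]]|h]; last by right; rewrite e1.
left; have := uE; rewrite (generated_fix _ Gu) => [h|_ [i i0 <-]]; last first.
  by rewrite rflE i0 mulr0 scale0r subr0.
have := congr1 (mulmx w') h; rewrite -!mulmxA isom3_mulKV//; exact: wgrp_isom3.
Qed.

(** For distinct orbit points u and v, the norm of u - v is 2 <y, y> - 2 <u, v> >= 4 m^2, and the
    Euclidean norm is at least as large. A bound on the time coordinate bounds all the others by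
    causality. *)
Lemma orbit_finite m y B : dom e m y -> 0 < m -> mink y y < 0 -> 0 < y 3 0 ->
  finite_set [set u | [set w *m y | w in W] u /\ u 3 0 <= B].
Proof.
move=> dy m0 yy y3; apply: (@finite_separated _ _ (4 * (m * m)) B).
- by rewrite mulr_gt0// mulr_gt0.
- move=> u i [[w Ww <-] h]; apply: le_trans h; apply: causal_coord.
    by rewrite (wgrp_mink eP)// ltW.
  by apply: isom3_future; rewrite ?ltW//; exact: wgrp_isom3.
- move=> u v [[w Ww <-] _] [[w' Ww' <-] _] ne.
  have [//|h] := orbit_gap_pair dy (ltW m0) Ww Ww' erefl.
  rewrite (eq_bigr (fun i => ((w *m y - w' *m y) i 0) ^+ 2)); last by move=> i _; rewrite !mxE.
  apply: le_trans (sum_sqr_mink _).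
  by rewrite !minkE !(wgrp_mink eP)// (minkC (w' *m y)); lra.
Qed.

Lemma causal_bound (p : 'cV[R]_4) : mink p p < 0 -> 0 < p 3 0 ->
  exists2 k : R, 0 < k & forall u, mink u u <= 0 -> 0 <= u 3 0 -> u 3 0 <= k * - mink u p.
Proof.
move=> pp p3; have [k k0 [k1 k2]] := timelike_perturb (- (delta_mx 3 0 : 'cV_4)) pp p3.
exists k^-1; first by rewrite invr_gt0.
move=> u uu u3; have := mink_causal_le0 uu u3 (ltW k1) (ltW k2).
rewrite !minkE (_ : mink u (delta_mx 3 0) = - u 3 0); last by rewrite /mink !mxE /=; ring.
by rewrite ler_pdivlMl//; lra.
Qed.

(** Among the orbit points of x0, an interior vector of the chamber, take one whose product with p
    is largest, that is, one nearest to p. A wall separating it from p could be used to bring it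
    closer. *)
Lemma dominant_rep m x0 p : dom e m x0 -> (forall i, mink x0 (e i) <> 0) -> 0 < m ->
  mink x0 x0 < 0 -> 0 < x0 3 0 -> H3 p ->
  exists2 w, W w & dominant e (w^-1 *m p).
Proof.
move=> d0 dn m0 xx x3 [pp p3].
have pp' : mink p p < 0 by rewrite pp; lra.
have [k k0 kP] := causal_bound pp' p3.
pose S := [set u | [set w *m x0 | w in W] u /\ mink x0 p <= mink u p].
have fS : finite_set S.
  apply: sub_finite_set (orbit_finite (k * - mink x0 p) d0 m0 xx x3).
  move=> _ [[w Ww <-] h]; split; first by exists w.
  apply: (@le_trans _ _ (k * - mink (w *m x0) p)); last by rewrite ler_pM2l//; lra.
  apply: kP; first by rewrite (wgrp_mink eP)// ltW.
  by apply: isom3_future; rewrite ?ltW//; exact: wgrp_isom3.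
have S0 : S !=set0 by exists x0; split=> //; exists 1; rewrite ?mul1mx//; exact: wgrp1.
have [_ [[w Ww <-] h] max] := finite_set_max (fun u => mink u p) fS S0.
exists w => // i; rewrite leNgt; apply/negP => neg.
have iw := wgrp_isom3 Ww.
have Wr := wgrpM Ww (wgrp_r e i).
have E : mink ((w * rfl (e i)) *m x0) p =
    mink (w *m x0) p - 2 * (mink x0 (e i) * mink (w^-1 *m p) (e i)).
  rewrite -{1}(isom3_mulKV p iw) -mulmxA (wgrp_mink eP)// rflE minkDl minkNl minkZl.
  by rewrite -[in X in _ = X](isom3_mulKV p iw) (wgrp_mink eP)// isom3_mulVK// (minkC (e i)); ring.
have pos : 0 < mink x0 (e i).
  by case: (d0 i) => [/dn//|[_]]; exact: lt_le_trans.
have : mink ((w * rfl (e i)) *m x0) p <= mink (w *m x0) p.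
  apply: max; split; first by exists (w * rfl (e i)).
  by apply: le_trans h _; rewrite E; nra.
by rewrite E; nra.
Qed.

End CoxeterAction.

(** * The polyhedron and its tiles *)

Section Coordinates.
Variable R : realType.
Implicit Types (p q x y : R).

Definition r2 : R := Num.sqrt 2.

Lemma r2r2 : r2 * r2 = 2.
Proof. by rewrite -expr2 sqr_sqrtr. Qed.

Lemma r2_gt1 : 1 < r2.
Proof. by have := sqrtr_ge0 (2 : R); have := r2r2; rewrite /r2; nra. Qed.

(* The vector whose Hermitian matrix is [[p, x + iy], [x - iy, q]]; on H^3 the
   height of the corresponding point of the upper half-space is 1/q. *)
Definition hv p q x y : 'cV[R]_4 := vec4 x y ((p - q) / 2) ((p + q) / 2).

Lemma hv_eta (v : 'cV[R]_4) : v = hv (v 3 0 + v 2 0) (v 3 0 - v 2 0) (v 0 0) (v 1 0).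
Proof. by apply: vec4_ext; rewrite !mxE /=; field. Qed.

Lemma mink_hv p q x y p' q' x' y' :
  mink (hv p q x y) (hv p' q' x' y') = x * x' + y * y' - (p * q' + p' * q) / 2.
Proof. by rewrite /mink !mxE /=; field. Qed.

Lemma hvD p q x y p' q' x' y' :
  hv p q x y + hv p' q' x' y' = hv (p + p') (q + q') (x + x') (y + y').
Proof. by apply: vec4_ext; rewrite !mxE /=; field. Qed.

Lemma hvZ k p q x y : k *: hv p q x y = hv (k * p) (k * q) (k * x) (k * y).
Proof. by apply: vec4_ext; rewrite !mxE /=; field. Qed.

Lemma hvN p q x y : - hv p q x y = hv (- p) (- q) (- x) (- y).
Proof. by rewrite -scaleN1r hvZ !mulN1r. Qed.

Lemma rfl_hv a b c d p q x y :
  let m := 2 * (c * x + d * y) - (a * q + p * b) in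
  rfl (hv a b c d) *m hv p q x y = hv (p - m * a) (q - m * b) (x - m * c) (y - m * d).
Proof.
move=> m; rewrite rflE mink_hv hvZ hvN hvD; congr hv; rewrite /m; by field.
Qed.

Lemma hv_inj p q x y p' q' x' y' : hv p q x y = hv p' q' x' y' ->
  [/\ p = p', q = q', x = x' & y = y'].
Proof.
move=> e; have c i := congr1 (fun v : 'cV_4 => v i 0) e.
have := c 0; have := c 1; have := c 2; have := c 3; rewrite !mxE /= => h3 h2 h1 h0.
by split=> //; lra.
Qed.

Lemma ideal_hv (a b : R) : ideal_vec (Some (a +i* b)) = hv (a ^+ 2 + b ^+ 2) 1 a b.
Proof. by rewrite /ideal_vec /unherm !mxE /=; congr vec4; ring. Qed.

Lemma ideal_oo : ideal_vec None = hv 1 0 0 0.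
Proof. by rewrite /ideal_vec /unherm !mxE /=; congr vec4. Qed.

Lemma hv_future p q x y : mink (hv p q x y) (hv p q x y) < 0 -> 0 < hv p q x y 3 0 ->
  0 < q /\ 0 < p.
Proof.
rewrite mink_hv !mxE /= => h1 h2.
have := sqr_ge0 x; have := sqr_ge0 y; rewrite !expr2 => ? ?.
have pq : 0 < p * q by lra.
by split; nra.
Qed.

Definition vshift_mx (a : R) : 'M[R[i]]_2 := mx2 1 (0 +i* a) 0 1.

Definition vshift (a : R) : 'M[R]_4 := lorentz (vshift_mx a).

End Coordinates.

Arguments r2 {R}.

Section Mirrors.
Variables (R : realType) (n : nat).
Local Notation r2 := (@r2 R).

(* Walls of the Coxeter polyhedron, in the upper half-space: Re = 0, Re = 1/2,
   Im = 1/2, Im = - 2 n sqrt 2 - 1/2, and the unit hemispheres centred at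
   - k i sqrt 2 for k <= 2 n. *)
Inductive mirror := MRe0 | MRe1 | MTop | MBot | MSph of 'I_(2 * n).+1.

(** The product with this root is nonnegative exactly outside the hemisphere; the square of k sqrt 2
    is already expanded in the first coordinate. *)
Definition sph_root (k : nat) : 'cV[R]_4 := hv (1 - 2 * k%:R ^+ 2) (-1) 0 (k%:R * r2).

Definition mirror_root (i : mirror) : 'cV[R]_4 :=
  match i with
  | MRe0 => hv 0 0 1 0
  | MRe1 => hv (-1) 0 (-1) 0
  | MTop => hv (-1) 0 0 (-1)
  | MBot => hv (- (4 * n%:R * r2 + 1)) 0 0 1
  | MSph k => sph_root k
  end.

(** The hemispheres k and l have product 1 - (l - k)^2: the distance sqrt 2 of neighbouring centres
    makes them orthogonal, and all further ones are disjoint. The planes Im = const meet only the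
    hemisphere nearest to them, at angle pi / 3. *)
Lemma cox_root : cox_roots mirror_root.
Proof.
have r2r2 := @r2r2 R; have r2g := @r2_gt1 R.
have n0 : 0 <= n%:R :> R by [].
split=> [[||||k]|].
1-5: rewrite mink_hv; try by field.
  transitivity (k%:R ^+ 2 * (r2 * r2) + (1 - 2 * k%:R ^+ 2)); first by field.
  by rewrite r2r2; ring.
have top (k : 'I_(2 * n).+1) : [\/ mirror_root MTop = mirror_root (MSph k), mink (mirror_root MTop) (mirror_root (MSph k)) = 0,
   mink (mirror_root MTop) (mirror_root (MSph k)) = - (1 / 2) | mink (mirror_root MTop) (mirror_root (MSph k)) <= -1].
  rewrite mink_hv; case: k => [[|k] hk] /=; first by constructor 3; field.
  constructor 4; have : 1 <= k.+1%:R :> R by rewrite ler1n.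
  by move: (_%:R) => t t1; nra.
have bot (k : 'I_(2 * n).+1) : [\/ mirror_root MBot = mirror_root (MSph k), mink (mirror_root MBot) (mirror_root (MSph k)) = 0,
   mink (mirror_root MBot) (mirror_root (MSph k)) = - (1 / 2) | mink (mirror_root MBot) (mirror_root (MSph k)) <= -1].
  rewrite mink_hv; have := ltn_ord k; rewrite ltnS leq_eqVlt => /orP[/eqP->|h].
    by constructor 3; rewrite natrM; field.
  constructor 4; have : k%:R + 1 <= 2 * n%:R :> R by rewrite -natrM natr1 ler_nat.
  by move: (k%:R) => t t1; nra.
have sph (k l : 'I_(2 * n).+1) : (k <= l)%N -> [\/ mirror_root (MSph k) = mirror_root (MSph l),
   mink (mirror_root (MSph k)) (mirror_root (MSph l)) = 0,
   mink (mirror_root (MSph k)) (mirror_root (MSph l)) = - (1 / 2) | mink (mirror_root (MSph k)) (mirror_root (MSph l)) <= -1].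
  rewrite leq_eqVlt => /orP[/eqP/val_inj->|kl]; first by constructor 1.
  have -> : mink (mirror_root (MSph k)) (mirror_root (MSph l)) = 1 - (l%:R - k%:R) ^+ 2.
    rewrite mink_hv; transitivity (k%:R * l%:R * (r2 * r2) + 1 - k%:R ^+ 2 - l%:R ^+ 2 : R); first by field.
    by rewrite r2r2; ring.
  move: kl; rewrite leq_eqVlt => /orP[/eqP<-|kl].
    by constructor 2; rewrite -natr1; ring.
  have : k%:R + 2 <= l%:R :> R by rewrite -natrD ler_nat addn2.
  by constructor 4; nra.
have mC i j : [\/ mirror_root i = mirror_root j, mink (mirror_root i) (mirror_root j) = 0,
    mink (mirror_root i) (mirror_root j) = - (1 / 2) | mink (mirror_root i) (mirror_root j) <= -1] ->
  [\/ mirror_root j = mirror_root i, mink (mirror_root j) (mirror_root i) = 0,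
    mink (mirror_root j) (mirror_root i) = - (1 / 2) | mink (mirror_root j) (mirror_root i) <= -1].
  by rewrite minkC => -[->|?|?|?]; [constructor 1|constructor 2|constructor 3|constructor 4].
case=> [||||k] [||||l]; try by constructor 1.
all: try exact: top; try exact: bot; try (by apply: mC; exact: top); try (by apply: mC; exact: bot).
all: try (by constructor 2; rewrite mink_hv; field).
all: try (by constructor 4; rewrite mink_hv; nra).
all: try (by constructor 3; rewrite mink_hv; field).
by case/orP: (leq_total k l) => h; [exact: sph|apply: mC; exact: sph].
Qed.

Definition oo : 'cV[R]_4 := hv 1 0 0 0.

(** The vertical walls contain [oo], and each hemisphere has product exactly 1 / 2 with it. This
    gives gap 1 against a normal and gap 1 / 2 of the orbit of [oo] against itself. *)
Lemma dom_oo : dom mirror_root (1 / 2) oo.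
Proof. case=> [||||k]; rewrite mink_hv; ((left; by field) || (right; split; lra)). Qed.

(** A timelike vector, not normalised, in the open chamber for every n. *)
Definition inner : 'cV[R]_4 := hv 5 1 (1 / 4) 0.

Lemma inner_root i : 1 / 4 <= mink inner (mirror_root i).
Proof.
have r2g := @r2_gt1 R; have n0 : 0 <= n%:R :> R by [].
case: i => [||||k]; rewrite mink_hv; [lra|lra|lra|nra|].
by have := sqr_ge0 (k%:R : R); lra.
Qed.

Lemma fundamental_rep p : H3 p -> exists2 w, wgrp mirror_root w & dominant mirror_root (w^-1 *m p).
Proof.
move=> Hp; apply: (dominant_rep cox_root (m := 1 / 4) (x0 := inner)) => //.
- by move=> i; right; split; [lra|exact: inner_root].
- by move=> i; have := inner_root i; lra.
- by rewrite mink_hv; lra.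
- by rewrite !mxE /=; lra.
Qed.

End Mirrors.

(** * Affine from linear independence *)

Section AffineIndependence.
Variable R : realType.

Lemma affdim_indep (p : 'I_4 -> 'cV[R]_4) :
  (forall c : 'I_4 -> R, \sum_k c k *: p k = 0 -> forall k, c k = 0) ->
  \rank (\matrix_(k, j) (p k j 0 - p 0 j 0)) = 3.
Proof.
move=> pI; set D := \matrix_(_, _) _; pose P : 'M[R]_4 := \matrix_(k, j) p k j 0.
have rP : \rank P = 4%N.
  apply/eqP; apply/inj_row_free => v vP.
  apply/rowP => k; rewrite mxE; apply: (pI (fun k => v 0 k)).
  apply/matrixP => i j; rewrite ord1 [RHS]mxE summxE.
  have := congr1 (fun M : 'rV_4 => M 0 i) vP; rewrite !mxE => {2}<-.
  by apply: eq_bigr => l _; rewrite !mxE.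
have D4 : (\rank D < 4)%N.
  rewrite ltn_neqAle rank_leq_row andbT; apply/negP => rD.
  have /row_free_inj h : row_free D by [].
  have : (delta_mx 0 0 : 'rV[R]_4) = 0.
    by apply: (h 1%N); rewrite mul0mx -rowE; apply/rowP => j; rewrite !mxE subrr.
  by move/(congr1 (fun M : 'rV[R]_4 => M 0 0)); rewrite !mxE /= => /eqP; rewrite oner_eq0.
have PD : (P <= D + row 0%R P)%MS.
  apply/row_subP => i; rewrite (_ : row i P = row i D + row 0 P).
    by apply: addmx_sub_adds; rewrite ?row_sub.
  by apply/rowP => j; rewrite !mxE subrK.
have := leq_trans (mxrankS PD) (mxrank_adds_leqif _ _).
rewrite rP; have := rank_leq_row (row 0 P); move: (\rank _) (\rank D) D4 => a b; lia.
Qed.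

End AffineIndependence.

(** * Integral coordinates for tiles *)

Section IntegralModel.
Variables (R : realType) (d : int) (s : R).
Hypothesis sd : s * s = d%:~R.

(** With s = 1 for the octahedron and s = - sqrt 2 for the cuboctahedron, the scaled vertices, the
    centres and the mirrors of both tiles become integral, so that their combinatorics can be
    evaluated. *)
Definition ivec : Type := (int * int * int * int)%type.

Definition ev (v : ivec) : 'cV[R]_4 :=
  let: (p, q, x, y) := v in hv p%:~R q%:~R x%:~R (s * y%:~R).

Definition imink (u v : ivec) : int :=
  let: (p, q, x, y) := u in let: (p', q', x', y') := v in
  2 * (x * x') + 2 * (d * (y * y')) - (p * q' + p' * q).

(** Since [imink] is twice the product, this is the reflection without any factor 2 or division. *)
Definition irfl (e v : ivec) : ivec :=
  let m := imink v e in
  let: (p, q, x, y) := v in let: (p', q', x', y') := e in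
  (p - m * p', q - m * q', x - m * x', y - m * y').

Lemma ev_mink u v : 2 * mink (ev u) (ev v) = (imink u v)%:~R.
Proof.
move: u v => [[[p q] x] y] [[[p' q'] x'] y'].
rewrite mink_hv !(rmorphD, rmorphN, rmorphB, rmorphM) /= -sd; by field.
Qed.

Lemma ev_rfl e v : rfl (ev e) *m ev v = ev (irfl e v).
Proof.
rewrite rflE minkC minkC ev_mink; move: e v => [[[p q] x] y] [[[p' q'] x'] y'].
rewrite hvZ hvN hvD /irfl; move: (imink _ _) => m.
rewrite /ev !(rmorphD, rmorphN, rmorphB, rmorphM) /=; congr hv; ring.
Qed.

End IntegralModel.

(** * Certificates for a tile *)

Section Tiles.
Variables (R : realType) (n : nat).
Local Notation root := (@mirror_root R n).
Local Notation W := (wgrp root).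

Definition orbit_oo : set 'cV[R]_4 := [set w *m oo R | w in W].

(** What [orbit_gap] needs in order to identify the face of N: the equality case leads from [oo]
    along mirrors through N, and these never leave the list [vs]. *)
Definition tile_data (N : 'cV[R]_4) (vs : seq 'cV[R]_4) :=
  [/\ dom root 1 N, forall v, v \in vs -> mink N v = -1 /\ orbit_oo v, oo R \in vs,
      forall i v, mink N (root i) = 0 -> v \in vs -> rfl (root i) *m v \in vs &
      affdim_ge3 [set` vs]].

Lemma isom_rfl (M : 'M[R]_4) e : isom3 M -> M * rfl e = rfl (M *m e) * M.
Proof.
move=> [Mm _]; apply: mulmx_inj4 => v; rewrite -[LHS]mulmxA -[RHS]mulmxA !rflE Mm.
by rewrite mulmxBr -scalemxAr.
Qed.

Definition irfl_step d (es vs : seq ivec) : seq ivec :=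
  undup (vs ++ [seq irfl d e v | e <- es, v <- vs]).

(** The value -2 encodes product -1. Six rounds of reflections in the listed mirrors suffice to
    reach every vertex from [oo]. The last four tests supply affinely independent vertices, the
    final alternative separating octahedron and cuboctahedron. *)
Definition tile_check d nn (es vs : seq ivec) : bool :=
  [&& all (fun v => imink d nn v == -2) vs,
      all (fun e => all (fun v => irfl d e v \in vs) vs) es,
      all (fun v => v \in iter 6 (irfl_step d es) [:: (1, 0, 0, 0) : ivec]) vs,
      (1, 0, 0, 0) \in vs, (0, 1, 0, 0) \in vs, (1, 1, 1, 0) \in vs &
      ((1, 1, 0, 1) \in vs) || ((2, 1, 0, 1) \in vs)].

Lemma tile_dataP d s (th : 'M[R]_4) (nn : ivec) (es vs : seq ivec) :
  s * s = d%:~R -> s != 0 -> isom3 th -> th *m oo R = oo R ->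
  (forall e, e \in es -> exists i, root i = th *m ev s e) ->
  (forall i, mink (th *m ev s nn) (root i) = 0 /\
             (exists2 e, e \in es & root i = th *m ev s e)
          \/ 1 <= mink (th *m ev s nn) (root i)) ->
  tile_check d nn es vs ->
  tile_data (th *m ev s nn) [seq th *m ev s v | v <- vs].
Proof.
move=> sd s0 iT Too esr nnr /and4P[/allP nvs /allP cvs /allP ovs indep].
have evoo : ev s (1, 0, 0, 0) = oo R by rewrite /ev /oo; congr hv; rewrite mulr0.
split.
- by move=> i; case: (nnr i) => [[-> _]|]; [left|right; split].
- move=> _ /mapP[v vvs ->]; split.
    case: iT => -> _; have := ev_mink sd nn v; rewrite (eqP (nvs _ vvs)).
    by rewrite rmorphN /=; lra.
  have := ovs _ vvs; elim: (6%N) v {vvs} => [|k IH] v.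
    by rewrite inE => /eqP->; exists 1; rewrite ?mul1mx ?evoo ?Too//; exact: wgrp1.
  rewrite iterS /irfl_step mem_undup mem_cat => /orP[/IH//|/allpairsP[[e u] /= [ees uk ->]]].
  have [w Ww wE] := IH _ uk; have [i iE] := esr _ ees.
  exists (rfl (root i) * w); first exact: wgrpM (wgrp_r _ _) _.
  rewrite -mulmxA wE iE -(ev_rfl sd) mulmxA -[_ *m th]/(rfl _ * th) -isom_rfl//.
  by rewrite -mulmxA.
- by rewrite -Too -evoo; apply: (map_f (fun v => th *m ev s v)); case/and4P: indep.
- move=> i _ i0 /mapP[v vvs ->]; case: (nnr i) => [[_ [e ees ->]]|]; last by rewrite i0; lra.
  rewrite mulmxA -[_ *m th]/(rfl _ * th) -isom_rfl// -mulmxA (ev_rfl sd).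
  by apply: (map_f (fun v => th *m ev s v)); have /allP := cvs _ ees; apply.
- case/and4P: indep => h0 h1 h2 h3.
  (* Only this fourth vertex has a nonzero last coordinate, so its coefficient vanishes first and
     the remaining system is triangular whatever t is. *)
  have [t th3] : exists t : int, (t, 1, 0, 1) \in vs by case/orP: h3; [exists 1|exists 2].
  exists (fun k => th *m ev s (nth (1, 0, 0, 0) [:: (1, 0, 0, 0) : ivec; (0, 1, 0, 0); (1, 1, 1, 0); (t, 1, 0, 1)] k)).
  split.
    by case=> [[|[|[|[|//]]]] hk]; apply: (map_f (fun v => th *m ev s v)).
  apply: affdim_indep => c.
  under eq_bigr do rewrite scalemxAr.
  rewrite -mulmx_sumr => e.
  have {}e := congr1 (mulmx th^-1) e; rewrite isom3_mulVK// mulmx0 in e.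
  move: e; rewrite !big_ord_recl big_ord0 addr0 /= !hvZ !hvD => e.
  have hv0 : (0 : 'cV[R]_4) = hv 0 0 0 0 by apply: vec4_ext; rewrite !mxE /=; field.
  have /hv_inj[e1 e2 e3 e4] := etrans e hv0.
  have c3 : c (lift ord0 (lift ord0 (lift ord0 ord0))) = 0.
    apply: (mulIf s0); rewrite mul0r; move: e4; rewrite !rmorph0 !rmorph1 !mulr0 !add0r !mulr1.
    by [].
  move: e1 e2 e3; rewrite c3 !rmorph0 !rmorph1 !mulr0 !mulr1 !mul0r !add0r !addr0 => e1 e2 e3.
  have c2 := e3; rewrite c2 !addr0 in e1 e2.
  case=> [[|[|[|[|//]]]] hk].
  - by rewrite (_ : Ordinal hk = ord0) ?e1 //; apply: val_inj.
  - by rewrite (_ : Ordinal hk = (lift ord0 ord0)) ?e2 //; apply: val_inj.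
  - by rewrite (_ : Ordinal hk = (lift ord0 (lift ord0 ord0))) ?c2 //; apply: val_inj.
  - by rewrite (_ : Ordinal hk = (lift ord0 (lift ord0 (lift ord0 ord0)))) ?c3 //; apply: val_inj.
Qed.

End Tiles.

(** * Two-by-two matrices *)

Section TwoByTwo.

Lemma ord2P (P : 'I_2 -> Prop) : P 0 -> P 1 -> forall i, P i.
Proof.
move=> p0 p1 [[|[|//]] h].
- by have -> : Ordinal h = 0 by exact: val_inj.
- by have -> : Ordinal h = 1 by exact: val_inj.
Qed.

Lemma mx2M (T : pzSemiRingType) (a b c d a' b' c' d' : T) :
  mx2 a b c d *m mx2 a' b' c' d' =
  mx2 (a * a' + b * c') (a * b' + b * d') (c * a' + d * c') (c * b' + d * d').
Proof.
have sum2 (F : 'I_2 -> T) : \sum_i F i = F 0 + F 1.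
  by rewrite !big_ord_recl big_ord0 addr0; congr (_ + F _); exact: val_inj.
by apply/matrixP => i j; move: i j; apply: ord2P; apply: ord2P; rewrite !mxE sum2 !mxE.
Qed.

Lemma mx2T (T : Type) (a b c d : T) : (mx2 a b c d)^T = mx2 a c b d.
Proof. by apply/matrixP => i j; move: i j; apply: ord2P; apply: ord2P; rewrite !mxE. Qed.

Lemma barmx2 (R : realType) (a b c d : R[i]) :
  barmx (mx2 a b c d) = mx2 (conjc a) (conjc b) (conjc c) (conjc d).
Proof. by apply/matrixP => i j; move: i j; apply: ord2P; apply: ord2P; rewrite !mxE. Qed.

Lemma mx2_eta (T : Type) (A : 'M[T]_2) : A = mx2 (A 0 0) (A 0 1) (A 1 0) (A 1 1).
Proof. by apply/matrixP => i j; move: i j; apply: ord2P; apply: ord2P; rewrite mxE. Qed.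

Lemma det_mx2 (T : comPzRingType) (a b c d : T) : \det (mx2 a b c d) = a * d - b * c.
Proof.
rewrite (expand_det_row _ 0) !big_ord_recl big_ord0 /cofactor !det_mx11 !mxE /=.
by rewrite expr0 expr1 mul1r mulN1r addr0 mulrN.
Qed.

End TwoByTwo.

(** * Normals and vertices of the tiles *)

Section TileGeometry.
Variables (R : realType) (n : nat).
Local Notation root := (@mirror_root R n).
Local Notation r2 := (@r2 R).

Lemma vshift_hv (a p q x y : R) :
  vshift a *m hv p q x y = hv (p + 2 * a * y + a ^+ 2 * q) q x (y + a * q).
Proof.
rewrite /vshift lorentzE /vshift_mx barmx2 mx2T /herm !mx2M /unherm !mxE /= /hv.
by congr vec4; field.
Qed.

Lemma vshift_det a : \det (@vshift_mx R a) = 1.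
Proof.
by rewrite det_mx2 mulr1 mulr0 subr0.
Qed.

Lemma vshift_isom3 a : isom3 (@vshift R a).
Proof. by apply: lorentz_isom3; exact: vshift_det. Qed.

Lemma refl_hv (p q x y : R) : refl R *m hv p q x y = hv p q x (- y).
Proof.
rewrite /refl mul_diag_mx; apply: vec4_ext; rewrite !mxE /=; ring.
Qed.

(* Tile k lies between the planes over Im = - (k - 1) sqrt 2 and - k sqrt 2. *)
Definition theta (k : nat) : 'M[R]_4 :=
  if k == 0%N then 1 else
  if (k <= 2 * n)%N then vshift (- (k.-1%:R * r2)) else vshift (- ((2 * n)%:R * r2)) * refl R.

(** The two end tiles are octahedra, all the others cuboctahedra. *)
Definition octa k := (k == 0%N) || (2 * n < k)%N.

(** Proportional to the sum of the vertices, for both tiles in their own coordinates (a third and a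
    twelfth of it), and scaled to have product -1 with each vertex. *)
Definition tile_center : ivec := (2, 2, 1, 1).

(** An entry (p, q, x, y) with q nonzero is q times the vector of the ideal point (x + i s y) / q;
    the factor q places it in the orbit of [oo]. *)
Definition octa_verts : seq ivec :=
  [:: (1, 0, 0, 0); (0, 1, 0, 0); (1, 1, 1, 0); (1, 1, 0, 1); (2, 1, 1, 1); (1, 2, 1, 1)].

(** The walls of the polyhedron through the centre of the tile, which generate its symmetries;
    likewise in [cubo_roots]. *)
Definition octa_roots : seq ivec := [:: (-1, 0, -1, 0); (-1, 0, 0, -1); (1, -1, 0, 0)].

Definition cubo_verts : seq ivec :=
  [:: (1, 0, 0, 0); (0, 1, 0, 0); (1, 1, 1, 0); (2, 1, 0, 1); (3, 1, 1, 1); (1, 2, 0, 1);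
      (3, 2, 2, 1); (3, 4, 2, 2); (1, 3, 1, 1); (3, 3, 1, 2); (2, 3, 2, 1); (4, 3, 2, 2)].

Definition cubo_roots : seq ivec := [:: (-1, 0, -1, 0); (1, -1, 0, 0); (-1, -1, 0, -1)].

Lemma octa_check : tile_check 1 tile_center octa_roots octa_verts.
Proof. by vm_compute. Qed.

Lemma cubo_check : tile_check 2 tile_center cubo_roots cubo_verts.
Proof. by vm_compute. Qed.

Definition base_ev k : ivec -> 'cV[R]_4 := ev (if octa k then 1 else - r2).

Definition base_verts k : seq ivec := if octa k then octa_verts else cubo_verts.

Definition tile_normal k : 'cV[R]_4 := theta k *m base_ev k tile_center.

Definition tile_verts k : seq 'cV[R]_4 := [seq theta k *m base_ev k v | v <- base_verts k].

Lemma theta_isom3 k : isom3 (theta k).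
Proof.
rewrite /theta; case: ifP => _; first exact: isom3_1.
case: ifP => _; first exact: vshift_isom3.
by apply: isom3M; [exact: vshift_isom3|exact: refl_isom3].
Qed.

Lemma vshift_oo a : vshift a *m oo R = oo R.
Proof. by rewrite /oo vshift_hv; congr hv; ring. Qed.

Lemma refl_oo : refl R *m oo R = oo R.
Proof. by rewrite /oo refl_hv oppr0. Qed.

Lemma theta_oo k : theta k *m oo R = oo R.
Proof.
rewrite /theta; case: ifP => _; first exact: mul1mx.
by case: ifP => _; rewrite ?vshift_oo// -mulmxA refl_oo vshift_oo.
Qed.

(** The walls through the centre are Re = 1/2 together with Im = 1/2 and the hemisphere 0 for the
    first octahedron, the bottom plane and the hemisphere 2n for the last one, and the hemispheres
    k-1 and k for the k-th cuboctahedron. Every other wall has product at least 1 with the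
    normal. *)
Lemma tile_data_ok k : (k < (2 * n).+2)%N -> tile_data n (tile_normal k) (tile_verts k).
Proof.
move=> kn.
have r2r2 := @r2r2 R; have r2g := @r2_gt1 R; have n0 : 0 <= n%:R :> R by [].
have r2N : - r2 * - r2 = 2%:~R by rewrite mulrNN r2r2.
have r11 : 1 * 1 = 1%:~R :> R by rewrite mulr1.
have r2N0 : - r2 != 0 by rewrite oppr_eq0 gt_eqF// (lt_trans ltr01).
have th := theta_isom3 k; have tho := theta_oo k.
rewrite /tile_normal /tile_verts /base_ev /base_verts.
have [k0|kp] := posnP k.
  have -> : octa k by rewrite /octa k0.
  have thE : theta k = 1 by rewrite /theta k0.
  apply: (tile_dataP r11 (oner_neq0 R) th tho _ _ octa_check).
  - move=> e; rewrite !inE thE => /or3P[] /eqP->; rewrite mul1mx.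
    + by exists (MRe1 n); rewrite /ev /=; congr hv; rewrite ?rmorph0 ?mulr0 ?rmorphN1.
    + by exists (MTop n); rewrite /ev /=; congr hv; rewrite ?rmorph0 ?mulr0 ?rmorphN1 ?mul1r.
    + exists (MSph ord0); rewrite /ev /= /sph_root; congr hv; rewrite ?rmorph0 ?rmorph1 ?rmorphN1; ring.
  - rewrite thE => -[||||j]; rewrite mul1mx /ev /tile_center.
    + by right; rewrite mink_hv; lra.
    + left; split; first by rewrite mink_hv; lra.
      by exists (-1, 0, -1, 0) => //; rewrite mul1mx /=; congr hv; rewrite ?rmorph0 ?mulr0 ?rmorphN1.
    + left; split; first by rewrite mink_hv; lra.
      by exists (-1, 0, 0, -1) => //; rewrite mul1mx /=; congr hv; rewrite ?rmorph0 ?mulr0 ?rmorphN1 ?mul1r.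
    + by right; rewrite mink_hv; nra.
    + have [j0|jp] := posnP j.
        left; split; first by rewrite mink_hv j0; lra.
        exists (1, -1, 0, 0) => //; rewrite mul1mx /= /sph_root j0; congr hv; rewrite ?rmorph0 ?rmorph1 ?rmorphN1; ring.
      right; rewrite mink_hv; have : 1 <= j%:R :> R by rewrite ler1n.
      by move: (j%:R) => t; nra.
have [kl|kl] := leqP k (2 * n).
  have -> : octa k = false by rewrite /octa gtn_eqF//= ltnNge kl.
  have jn : (k.-1 < 2 * n)%N by rewrite prednK.
  have thE : theta k = vshift (- (k.-1%:R * r2)) by rewrite /theta gtn_eqF//= kl.
  apply: (tile_dataP r2N r2N0 th tho _ _ cubo_check).
  - move=> e; rewrite !inE thE => /or3P[] /eqP->; rewrite /ev vshift_hv.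
    + by exists (MRe1 n); rewrite /=; congr hv; ring.
    + exists (MSph (Ordinal (ltnW jn : (k.-1 < (2 * n).+1)%N))); rewrite /= /sph_root; congr hv; try ring.
      transitivity (1 - k.-1%:R ^+ 2 * (r2 * r2)); first by rewrite r2r2; ring.
      by ring.
    + exists (MSph (Ordinal (jn : (k.-1.+1 < (2 * n).+1)%N))); rewrite /= /sph_root -natr1; congr hv; try ring.
      transitivity (-1 - 2 * k.-1%:R * (r2 * r2) - k.-1%:R ^+ 2 * (r2 * r2)); first by rewrite r2r2; ring.
      by ring.
  - have jn' : k.-1%:R + 1 <= 2 * n%:R :> R by rewrite natr1 -natrM ler_nat.
    have j0 : 0 <= k.-1%:R :> R by [].
    have NE : theta k *m ev (- r2) tile_center =
        hv (2 + 4 * k.-1%:R + 4 * k.-1%:R ^+ 2) 2 1 (- r2 * (1 + 2 * k.-1%:R)).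
      rewrite thE /ev /= vshift_hv; congr hv; last by ring.
      transitivity (2 + 2 * k.-1%:R * (r2 * r2) + 2 * k.-1%:R ^+ 2 * (r2 * r2)); first by ring.
      by rewrite r2r2; ring.
    move=> i; rewrite NE thE /ev; case: i => [||||j].
    + by right; rewrite mink_hv; lra.
    + left; split; first by rewrite mink_hv; lra.
      by exists (-1, 0, -1, 0) => //; rewrite vshift_hv /=; congr hv; ring.
    + by right; rewrite mink_hv; nra.
    + by right; rewrite mink_hv; nra.
    (* Twice a product of consecutive integers: it vanishes exactly at the two hemispheres through
       the centre. *)
    + have E : mink (hv (2 + 4 * k.-1%:R + 4 * k.-1%:R ^+ 2) 2 1 (- r2 * (1 + 2 * k.-1%:R)))
          (root (MSph j)) = 2 * ((k.-1%:R - j%:R) * (k.-1%:R - j%:R + 1)).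
        rewrite mink_hv; transitivity (- (1 + 2 * k.-1%:R) * j%:R * (r2 * r2) + 2 * j%:R ^+ 2
          + 2 * k.-1%:R + 2 * k.-1%:R ^+ 2 : R); first by field.
        by rewrite r2r2; ring.
      rewrite E; have [jE|jk] := eqVneq (nat_of_ord j) k.-1.
        left; split; first by rewrite jE; ring.
        exists (1, -1, 0, 0) => //; rewrite vshift_hv /= /sph_root jE; congr hv; try ring.
        transitivity (1 - k.-1%:R ^+ 2 * (r2 * r2)); first by rewrite r2r2; ring.
        by ring.
      have [jE|jk'] := eqVneq (nat_of_ord j) k.-1.+1.
        left; split; first by rewrite jE -natr1; ring.
        exists (-1, -1, 0, -1) => //; rewrite vshift_hv /= /sph_root jE -natr1; congr hv; try ring.
        transitivity (-1 - 2 * k.-1%:R * (r2 * r2) - k.-1%:R ^+ 2 * (r2 * r2)); first by rewrite r2r2; ring.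
        by ring.
      right; move: (nat_of_ord j) (k.-1) jk jk' => a b.
      case: (ltngtP a b) => // h _ h'.
        have : a%:R + 1 <= b%:R :> R by rewrite natr1 ler_nat.
        by nra.
      have : b%:R + 2 <= a%:R :> R.
        by rewrite -natrD ler_nat addn2 ltn_neqAle eq_sym h' h.
      by nra.
have kE : k = (2 * n).+1 by apply/eqP; rewrite eqn_leq kl andbT -ltnS.
have -> : octa k by rewrite /octa kl orbT.
have thE p q x y : theta k *m hv p q x y =
    hv (p + 2 * (2 * n%:R * r2) * y + 2 * (2 * n%:R) ^+ 2 * q) q x (- y - 2 * n%:R * r2 * q).
  rewrite /theta gtn_eqF//= leqNgt kl /= -mulmxA refl_hv vshift_hv natrM; congr hv; last by ring.
  transitivity (p + 2 * (2 * n%:R * r2) * y + (2 * n%:R) ^+ 2 * (r2 * r2) * q); first by ring.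
  by rewrite r2r2; ring.
apply: (tile_dataP r11 (oner_neq0 R) th tho _ _ octa_check).
- move=> e; rewrite !inE => /or3P[] /eqP->; rewrite /ev thE.
  + by exists (MRe1 n); rewrite /=; congr hv; ring.
  + by exists (MBot n); rewrite /=; congr hv; ring.
  + by exists (MSph ord_max); rewrite /= /sph_root natrM; congr hv; ring.
- move=> i; rewrite /ev /tile_center thE; case: i => [||||j].
  + by right; rewrite mink_hv; lra.
  + left; split; first by rewrite mink_hv; lra.
    by exists (-1, 0, -1, 0) => //; rewrite thE /=; congr hv; ring.
  + by right; rewrite mink_hv; nra.
  + left; split; first by rewrite mink_hv; lra.
    by exists (-1, 0, 0, -1) => //; rewrite thE /=; congr hv; ring.
  + have E : mink (hv (2%:~R + 2 * (2 * n%:R * r2) * (1 * 1%:~R) + 2 * (2 * n%:R) ^+ 2 * 2%:~R) 2%:~R 1%:~R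
        (- (1 * 1%:~R) - 2 * n%:R * r2 * 2%:~R)) (root (MSph j)) =
        2 * (2 * n%:R - j%:R) ^+ 2 + r2 * (2 * n%:R - j%:R).
      rewrite mink_hv; transitivity (2 * n%:R * r2 + 8 * n%:R ^+ 2 + 2 * j%:R ^+ 2 - j%:R * r2
          - 4 * n%:R * j%:R * (r2 * r2) : R); first by field.
      by rewrite r2r2; ring.
    rewrite E; have := ltn_ord j; rewrite ltnS leq_eqVlt => /orP[/eqP jE|h].
      left; split; first by rewrite jE natrM; ring.
      by exists (1, -1, 0, 0) => //; rewrite thE /= /sph_root jE natrM; congr hv; ring.
    right; have : j%:R + 1 <= 2 * n%:R :> R by rewrite natr1 -natrM ler_nat.
    by nra.
Qed.

End TileGeometry.

(** * Facets of the hull *)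

Section Facets.
Variables (R : realType) (n : nat).
Local Notation root := (@mirror_root R n).
Local Notation W := (wgrp root).
Local Notation r2 := (@r2 R).
Local Notation V := (@orbit_oo R n).
Local Notation nrm := (@tile_normal R n).
Local Notation verts := (@tile_verts R n).
Local Notation cP := (@cox_root R n).

Definition normals : set 'cV[R]_4 :=
  [set N | exists w k, [/\ W w, (k < (2 * n).+2)%N & N = w *m nrm k]].

Lemma orbit_oo_mul w u : W w -> V u -> V (w *m u).
Proof.
by move=> Ww [w' Ww' <-]; exists (w * w'); [exact: wgrpM|rewrite mulmxA].
Qed.

Lemma orbit_oo_Lplus : V `<=` @Lplus R.
Proof.
move=> _ [w Ww <-]; apply: isom3_Lplus; first exact: (wgrp_isom3 cP Ww).
by rewrite /Lplus /= mink_hv !mxE /=; split; lra.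
Qed.

(** The induction carries stability under the inverse as well, which the last constructor of
    [generated] calls for. *)
Lemma generated_stable (S : set 'M[R]_4) (vs : seq 'cV[R]_4) x :
  (forall s, S s -> s * s = 1 /\ forall v, v \in vs -> s *m v \in vs) ->
  generated S x -> forall v, v \in vs -> x *m v \in vs.
Proof.
move=> Sv Sx.
have : x \is a GRing.unit /\
    forall v, v \in vs -> x *m v \in vs /\ x^-1 *m v \in vs.
  elim: Sx => {x} [x /Sv[xx xv]||x y _ [xu hx] _ [yu hy]|x _ [xu hx]].
  - have xu : x \is a GRing.unit by apply/unitrP; exists x.
    have xV : x^-1 = x by apply: (mulrI xu); rewrite divrr.
    by split=> // v vv; rewrite xV; split; exact: xv.
  - by rewrite unitr1; split=> // v vv; rewrite invr1 mul1mx.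
  - rewrite unitrMl ?xu ?yu; split=> // v vv; rewrite invrM// -!mulmxA.
    have [h1 _] := hy _ vv; have [_ h2] := hx _ vv.
    by have [h3 _] := hx _ h1; have [_ h4] := hy _ h2.
  - rewrite unitrV; split=> // v vv; rewrite invrK.
    by have [? ?] := hx _ vv.
by move=> [_ h] v /h[].
Qed.

Let oo_nrm k : (k < (2 * n).+2)%N -> mink (@oo R) (nrm k) = -1.
Proof.
move=> kn; have [_ h oov _ _] := @tile_data_ok R _ _ kn.
by have [h' _] := h _ oov; rewrite minkC.
Qed.

(** The gap between [oo] and the normal is 2 (1/2) 1 = 1. In the equality case the orbit vector
    comes from [oo] by mirrors through the normal, hence is a vertex of the tile. *)
Lemma normal_gap w w' k : W w -> W w' -> (k < (2 * n).+2)%N ->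
  mink (w *m nrm k) (w' *m @oo R) = -1 /\
     (exists2 v, v \in verts k & w' *m @oo R = w *m v)
  \/ mink (w *m nrm k) (w' *m @oo R) <= -2.
Proof.
move=> Ww Ww' kn; have [dN Nv oov rv _] := @tile_data_ok R _ _ kn.
have iw := wgrp_isom3 cP Ww.
have Wg : W (w^-1 * w') by apply: wgrpM => //; exact: (wgrpV cP Ww).
have E : mink (w *m nrm k) (w' *m @oo R) = mink ((w^-1 * w') *m @oo R) (nrm k).
  by rewrite minkC -[RHS](wgrp_mink cP _ _ Ww) -mulmxA isom3_mulKV.
case: (orbit_gap cP (@dom_oo R n) dN _ _ Wg); try lra.
  move=> [e [g Gg gE]]; left; rewrite E e oo_nrm//; split=> //.
  exists (g *m @oo R); last by rewrite -gE -mulmxA isom3_mulKV.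
  refine (generated_stable _ Gg oov) => _ [i /= i0 <-]; split; first exact: (rr cP i).
  by move=> v; exact: rv.
by rewrite oo_nrm// => h; right; rewrite E; lra.
Qed.

Lemma face_verts_tile w k : W w -> (k < (2 * n).+2)%N ->
  face_verts V (w *m nrm k) = [set w *m v | v in [set` verts k]].
Proof.
move=> Ww kn; have [_ Nv _ _ _] := @tile_data_ok R _ _ kn.
apply/seteqP; split=> [_ [[w' Ww' <-] e]|_ [v /= /Nv[vN vV] <-]].
  by case: (normal_gap Ww Ww' kn) => [[_ [v vv ->]]|]; [exists v|lra].
by split; [exact: orbit_oo_mul|rewrite /= (wgrp_mink cP)].
Qed.

Definition econe (S : set 'cV[R]_4) x := exists w, wcone S w x.

Lemma econeD S x y : econe S x -> econe S y -> econe S (x + y).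
Proof. by move=> [w h] [w' h']; exists (w + w'); exact: wconeD. Qed.

Lemma econeZ S (k : R) x : 0 <= k -> econe S x -> econe S (k *: x).
Proof. by move=> k0 [w h]; exists (k * w); exact: wconeZ. Qed.

Lemma econe1 S x : S x -> econe S x.
Proof. by move=> h; exists 1; exact: wcone1. Qed.

Lemma econe_mul (M : 'M[R]_4) S x : econe S x -> econe [set M *m v | v in S] (M *m x).
Proof.
move=> [w h]; exists (1 * w); rewrite -[M *m x]scale1r.
apply: (wcone_map (S := S) (f := mulmx M)) h => //.
  by move=> c y z; rewrite mulmxDr -scalemxAr.
by move=> v Sv; rewrite scale1r; apply: wcone1; exists v.
Qed.

(** This region lies in the tetrahedron with vertices oo, 0, 1, i, one of the four into which the
    octahedron splits around its axis from 1 to i. *)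
Lemma octa_cone p q x y : 0 <= x -> 0 <= y -> x + y <= q -> q <= p ->
  econe [set ev 1 v | v in [set` octa_verts]] (hv p q x y : 'cV[R]_4).
Proof.
move=> x0 y0 xyq qp.
have v0 : econe [set ev 1 v | v in [set` octa_verts]] (ev 1 (1, 0, 0, 0) : 'cV[R]_4).
  by apply: econe1; exists (1, 0, 0, 0).
have v1 : econe [set ev 1 v | v in [set` octa_verts]] (ev 1 (0, 1, 0, 0) : 'cV[R]_4).
  by apply: econe1; exists (0, 1, 0, 0).
have v2 : econe [set ev 1 v | v in [set` octa_verts]] (ev 1 (1, 1, 1, 0) : 'cV[R]_4).
  by apply: econe1; exists (1, 1, 1, 0).
have v3 : econe [set ev 1 v | v in [set` octa_verts]] (ev 1 (1, 1, 0, 1) : 'cV[R]_4).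
  by apply: econe1; exists (1, 1, 0, 1).
rewrite (_ : hv p q x y = (p - x - y) *: ev 1 (1, 0, 0, 0) + (q - x - y) *: ev 1 (0, 1, 0, 0) +
   x *: ev 1 (1, 1, 1, 0) + y *: ev 1 (1, 1, 0, 1)); last first.
  by rewrite /ev !hvZ !hvD; congr hv; ring.
by repeat apply: econeD; apply: econeZ => //; lra.
Qed.

(* The cone over a fundamental chamber of the symmetry group of the cuboctahedron
   is cut into simplices with apex the centre (half the sum of two opposite
   vertices). *)
Lemma cubo_cone p q x y : 0 <= x -> x <= q / 2 -> 0 <= y -> y <= q -> q <= p ->
  4 * y <= p + q ->
  econe [set ev (- r2) v | v in [set` cubo_verts]] (hv p q x (- r2 * y) : 'cV[R]_4).
Proof.
move=> x0 xq y0 yq qp ypq; set S := [set _ | _ in _].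
have vP v : v \in cubo_verts -> econe S (ev (- r2) v).
  by move=> vv; apply: econe1; exists v.
have half : 0 <= 1 / 2 :> R by lra.
(* Up to scale, [c0] is the centre, [sq] the centre of a square face, [em] and [em'] are midpoints
   of edges, [tc] and [tc'] centres of triangular faces. *)
have c0 : econe S (hv 2 2 1 (- r2)).
  rewrite (_ : hv _ _ _ _ = (1 / 2) *: (ev (- r2) (1, 0, 0, 0) + ev (- r2) (3, 4, 2, 2))).
    by apply: econeZ => //; apply: econeD; apply: vP.
  by rewrite /ev !hvD !hvZ; congr hv; by field.
have sq : econe S (hv 2 2 0 (- r2)).
  rewrite (_ : hv _ _ _ _ = (1 / 2) *: (ev (- r2) (1, 0, 0, 0) + ev (- r2) (0, 1, 0, 0)
      + ev (- r2) (1, 2, 0, 1) + ev (- r2) (2, 1, 0, 1))).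
    by apply: econeZ => //; repeat apply: econeD; apply: vP.
  by rewrite /ev !hvD !hvZ; congr hv; by field.
have v0 : econe S (hv 1 0 0 0).
  by have := vP (1, 0, 0, 0) isT; rewrite /ev mulr0.
have em : econe S (hv 1 1 0 0).
  rewrite (_ : hv _ _ _ _ = ev (- r2) (1, 0, 0, 0) + ev (- r2) (0, 1, 0, 0)).
    by apply: econeD; apply: vP.
  by rewrite /ev !hvD; congr hv; ring.
have tc : econe S (hv 2 2 1 0).
  rewrite (_ : hv _ _ _ _ = ev (- r2) (1, 0, 0, 0) + ev (- r2) (0, 1, 0, 0) + ev (- r2) (1, 1, 1, 0)).
    by repeat apply: econeD; apply: vP.
  by rewrite /ev !hvD; congr hv; ring.
have em' : econe S (hv 3 1 0 (- r2)).
  rewrite (_ : hv _ _ _ _ = ev (- r2) (1, 0, 0, 0) + ev (- r2) (2, 1, 0, 1)).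
    by apply: econeD; apply: vP.
  by rewrite /ev !hvD; congr hv; ring.
have tc' : econe S (hv 6 2 1 (- 2 * r2)).
  rewrite (_ : hv _ _ _ _ = ev (- r2) (1, 0, 0, 0) + ev (- r2) (2, 1, 0, 1) + ev (- r2) (3, 1, 1, 1)).
    by repeat apply: econeD; apply: vP.
  by rewrite /ev !hvD; congr hv; ring.
case: (lerP y (q / 2)) => h.
  case: (lerP x y) => h'.
    rewrite (_ : hv _ _ _ _ = x *: hv 2 2 1 (- r2) + (p - q) *: hv 1 0 0 0 +
        (y - x) *: hv 2 2 0 (- r2) + (q - 2 * y) *: hv 1 1 0 0).
      by repeat apply: econeD; apply: econeZ => //; lra.
    by rewrite !hvZ !hvD; congr hv; ring.
  rewrite (_ : hv _ _ _ _ = y *: hv 2 2 1 (- r2) + (p - q) *: hv 1 0 0 0 +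
      (x - y) *: hv 2 2 1 0 + (q - 2 * x) *: hv 1 1 0 0).
    by repeat apply: econeD; apply: econeZ => //; lra.
  by rewrite !hvZ !hvD; congr hv; ring.
case: (lerP (x + y) q) => h'.
  rewrite (_ : hv _ _ _ _ = x *: hv 2 2 1 (- r2) + (p - 4 * y + q) *: hv 1 0 0 0 +
      (q - y - x) *: hv 2 2 0 (- r2) + (2 * y - q) *: hv 3 1 0 (- r2)).
    by repeat apply: econeD; apply: econeZ => //; lra.
  by rewrite !hvZ !hvD; congr hv; ring.
rewrite (_ : hv _ _ _ _ = (q - y) *: hv 2 2 1 (- r2) + (p + q - 4 * y) *: hv 1 0 0 0 +
    (x + y - q) *: hv 6 2 1 (- 2 * r2) + (q - 2 * x) *: hv 3 1 0 (- r2)).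
  by repeat apply: econeD; apply: econeZ => //; lra.
by rewrite !hvZ !hvD; congr hv; ring.
Qed.

Lemma tile_verts_image k :
  [set` verts k] = [set @theta R n k *m v | v in [set @base_ev R n k v | v in [set` base_verts n k]]].
Proof.
apply/seteqP; split=> [v /= /mapP[u uv ->]|_ [_ [u uv <-] <-]].
  by exists (@base_ev R n k u) => //; exists u.
by rewrite /=; apply: (map_f (fun v => @theta R n k *m @base_ev R n k v)).
Qed.

(** The planes Im = 0, - sqrt 2, ..., - 2 n sqrt 2 cut the polyhedron into pieces, each inside one
    prototile. The second claim says q <= 2, that is, height at least 1/2; it is sharp at the
    centres of the cuboctahedra. *)
Lemma fundamental_domain f : H3 f -> dominant root f ->
  (exists2 k, (k < (2 * n).+2)%N & econe [set` verts k] f) /\ - mink f (@oo R) <= 1.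
Proof.
rewrite [f]hv_eta; move: (_ + _) (_ - _) (f 0 0) (f 1 0) => p q x y [ff f3] fd.
have r2r2 := @r2r2 R; have r2g := @r2_gt1 R; have n0 : 0 <= n%:R :> R by [].
have [q0 p0] : 0 < q /\ 0 < p by apply: hv_future f3; rewrite ff; lra.
have x0 : 0 <= x by have := fd (MRe0 n); rewrite mink_hv; lra.
have xq : x <= q / 2 by have := fd (MRe1 n); rewrite mink_hv; lra.
have yt : y <= q / 2 by have := fd (MTop n); rewrite mink_hv; lra.
have yb : - (4 * n%:R * r2 + 1) * q / 2 <= y by have := fd (MBot n); rewrite mink_hv; lra.
have sph (k : nat) : (k <= 2 * n)%N -> 0 <= p + 2 * k%:R * r2 * y + (2 * k%:R ^+ 2 - 1) * q.
  move=> kn; have := fd (MSph (Ordinal (kn : (k < (2 * n).+1)%N))).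
  by rewrite mink_hv /=; lra.
have ooE : - mink (hv p q x y) (@oo R) = q / 2 by rewrite /oo mink_hv; lra.
rewrite ooE; move: ff; rewrite mink_hv => ff.
case: (lerP 0 y) => y0.
  have pq : q <= p by have := sph 0%N isT; rewrite expr0n /=; lra.
  split; last by nra.
  exists 0%N => //; rewrite tile_verts_image /theta /= -[hv p q x y]mul1mx.
  by apply: econe_mul; apply: octa_cone => //; lra.
case: (lerP y (- (2 * n)%:R * r2 * q)) => yn.
  have pq := sph (2 * n)%N (leqnn _).
  set k : R := (2 * n)%:R in yn pq; have kE : k = 2 * n%:R by rewrite /k natrM.
  pose y' := - y - k * r2 * q; pose p' := p + 2 * k * r2 * y + 2 * k ^+ 2 * q.
  have y'0 : 0 <= y' by rewrite /y'; lra.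
  have y'q : y' <= q / 2 by rewrite /y' kE; lra.
  have p'q : q <= p' by rewrite /p'; lra.
  have ff' : x * x + y' * y' - (p' * q + p' * q) / 2 = -1.
    rewrite -ff /y' /p'; transitivity (x * x + y * y + 2 * y * k * r2 * q + k ^+ 2 * (r2 * r2) * q ^+ 2 -
      (p * q + 2 * k * r2 * y * q + 2 * k ^+ 2 * q ^+ 2)); first by field.
    by rewrite r2r2; by field.
  split; last by nra.
  exists (2 * n).+1 => //; rewrite tile_verts_image.
  have -> : hv p q x y = @theta R n (2 * n).+1 *m hv p' q x y'.
    rewrite /theta /= ltnn -mulmxA refl_hv vshift_hv -/k /p' /y'; congr hv; last by ring.
    transitivity (p + 2 * k * r2 * y + 2 * k ^+ 2 * q - 2 * k * r2 * y - 2 * k ^+ 2 * (r2 * r2) * q +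
      k ^+ 2 * (r2 * r2) * q); first by rewrite r2r2; ring.
    by ring.
  apply: econe_mul; rewrite /base_ev /base_verts /octa ltnSn orbT.
  by apply: octa_cone => //; lra.
(* The strip between two consecutive planes that contains the point, found by induction on the
   number of strips. *)
have [k [kn yk yk']] : exists k : nat, [/\ (k < 2 * n)%N, - (k%:R + 1) * r2 * q <= y & y <= - k%:R * r2 * q].
  move: yn {sph yb}; elim: (2 * n)%N => [|m IH] h; first by move: h; rewrite oppr0 !mul0r; lra.
  case: (lerP y (- m%:R * r2 * q)) => h'; last first.
    by have [k [? ? ?]] := IH h'; exists k; split=> //; exact: ltnW.
  by exists m; split=> //; rewrite natr1 ltW.
have s1 := sph k (ltnW kn); have s2 := sph k.+1 kn.
rewrite -natr1 in s2; move: s1 s2.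
set t : R := k%:R in yk yk' * => s1 s2.
(* Coordinates after moving the strip up to the first cuboctahedron, the last one in units of - sqrt
   2 as in [cubo_cone]. *)
pose Y := - (y + t * r2 * q) * r2 / 2; pose p' := p + 2 * t * r2 * y + 2 * t ^+ 2 * q.
have r2i : r2 * r2 / 2 = 1 by rewrite r2r2 divff.
have yY : y + t * r2 * q = - r2 * Y.
  by rewrite /Y; transitivity ((r2 * r2 / 2) * (y + t * r2 * q)); [rewrite r2i mul1r|ring].
have Y0 : 0 <= Y by nra.
have Yq : Y <= q by nra.
have p'q : q <= p' by rewrite /p'; lra.
have p'Y : 4 * Y <= p' + q.
  have E : p + 2 * (t + 1) * r2 * y + (2 * (t + 1) ^+ 2 - 1) * q = p' + q - 4 * Y.
    transitivity (p' + q + 2 * r2 * (y + t * r2 * q) + 2 * t * q * (2 - r2 * r2)).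
      by rewrite /p'; ring.
    rewrite yY r2r2; transitivity (p' + q - 2 * (r2 * r2) * Y); first by ring.
    by rewrite r2r2; ring.
  by lra.
have ff' : x * x + 2 * (Y * Y) - p' * q = -1.
  have -> : 2 * (Y * Y) = (y + t * r2 * q) * (y + t * r2 * q).
    by rewrite yY; transitivity ((r2 * r2) * (Y * Y)); [rewrite r2r2|ring].
  rewrite -ff /p'; transitivity (x * x + y * y + 2 * y * t * r2 * q + t ^+ 2 * (r2 * r2) * q ^+ 2 -
      (p * q + 2 * t * r2 * y * q + 2 * t ^+ 2 * q ^+ 2)); first by ring.
  by rewrite r2r2; by field.
split.
  exists k.+1; first by rewrite !ltnS ltnW.
  rewrite tile_verts_image.
  have -> : hv p q x y = @theta R n k.+1 *m hv p' q x (- r2 * Y).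
    rewrite /theta /= kn vshift_hv -/t -yY /p'; congr hv; last by ring.
    transitivity (p + 2 * t * r2 * y + 2 * t ^+ 2 * q - 2 * t * r2 * y - 2 * t ^+ 2 * (r2 * r2) * q +
      t ^+ 2 * (r2 * r2) * q); first by rewrite r2r2; ring.
    by ring.
  apply: econe_mul; rewrite /base_ev /base_verts /octa ltnNge kn /=.
  by apply: cubo_cone.
have qq : q * q <= 4; last by nra.
case: (lerP Y (q / 2)) => h; first by nra.
by nra.
Qed.

Lemma deep_vertex p : H3 p -> exists2 v, V v & - mink p v <= 1.
Proof.
move=> Hp; have [w Ww fd] := fundamental_rep n Hp.
have iw := wgrp_isom3 cP Ww.
have Hf : H3 (w^-1 *m p) by have [_ h] := isom3V iw; exact: h.
have [_ h] := fundamental_domain Hf fd.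
exists (w *m @oo R); first by exists w.
by rewrite -(isom3_mulKV p iw) (wgrp_mink cP).
Qed.

Lemma affdim_mul (M : 'M[R]_4) S : isom3 M -> affdim_ge3 S ->
  affdim_ge3 [set M *m v | v in S].
Proof.
move=> iM [p [pS rp]]; exists (fun k => M *m p k); split; first by move=> k; exists (p k).
rewrite -rp (_ : \matrix_(_, _) _ = (\matrix_(k, j) (p k j 0 - p 0 j 0)) *m M^T).
  by rewrite mxrankMfree// row_free_unit unitmx_tr; exact: isom3_unit.
apply/matrixP => i j; rewrite !mxE -sumrB; apply: eq_bigr => l _.
by rewrite !mxE; ring.
Qed.

Lemma quadratic_leading_ge0 (a b c d : R) : (forall m : nat, d <= a * m%:R ^+ 2 + b * m%:R + c) ->
  0 <= a.
Proof.
move=> h; case: (lerP 0 a) => // a0.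
pose B := (`|b| + `|c| + `|d| + 1) / - a.
have B0 : 0 < B by rewrite divr_gt0 ?oppr_gt0// ltr_wpDl// !addr_ge0.
have BE : a * B = - (`|b| + `|c| + `|d| + 1) by rewrite /B; field; rewrite lt_eqF.
pose m := (Num.truncn B).+1.
have mB : B < m%:R by have /andP[] := truncn_itv (ltW B0).
have m1 : 1 <= m%:R :> R by rewrite ler1n.
have := h m; move: (m%:R) mB m1 => t tB t1.
have at1 : a * t <= - (`|b| + `|c| + `|d| + 1) by rewrite -BE ler_nM2l// ltW.
have b1 := ler_norm b; have c1 := ler_norm c; have d1 := lerNnormlW (lexx `|d|).
have c2 : 0 <= `|c| by []. have d2 : 0 <= `|d| by [].
have e1 : a * t ^+ 2 <= - (`|b| + `|c| + `|d| + 1) * t.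
  by rewrite expr2 mulrA ler_pM2r//; lra.
have e2 : b * t <= `|b| * t by rewrite ler_pM2r//; lra.
have e3 : `|c| <= `|c| * t by rewrite ler_peMr.
have e4 : `|d| <= `|d| * t by rewrite ler_peMr.
lra.
Qed.

(** The translation z |-> z + 1. *)
Definition htrans : 'M[R]_4 := rfl (root (MRe1 n)) * rfl (root (MRe0 n)).

Lemma htransE m p q x y : (htrans ^+ m) *m hv p q x y =
  hv (p + 2 * m%:R * x + m%:R ^+ 2 * q) q (x + m%:R * q) y.
Proof.
elim: m p q x y => [|m IH] p q x y.
  by rewrite expr0 mul1mx; congr hv; ring.
rewrite exprSr -mulmxA /htrans -mulmxA !rfl_hv IH -natr1; congr hv; by field.
Qed.

Lemma htrans_wgrp m : W (htrans ^+ m).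
Proof.
elim: m => [|m IH]; first exact: wgrp1.
by rewrite exprS; apply: wgrpM => //; apply: wgrpM; exact: wgrp_r.
Qed.

End Facets.

(** * The tile normals as facet normals; local finiteness *)

Section FacetNormals.
Variables (R : realType) (n : nat).
Local Notation root := (@mirror_root R n).
Local Notation W := (wgrp root).
Local Notation V := (@orbit_oo R n).
Local Notation nrm := (@tile_normal R n).
Local Notation cP := (@cox_root R n).

(** Along the vectors of the integers m, the images of the vector of 0 under powers of [htrans], the
    form is a quadratic polynomial in m with leading coefficient its value at [oo]. A lower bound
    makes that coefficient nonnegative; w transports this to every orbit vector. *)
Lemma orbit_recession (l : 'rV[R]_4) a : (forall u, V u -> a <= (l *m u) 0 0) ->
  forall u, V u -> 0 <= (l *m u) 0 0.
Proof.
move=> la _ [w Ww <-].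
have V0 : V (hv 0 1 0 0).
  exists (rfl (root (MSph ord0))); first exact: wgrp_r.
  by rewrite /= /sph_root /oo rfl_hv; congr hv; rewrite /=; ring.
pose L (u : 'cV[R]_4) : R := (l *m (w *m u)) 0 0.
change (0 <= L (@oo R)); apply: (@quadratic_leading_ge0 R (L (@oo R)) (L (hv 0 0 1 0)) (L (hv 0 1 0 0)) a) => m.
rewrite (_ : _ + _ = L (htrans R n ^+ m *m hv 0 1 0 0)).
  apply: la; apply: orbit_oo_mul => //; apply: orbit_oo_mul => //; exact: htrans_wgrp.
rewrite htransE (_ : hv (_ + _) _ _ _ = m%:R ^+ 2 *: @oo R + m%:R *: hv 0 0 1 0 + hv 0 1 0 0).
  by rewrite /L !mulmxA !row_mulD !row_mulZ; ring.
by rewrite /oo !hvZ !hvD; congr hv; ring.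
Qed.

Lemma facet_normals_orbit : facet_normals V (normals n).
Proof.
split.
- exact: orbit_oo_Lplus.
- move=> _ _ [w [k [Ww kn ->]]] [w' Ww' <-].
  by case: (normal_gap Ww Ww' kn) => [[->//]|]; lra.
- move=> x Hx; have [w Ww fd] := fundamental_rep n Hx.
  have iw := wgrp_isom3 cP Ww.
  have Hf : H3 (w^-1 *m x) by have [_ h] := isom3V iw; exact: h.
  have [[k kn kf] _] := fundamental_domain Hf fd.
  exists (w *m nrm k); first by exists w, k.
  rewrite face_verts_tile//.
  by have := econe_mul w kf; rewrite isom3_mulKV.
- move=> _ [w [k [Ww kn ->]]]; rewrite face_verts_tile//.
  apply: affdim_mul; first exact: (wgrp_isom3 cP Ww).
  by have [_ _ _ _] := @tile_data_ok R _ _ kn.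
- exact: orbit_recession.
Qed.

Lemma normal_timelike k : mink (nrm k) (nrm k) < 0 /\ 0 < nrm k 3 0.
Proof.
have iT := @theta_isom3 R n k.
have Nk : mink (nrm k) (nrm k) < 0.
  case: (iT) => -> _; rewrite /base_ev /ev /=; case: ifP => _; rewrite mink_hv; first lra.
  by have := @r2r2 R; nra.
split=> //; have := isom3_future iT (u := @base_ev R n k tile_center).
have e : mink (@base_ev R n k tile_center) (@base_ev R n k tile_center) < 0.
  by case: (iT) => <- _.
move=> /(_ (ltW e)); rewrite -/(nrm k) lt0r => h.
have b3 : 0 <= @base_ev R n k tile_center 3 0 by rewrite /base_ev /ev /= !mxE /=; lra.
rewrite h// andbT; apply/eqP => N3; move: Nk; rewrite /mink N3.
have := sqr_ge0 (nrm k 0 0); have := sqr_ge0 (nrm k 1 0); have := sqr_ge0 (nrm k 2 0).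
by rewrite !expr2; lra.
Qed.

Lemma mink_continuous (v : 'cV[R]_4) : continuous (fun p : 'cV[R]_4 => mink v p).
Proof.
move=> x.
have c i : {for x, continuous (fun p : 'cV[R]_4 => p i 0)} by exact: coord_continuous.
have d i : {for x, continuous (fun p : 'cV[R]_4 => v i 0 * p i 0)}.
  by apply: continuousM; [exact: cst_continuous|exact: c].
exact: (continuousB (continuousD (continuousD (d 0) (d 1)) (d 2)) (d 3)).
Qed.

Lemma mink_sqr_continuous : continuous (fun p : 'cV[R]_4 => mink p p).
Proof.
move=> x.
have d i : {for x, continuous (fun p : 'cV[R]_4 => p i 0 * p i 0)}.
  by apply: continuousM; exact: coord_continuous.
exact: (continuousB (continuousD (continuousD (d 0) (d 1)) (d 2)) (d 3)).
Qed.

Lemma normals_finite B : finite_set [set N : 'cV[R]_4 | normals n N /\ N 3 0 <= B].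
Proof.
have : finite_set (\bigcup_(k in [set k | (k < (2 * n).+2)%N])
    [set u | [set w *m nrm k | w in W] u /\ u 3 0 <= B]).
  apply: bigcup_finite; first exact: finite_II.
  move=> k kn; have [t3 t0] := normal_timelike k.
  have [dk _ _ _ _] := @tile_data_ok R _ _ kn.
  exact: (orbit_finite cP B dk ltr01).
apply: sub_finite_set => _ [[w [k [Ww kn ->]]] h].
by exists k => //; split=> //; exists w.
Qed.

(** For p near x, the vector p - k d with d the time axis is still in the future cone, so N has
    nonpositive product with it. This bounds k times the time coordinate of N by - <N, p> <= - <N0,
    p>. *)
Lemma normals_lf : normals_locally_finite (@normals R n).
Proof.
move=> N0 x NN0 [xx x3].
have xx0 : mink x x < 0 by rewrite xx; lra.
pose d : 'cV[R]_4 := delta_mx 3 0.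
have [k k0 [k1 k2]] := timelike_perturb (- d) xx0 x3.
(* The first two conditions say that p - k d is timelike and future-directed; the third bounds <N0,
   p> from below. *)
exists [set p | [/\ mink p p + 2 * k * mink (- d) p + k ^+ 2 * mink d d < 0,
   0 < mink (- d) p - k & mink N0 x - 1 < mink N0 p]].
  have c1 : (fun p : 'cV[R]_4 => mink p p + 2 * k * mink (- d) p + k ^+ 2 * mink d d) @ x -->
      mink x x + 2 * k * mink (- d) x + k ^+ 2 * mink d d.
    exact: (cvgD (cvgD (@mink_sqr_continuous x)
      (cvgM (cvg_cst (2 * k)) (@mink_continuous (- d) x))) (cvg_cst _)).
  have c2 : (fun p : 'cV[R]_4 => mink (- d) p - k) @ x --> mink (- d) x - k.
    exact: (cvgB (@mink_continuous (- d) x) (cvg_cst k)).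
  have c3 := @mink_continuous N0 x.
  have dE : mink (- d) x = x 3 0 by rewrite /mink !mxE /=; ring.
  near=> p; split.
  - near: p; apply: (cvgr_lt _ c1).
    by move: k1; rewrite !minkE (minkC x d) => ?; lra.
  - near: p; apply: (cvgr_gt _ c2).
    by rewrite dE; move: k2; rewrite !mxE /=; lra.
  - near: p; apply: (cvgr_gt _ c3); lra.
apply: sub_finite_set (normals_finite ((1 - mink N0 x) / k)) => N [NN [p [[p1 p2 p3] _] h]].
split=> //; rewrite ler_pdivlMr//.
have [NN1 N3] : mink N N < 0 /\ 0 <= N 3 0.
  case: NN => w [j [Ww _ ->]]; have [h1 h2] := normal_timelike j.
  rewrite (wgrp_mink cP)//; split=> //.
  by apply: isom3_future; [exact: (wgrp_isom3 cP Ww)|exact: ltW|exact: ltW].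
have : mink N (p + k *: - d) <= 0.
  apply: mink_causal_le0 => //; first exact: ltW.
    by rewrite !minkE (minkC p d); move: p1; rewrite minkNl; lra.
  move: p2; rewrite (_ : mink (- d) p = p 3 0); last by rewrite /mink !mxE /=; ring.
  by rewrite !mxE /=; lra.
rewrite !minkE (_ : mink N d = - N 3 0); last by rewrite /mink !mxE /=; ring.
lra.
Unshelve. all: by end_near.
Qed.

End FacetNormals.

(** * Prototiles *)

Section Prototiles.
Variables (R : realType) (n : nat).
Local Notation root := (@mirror_root R n).
Local Notation W := (wgrp root).
Local Notation r2 := (@r2 R).
Local Notation nrm := (@tile_normal R n).
Local Notation verts := (@tile_verts R n).

Lemma radial_proportional (S S' : set 'cV[R]_4) :
  (forall v, S v -> exists2 k : R, 0 < k & S' (k *: v)) ->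
  radial (chull S) `<=` radial (chull S').
Proof.
move=> SS' x /radialP0[Hx [w xw]]; apply/radialP0; split=> //.
elim: xw => [|c v w' x' c0 Sv _ [w'' IH]]; first by exists 0; exact: wcone0.
have [k k0 h] := SS' _ Sv; exists (c / k + w'').
rewrite -[c in c *: v](@divfK _ k) ?gt_eqF// -scalerA.
by apply: wconeS => //; rewrite divr_ge0// ltW.
Qed.

Lemma move_radial (M : 'M[R]_4) S : isom3 M ->
  move M (radial (chull S)) = radial (chull [set M *m v | v in S]).
Proof.
have sub (N : 'M[R]_4) T : isom3 N -> move N (radial (chull T)) `<=` radial (chull [set N *m v | v in T]).
  move=> [_ NH] _ [x /radialP0[Hx xw] <-]; apply/radialP0; split; first exact: NH.
  exact: econe_mul xw.
move=> iM; apply/seteqP; split; first exact: sub.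
move=> x xr; exists (M^-1 *m x); last exact: isom3_mulKV.
have := sub M^-1 _ (isom3V iM) (M^-1 *m x) (ex_intro2 _ _ x xr erefl).
rewrite (_ : [set M^-1 *m v | v in [set M *m v | v in S]] = S)//.
apply/seteqP; split=> [_ [_ [v Sv <-] <-]|v Sv]; first by rewrite isom3_mulVK.
by exists (M *m v); [exists v|rewrite isom3_mulVK].
Qed.

Lemma cdivE (z : R[i]) (m : nat) a b : (m != 0)%N -> z = (m%:R * a) +i* (m%:R * b) ->
  z / m%:R = a +i* b.
Proof.
move=> m0 ->; have m0' : m%:R != 0 :> R[i] by rewrite pnatr_eq0.
apply: (mulIf m0'); rewrite divfK// (_ : m%:R = (m%:R)%:C); last exact: (esym (rmorph_nat (real_complex R) m)).
by apply/eqP; rewrite eq_complex /=; apply/andP; split; apply/eqP; ring.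
Qed.

(** An ideal point, the positive factor that scales its vector, and the resulting integral
    vertex. *)
Definition labelled := seq (option R[i] * R * ivec).

Lemma ideal_polyhedronE s (L : labelled) (zs : seq (option R[i])) vs :
  [seq t.1.1 | t <- L] = zs -> [seq t.2 | t <- L] = vs ->
  {in L, forall t, 0 < t.1.2 /\ t.1.2 *: ideal_vec t.1.1 = ev s t.2} ->
  ideal_polyhedron zs = radial (chull [set ev s v | v in [set` vs]]).
Proof.
move=> <- <- LP; apply/seteqP; split; apply: radial_proportional.
  move=> _ [_ /= /mapP[t tL ->] <-]; have [t0 tE] := LP _ tL.
  by exists t.1.2 => //; exists t.2 => //; apply: (map_f (fun t => t.2)).
move=> _ [_ /= /mapP[t tL ->] <-]; have [t0 tE] := LP _ tL.
exists t.1.2^-1; first by rewrite invr_gt0.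
exists t.1.1; first exact: (map_f (fun t => t.1.1)).
by rewrite -tE scalerK// gt_eqF.
Qed.

Lemma P1E : @P1 R = radial (chull [set ev 1 v | v in [set` octa_verts]]).
Proof.
apply: (@ideal_polyhedronE _ [:: (None, 1, (1, 0, 0, 0)); (Some 0, 1, (0, 1, 0, 0));
   (Some 1, 1, (1, 1, 1, 0)); (Some (iC R), 1, (1, 1, 0, 1));
   (Some (1 + iC R), 1, (2, 1, 1, 1)); (Some ((1 + iC R) / 2), 2, (1, 2, 1, 1))]) => //.
have half : (1 + iC R) / 2 = (1 / 2) +i* (1 / 2).
  by apply: cdivE => //; rewrite /iC; apply/eqP; rewrite eq_complex /=; apply/andP; split; apply/eqP; field.
have one : 1 + iC R = 1 +i* 1.
  by apply/eqP; rewrite eq_complex /=; apply/andP; split; apply/eqP; ring.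
move=> t; rewrite !inE => /or4P[/eqP->|/eqP->|/eqP->|/or3P[/eqP->|/eqP->|/eqP->]]; split => //=.
- by rewrite ideal_oo scale1r /ev; congr hv; ring.
- by rewrite -[0 : R[i]]/(0 +i* 0) ideal_hv hvZ; congr hv; ring.
- by rewrite -[1 : R[i]]/(1 +i* 0) ideal_hv hvZ; congr hv; ring.
- by rewrite /iC ideal_hv hvZ; congr hv; ring.
- by rewrite one ideal_hv hvZ; congr hv; ring.
- by rewrite half ideal_hv hvZ; congr hv; by field.
Qed.

Let cext (z : R[i]) a b : complex.Re z = a -> complex.Im z = b -> z = a +i* b.
Proof. by case: z => x y /= -> ->. Qed.

Lemma P2E : @P2 R = radial (chull [set ev (- r2) v | v in [set` cubo_verts]]).
Proof.
have r2r2 := @r2r2 R.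
pose c (a b : nat) : R[i] := (a%:R - b%:R * isqrt2 R) / 3.
apply: (@ideal_polyhedronE _ [:: (None, 1, (1, 0, 0, 0)); (Some 0, 1, (0, 1, 0, 0));
   (Some 1, 1, (1, 1, 1, 0)); (Some (- isqrt2 R), 1, (2, 1, 0, 1));
   (Some (1 - isqrt2 R), 1, (3, 1, 1, 1)); (Some (- isqrt2 R / 2), 2, (1, 2, 0, 1));
   (Some (1 - isqrt2 R / 2), 2, (3, 2, 2, 1)); (Some ((1 - isqrt2 R) / 2), 4, (3, 4, 2, 2));
   (Some (c 1%N 1%N), 3, (1, 3, 1, 1)); (Some (c 1%N 2), 3, (3, 3, 1, 2));
   (Some (c 2 1%N), 3, (2, 3, 2, 1)); (Some (c 2 2), 3, (4, 3, 2, 2))]) => //.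
have nE (m : nat) : (m%:R : R[i]) = m%:R +i* 0.
  exact: (esym (rmorph_nat (real_complex R) m)).
have sq : (- r2) ^+ 2 = 2 by rewrite sqrrN expr2.
have z1 : - isqrt2 R = 0 +i* (- r2) by apply: cext => //=; rewrite oppr0.
have z2 : 1 - isqrt2 R = 1 +i* (- r2) by apply: cext => /=; rewrite ?subr0 ?sub0r.
have z3 : - isqrt2 R / 2 = 0 +i* (- r2 / 2).
  by apply: cdivE => //; rewrite z1; congr (_ +i* _); by field.
have z4 : 1 - isqrt2 R / 2 = 1 +i* (- r2 / 2).
  by rewrite -mulNr z3; apply: cext => /=; ring.
have z5 : (1 - isqrt2 R) / 2 = (1 / 2) +i* (- r2 / 2).
  by apply: cdivE => //; rewrite z2; congr (_ +i* _); by field.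
have cE (a b : nat) : c a b = (a%:R / 3) +i* (- b%:R * r2 / 3).
  apply: cdivE => //; rewrite !nE /isqrt2 -/r2; apply: cext => /=; by field.
move=> t; rewrite !inE => /or4P[/eqP->|/eqP->|/eqP->|/or4P[/eqP->|/eqP->|/eqP->|
  /or4P[/eqP->|/eqP->|/eqP->|/or3P[/eqP->|/eqP->|/eqP->]]]]; split => //=.
- by rewrite ideal_oo scale1r /ev; congr hv; ring.
- by rewrite -[0 : R[i]]/(0 +i* 0) ideal_hv hvZ; congr hv; ring.
- by rewrite -[1 : R[i]]/(1 +i* 0) ideal_hv hvZ; congr hv; ring.
- by rewrite z1 ideal_hv hvZ sq; congr hv; ring.
- by rewrite z2 ideal_hv hvZ sq; congr hv; ring.
- rewrite z3 ideal_hv hvZ (_ : (- r2 / 2) ^+ 2 = r2 * r2 / 4); last by field.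
  by rewrite r2r2; congr hv; by field.
- rewrite z4 ideal_hv hvZ (_ : (- r2 / 2) ^+ 2 = r2 * r2 / 4); last by field.
  by rewrite r2r2; congr hv; by field.
- rewrite z5 ideal_hv hvZ (_ : (- r2 / 2) ^+ 2 = r2 * r2 / 4); last by field.
  by rewrite r2r2; congr hv; by field.
- rewrite cE ideal_hv hvZ (_ : (- _ * r2 / 3) ^+ 2 = 1 * (r2 * r2) / 9); last by field.
  by rewrite r2r2; congr hv; by field.
- rewrite cE ideal_hv hvZ (_ : (- _ * r2 / 3) ^+ 2 = 4 * (r2 * r2) / 9); last by field.
  by rewrite r2r2; congr hv; by field.
- rewrite cE ideal_hv hvZ (_ : (- _ * r2 / 3) ^+ 2 = 1 * (r2 * r2) / 9); last by field.
  by rewrite r2r2; congr hv; by field.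
- rewrite cE ideal_hv hvZ (_ : (- _ * r2 / 3) ^+ 2 = 4 * (r2 * r2) / 9); last by field.
  by rewrite r2r2; congr hv; by field.
Qed.

Lemma vshift_mxM (a b : R) : vshift_mx a * vshift_mx b = vshift_mx (a + b).
Proof.
rewrite /vshift_mx -[LHS]/(_ *m _) mx2M; congr mx2; rewrite ?mul1r ?mulr0 ?mulr1 ?mul0r ?add0r ?addr0//.
by apply/eqP; rewrite eq_complex /=; apply/andP; split; apply/eqP; ring.
Qed.

Lemma vshift_mx0 : vshift_mx 0 = 1 :> 'M[R[i]]_2.
Proof. by apply/matrixP => i j; move: i j; apply: ord2P; apply: ord2P; rewrite !mxE. Qed.

Lemma mx_cX k : mx_c R ^+ k = vshift_mx (k%:R * r2).
Proof.
elim: k => [|k IH]; first by rewrite mul0r vshift_mx0.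
rewrite exprSr IH -natr1 (_ : mx_c R = vshift_mx r2)//.
by rewrite vshift_mxM; congr vshift_mx; ring.
Qed.

Lemma mx_cVX k : mx_c R ^- k = vshift_mx (- (k%:R * r2)).
Proof.
have e1 : vshift_mx (k%:R * r2) * vshift_mx (- (k%:R * r2)) = 1.
  by rewrite vshift_mxM subrr vshift_mx0.
have e2 : vshift_mx (- (k%:R * r2)) * vshift_mx (k%:R * r2) = 1.
  by rewrite vshift_mxM addrC subrr vshift_mx0.
have u : vshift_mx (k%:R * r2) \is a GRing.unit.
  by apply/unitrP; exists (vshift_mx (- (k%:R * r2))).
by rewrite mx_cX; apply: (mulrI u); rewrite divrr// e1.
Qed.

Definition proto k : set 'cV[R]_4 := radial (chull [set` verts k]).

Lemma protoE k : proto k = move (@theta R n k)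
  (if octa n k then @P1 R else @P2 R).
Proof.
rewrite /proto tile_verts_image /base_ev /base_verts; have iT := @theta_isom3 R n k.
by case: ifP => _; rewrite ?P1E ?P2E move_radial.
Qed.

Lemma prototilesE : @prototiles R n = [set proto k | k in [set k | (k < (2 * n).+2)%N]].
Proof.
have move1 P : move 1 P = P :> set 'cV[R]_4.
  apply/seteqP; split=> [_ [x Px <-]|x Px]; first by rewrite mul1mx.
  by exists x => //; rewrite mul1mx.
apply/seteqP; split.
  move=> P [[->|[k /= kn <-]]|->].
  - by exists 0%N => //; rewrite protoE /theta /octa /= move1.
  - exists k.+1; first by rewrite /= !ltnS ltnW.
    by rewrite protoE /theta /octa /= kn ltnNge kn /= mx_cVX.
  - exists (2 * n).+1 => //=.
    by rewrite protoE /theta /octa /= ltnn ltnSn /= mx_cVX.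
move=> _ [[|k] /= kn <-]; rewrite protoE /theta /octa /=; first by left; left; rewrite move1.
case: ifP => h.
  left; right; exists k; first exact: h.
  by rewrite ltnNge h mx_cVX.
have kE : k = (2 * n)%N by move: kn; rewrite !ltnS leq_eqVlt h orbF => /eqP.
by right; rewrite kE ltnSn /= mx_cVX.
Qed.

Lemma tile_ofE w k : W w -> (k < (2 * n).+2)%N ->
  tile_of (@orbit_oo R n) (w *m nrm k) = move w (proto k).
Proof.
move=> Ww kn; rewrite /tile_of face_verts_tile// /proto move_radial//.
exact: (wgrp_isom3 (@cox_root R n) Ww).
Qed.

(** A tile is determined by its normal, so it is enough that the smaller group already reaches every
    W-translate of each normal. *)
Lemma tilesE : PGamma R n `<=` W ->
  (forall w k, W w -> (k < (2 * n).+2)%N -> exists2 g, PGamma R n g & w *m nrm k = g *m nrm k) ->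
  tiles R n = [set tile_of (@orbit_oo R n) N | N in @normals R n].
Proof.
move=> GW GD; rewrite /tiles prototilesE; apply/seteqP; split.
  move=> _ [M GM [_ [k kn <-] <-]]; exists (M *m nrm k); last by rewrite tile_ofE//; exact: GW.
  by exists M, k; split=> //; exact: GW.
move=> _ [_ [w [k [Ww kn ->]]] <-]; have [g Gg ->] := GD _ _ Ww kn.
exists g => //; exists (proto k); first by exists k.
by rewrite tile_ofE//; exact: GW.
Qed.

End Prototiles.

(** * Words in the generators *)

Section Words.
Variable R : realType.
Local Notation r2 := (@r2 R).

Lemma herm_unherm (X : 'M[R[i]]_2) : (barmx X)^T = X -> herm (unherm X) = X.
Proof.
rewrite [X]mx2_eta barmx2 mx2T => e; rewrite /unherm /herm !mxE /=.
have c i j := congr1 (fun M : 'M[R[i]]_2 => M i j) e.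
have := c 0 0; have := c 0 1; have := c 1 1; rewrite !mxE /= {c e}.
case: (X 0 0) (X 0 1) (X 1 0) (X 1 1) => [a a'] [b b'] [c c'] [d d'] /=.
move=> [d0] [bc bc'] [a0]; congr mx2; apply/eqP; rewrite eq_complex /=; apply/andP; split; apply/eqP; lra.
Qed.

Lemma barmxM (A B : 'M[R[i]]_2) : barmx (A *m B) = barmx A *m barmx B.
Proof. exact: map_mxM. Qed.

Lemma barmxK (A : 'M[R[i]]_2) : barmx (barmx A) = A.
Proof. by apply/matrixP => i j; rewrite !mxE conjcK. Qed.

Lemma barmxT (A : 'M[R[i]]_2) : barmx A^T = (barmx A)^T.
Proof. by apply/matrixP => i j; rewrite !mxE. Qed.

Lemma herm_sym (v : 'cV[R]_4) : (barmx (herm v))^T = herm v.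
Proof. by rewrite /herm barmx2 mx2T !conjc_real /= opprK. Qed.

Lemma herm_lorentz (A : 'M[R[i]]_2) v : herm (lorentz A *m v) = A *m herm v *m (barmx A)^T.
Proof.
rewrite lorentzE herm_unherm// !barmxM barmxT barmxK !trmx_mul trmxK herm_sym.
by rewrite mulmxA.
Qed.

Lemma herm_inj (u v : 'cV[R]_4) : herm u = herm v -> u = v.
Proof. by move/(congr1 (@unherm R)); rewrite !unhermK. Qed.

Lemma lorentzM (A B : 'M[R[i]]_2) : lorentz (A *m B) = lorentz A *m lorentz B.
Proof.
apply: mulmx_inj4 => v; apply: herm_inj.
by rewrite -mulmxA !herm_lorentz barmxM trmx_mul !mulmxA.
Qed.

Lemma lorentz1 : lorentz 1%:M = 1%:M :> 'M[R]_4.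
Proof.
apply: (@mulmx_inj4 R) => v; apply: herm_inj; rewrite herm_lorentz !mul1mx.
by rewrite /barmx map_mx1 trmx1 mulmx1.
Qed.

Lemma lorentzN (A : 'M[R[i]]_2) : lorentz (- A) = lorentz A.
Proof.
apply: mulmx_inj4 => v; apply: herm_inj; rewrite (herm_lorentz (- A)) (herm_lorentz A).
by rewrite /barmx map_mxN linearN /= mulNmx mulmxN mulNmx opprK.
Qed.

Lemma lorentzV (A : 'M[R[i]]_2) : \det A = 1 -> lorentz A^-1 = (lorentz A)^-1.
Proof.
move=> dA; have Au : A \is a GRing.unit by change (A \in unitmx); rewrite unitmxE dA unitr1.
have e1 : lorentz A * lorentz A^-1 = 1.
  by rewrite -[LHS]lorentzM -[A *m _]/(A / A) divrr// lorentz1.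
have e2 : lorentz A^-1 * lorentz A = 1.
  by rewrite -[LHS]lorentzM -[_ *m A]/(A^-1 * A) mulVr// lorentz1.
move: (lorentz A) (lorentz A^-1) e1 e2 => M N e1 e2.
have u : M \is a GRing.unit by apply/unitrP; exists N.
by apply: (mulrI u); rewrite divrr.
Qed.

Lemma herm_refl (v : 'cV[R]_4) : herm (refl R *m v) = barmx (herm v).
Proof.
rewrite [v]hv_eta refl_hv /herm barmx2 !mxE /=.
by congr mx2; apply/eqP; rewrite eq_complex /= ?oppr0 ?opprK !eqxx.
Qed.

Lemma refl_lorentz (A : 'M[R[i]]_2) : refl R *m lorentz A = lorentz (barmx A) *m refl R.
Proof.
apply: mulmx_inj4 => v; apply: herm_inj.
by rewrite -!mulmxA herm_refl !herm_lorentz herm_refl !barmxM barmxT barmxK.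
Qed.

Lemma reflK : refl R *m refl R = 1%:M.
Proof.
by apply: mulmx_inj4 => v; rewrite [v]hv_eta -mulmxA !refl_hv opprK mul1mx.
Qed.

(* Words are evaluated in the ring Z[i, sqrt 2]: (a, b, c, d) stands for
   (a + b sqrt 2) + i (c + d sqrt 2). *)
Definition znum : Type := (int * int * int * int)%type.

Definition zadd (u v : znum) : znum :=
  let: (a, b, c, d) := u in let: (a', b', c', d') := v in (a + a', b + b', c + c', d + d').

Definition zopp (u : znum) : znum :=
  let: (a, b, c, d) := u in (- a, - b, - c, - d).

Definition zconj (u : znum) : znum :=
  let: (a, b, c, d) := u in (a, b, - c, - d).

Definition zmul (u v : znum) : znum :=
  let: (a, b, c, d) := u in let: (a', b', c', d') := v in
  (a * a' + 2 * (b * b') - (c * c' + 2 * (d * d')), a * b' + b * a' - (c * d' + d * c'),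
   a * c' + 2 * (b * d') + (c * a' + 2 * (d * b')), a * d' + b * c' + (c * b' + d * a')).

Definition zev (u : znum) : R[i] :=
  let: (a, b, c, d) := u in (a%:~R + b%:~R * r2) +i* (c%:~R + d%:~R * r2).

Lemma zevD u v : zev (zadd u v) = zev u + zev v.
Proof.
move: u v => [[[a b] c] d] [[[a' b'] c'] d'] /=.
by apply/eqP; rewrite eq_complex /= !rmorphD /=; apply/andP; split; apply/eqP; ring.
Qed.

Lemma zevN u : zev (zopp u) = - zev u.
Proof.
move: u => [[[a b] c] d] /=.
by apply/eqP; rewrite eq_complex /= !rmorphN /=; apply/andP; split; apply/eqP; ring.
Qed.

Lemma zev_conj u : zev (zconj u) = conjc (zev u).
Proof.
move: u => [[[a b] c] d] /=.
by apply/eqP; rewrite eq_complex /= !rmorphN /=; apply/andP; split; apply/eqP; ring.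
Qed.

Lemma zevM u v : zev (zmul u v) = zev u * zev v.
Proof.
have r2r2 := @r2r2 R.
move: u v => [[[a b] c] d] [[[a' b'] c'] d'] /=.
apply/eqP; rewrite eq_complex /= !(rmorphD, rmorphN, rmorphM) /=.
by apply/andP; split; apply/eqP; ring: r2r2.
Qed.

Definition zmat : Type := (znum * znum * znum * znum)%type.

Definition zmmul (A B : zmat) : zmat :=
  let: (a, b, c, d) := A in let: (a', b', c', d') := B in
  (zadd (zmul a a') (zmul b c'), zadd (zmul a b') (zmul b d'),
   zadd (zmul c a') (zmul d c'), zadd (zmul c b') (zmul d d')).

Definition zmconj (A : zmat) : zmat :=
  let: (a, b, c, d) := A in (zconj a, zconj b, zconj c, zconj d).

Definition zmopp (A : zmat) : zmat :=
  let: (a, b, c, d) := A in (zopp a, zopp b, zopp c, zopp d).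

Definition zmev (A : zmat) : 'M[R[i]]_2 :=
  let: (a, b, c, d) := A in mx2 (zev a) (zev b) (zev c) (zev d).

Lemma zmevM A B : zmev (zmmul A B) = zmev A *m zmev B.
Proof.
move: A B => [[[a b] c] d] [[[a' b'] c'] d'].
by rewrite /zmmul /zmev mx2M !zevD !zevM.
Qed.

Lemma zmev_conj A : zmev (zmconj A) = barmx (zmev A).
Proof. by move: A => [[[a b] c] d]; rewrite /zmconj /zmev barmx2 !zev_conj. Qed.

Lemma zmevN A : zmev (zmopp A) = - zmev A.
Proof.
move: A => [[[a b] c] d]; rewrite /zmopp /zmev !zevN.
by apply/matrixP => i j; move: i j; apply: ord2P; apply: ord2P; rewrite !mxE.
Qed.

(* (A, false) is z |-> A z, and (A, true) is z |-> A (conj z). *)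
Definition token : Type := (zmat * bool)%type.

(* Locked, so that unification does not unfold isometries into matrix products. *)
Definition iso (t : token) : 'M[R]_4 :=
  locked (lorentz (zmev t.1) *m (if t.2 then refl R else 1)).

Lemma isoE t : iso t = lorentz (zmev t.1) *m (if t.2 then refl R else 1).
Proof. by rewrite /iso -lock. Qed.

(** Moving a conjugation past a matrix conjugates its entries. *)
Definition tmul (t u : token) : token :=
  (zmmul t.1 (if t.2 then zmconj u.1 else u.1), t.2 (+) u.2).

(** Equality up to sign of the matrix, which does not affect the isometry. *)
Definition teq (t u : token) := (t.2 == u.2) && ((t.1 == u.1) || (t.1 == zmopp u.1)).

Lemma isoM t u : iso (tmul t u) = iso t * iso u.
Proof.
rewrite !isoE /tmul /= zmevM lorentzM -[RHS]/(_ *m _) -!mulmxA; congr (_ *m _).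
case: t => A [] /=; last by rewrite mul1mx; case: u => B [].
rewrite zmev_conj [in RHS]mulmxA refl_lorentz -mulmxA; congr (_ *m _).
by case: u => B [] /=; rewrite ?mulmx1 ?reflK.
Qed.

Lemma iso_teq t u : teq t u -> iso t = iso u.
Proof.
move: t u => [A a] [B b] /andP[/= /eqP-> /orP[/eqP->//|/eqP->]].
by rewrite !isoE /= zmevN lorentzN.
Qed.

Definition tone : token := ((1, 0, 0, 0) : znum, (0, 0, 0, 0) : znum, (0, 0, 0, 0) : znum, (1, 0, 0, 0) : znum, false).

Definition tprod (l : seq token) : token := foldr tmul tone l.

Lemma iso_tone : iso tone = 1.
Proof.
rewrite isoE /= mulmx1; transitivity (lorentz 1%:M : 'M[R]_4); last exact: lorentz1.
congr lorentz.
apply/matrixP => i j; move: i j; apply: ord2P; apply: ord2P; rewrite !mxE /=;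
  by apply/eqP; rewrite eq_complex /= !mul0r !addr0 !eqxx.
Qed.

Lemma iso_tprod l : iso (tprod l) = \prod_(t <- l) iso t.
Proof.
elim: l => [|t l IH]; first by rewrite big_nil iso_tone.
by rewrite big_cons -IH -isoM.
Qed.

End Words.

(** * Groups generated by involutions *)

Section InvolutionGroups.
Variable G : unitRingType.
Implicit Types (S T L U : set G) (x y z a b : G).

Lemma generated_sub S T : S `<=` generated T -> generated S `<=` generated T.
Proof.
move=> ST x; elim=> {x} [x /ST//||x y _ ? _ ?|x _ ?]; first exact: generated_one.
- exact: generated_mul.
- exact: generated_inv.
Qed.

(** Inverses are reversed words, so products of generators suffice. *)
Lemma generated_prod S x : (forall s, S s -> s * s = 1) -> generated S x ->
  exists2 l : seq G, (forall s, s \in l -> S s) & x = \prod_(s <- l) s.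
Proof.
move=> SS.
have inv (l : seq G) : (forall s, s \in l -> S s) ->
    (\prod_(s <- l) s) * (\prod_(s <- rev l) s) = 1.
  elim: l => [|s l IH] h; first by rewrite !big_nil mulr1.
  rewrite big_cons rev_cons -cats1 big_cat big_seq1 /= mulrA -(mulrA s) IH => [|t tl].
    by rewrite mulr1 SS//; apply: h; rewrite inE eqxx.
  by apply: h; rewrite inE tl orbT.
elim=> {x} [x Sx||x y _ [l lS ->] _ [m mS ->]|x _ [l lS ->]].
- by exists [:: x] => [s|]; rewrite ?big_seq1// inE => /eqP->.
- by exists [::] => //; rewrite big_nil.
- exists (l ++ m); last by rewrite big_cat.
  by move=> s; rewrite mem_cat => /orP[/lS|/mS].
- have rS : forall s, s \in rev l -> S s by move=> s; rewrite mem_rev; exact: lS.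
  exists (rev l) => //; have := inv _ rS; rewrite revK; have := inv _ lS.
  move: (\prod_(s <- l) s) (\prod_(s <- rev l) s) => u v uv vu.
  have uu : u \is a GRing.unit by apply/unitrP; exists v.
  by apply: (mulrI uu); rewrite divrr.
Qed.

Lemma generated_indl S (P : G -> Prop) : (forall s, S s -> s * s = 1) -> P 1 ->
  (forall s x, S s -> P x -> P (s * x)) -> forall x, generated S x -> P x.
Proof.
move=> SS P1 Ps x /(generated_prod SS)[l lS ->].
elim: l lS => [|s l IH] lS; first by rewrite big_nil.
rewrite big_cons; apply: Ps; first by apply: lS; rewrite inE eqxx.
by apply: IH => t tl; apply: lS; rewrite inE tl orbT.
Qed.

Lemma generated_indr S (P : G -> Prop) : (forall s, S s -> s * s = 1) -> P 1 ->
  (forall s x, S s -> P x -> P (x * s)) -> forall x, generated S x -> P x.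
Proof.
move=> SS P1 Ps x /(generated_prod SS)[l lS ->].
elim/last_ind: l lS => [|l s IH] lS; first by rewrite big_nil.
rewrite -cats1 big_cat big_seq1; apply: Ps; first by apply: lS; rewrite mem_rcons inE eqxx.
by apply: IH => t tl; apply: lS; rewrite mem_rcons inE tl orbT.
Qed.

Definition inprod L U x := exists a b, [/\ L a, U b & x = a * b].

(** The Coxeter relations of the symmetric group S_4, with no claim of faithfulness. *)
Definition A3 x y z := [/\ x * x = 1, y * y = 1, z * z = 1 &
  [/\ x * (y * x) = y * (x * y), y * (z * y) = z * (y * z) & x * z = z * x]].

Lemma A3_invol x y z : A3 x y z -> forall s, [set x; y; z] s -> s * s = 1.
Proof. by move=> [xx yy zz _] s [[->|->]|->]. Qed.

(** Representatives for the four cosets of S_3 in S_4: left multiplication by a generator permutes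
    them up to a factor from the subgroup on the right. *)
Lemma A3_coset_end x y z d : A3 x y z -> generated [set x; y; z] d ->
  exists e h, [/\ e \in [:: 1; z; y * z; x * (y * z)], generated [set x; y] h & d = e * h].
Proof.
move=> a3; have [xx yy zz [xy yz xz]] := a3.
have xyx : x * y * x = y * x * y by rewrite -!mulrA.
have zyz : y * z * y = z * y * z by rewrite -!mulrA.
have hx h : generated [set x; y] h -> generated [set x; y] (x * h).
  by apply: generated_mul; apply: generated_incl; left.
have hy h : generated [set x; y] h -> generated [set x; y] (y * h).
  by apply: generated_mul; apply: generated_incl; right.
have fin e' h' u : u = e' * h' -> e' \in [:: 1; z; y * z; x * (y * z)] ->
    generated [set x; y] h' ->
    exists e h0, [/\ e \in [:: 1; z; y * z; x * (y * z)], generated [set x; y] h0 & u = e * h0].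
  by move=> -> ? ?; exists e', h'.
have m1 : 1 \in [:: 1; z; y * z; x * (y * z)] by rewrite !inE eqxx.
have m2 : z \in [:: 1; z; y * z; x * (y * z)] by rewrite !inE eqxx ?orbT.
have m3 : y * z \in [:: 1; z; y * z; x * (y * z)] by rewrite !inE eqxx ?orbT.
have m4 : x * (y * z) \in [:: 1; z; y * z; x * (y * z)] by rewrite !inE eqxx ?orbT.
move: d; apply: (generated_indl (A3_invol a3)); first by apply: (fin 1 1); rewrite ?mulr1//; exact: generated_one.
move=> s d S [e [h [el hg ->]]]; move: el; rewrite !inE => /or4P[] /eqP->; case: S => [[->|->]|->].
- by apply: (fin 1 (x * h)); [rewrite !mul1r| |exact: hx].
- by apply: (fin 1 (y * h)); [rewrite !mul1r| |exact: hy].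
- by apply: (fin z h); rewrite // mul1r.
- by apply: (fin z (x * h)); [rewrite !mulrA xz| |exact: hx].
- by apply: (fin (y * z) h); rewrite // mulrA.
- by apply: (fin 1 h); rewrite // mulrA zz.
- by apply: (fin (x * (y * z)) h); rewrite // !mulrA.
- by apply: (fin z h); rewrite // !mulrA yy mul1r.
- by apply: (fin (y * z) (y * h)); [rewrite !mulrA zyz| |exact: hy].
- by apply: (fin (y * z) h); rewrite // !mulrA xx mul1r.
- apply: (fin (x * (y * z)) (x * h)) => //; last exact: hx.
  by rewrite !mulrA -xyx -(mulrA (x * y) x z) xz !mulrA.
- apply: (fin (x * (y * z)) (y * h)) => //; last exact: hy.
  by rewrite !mulrA -xz -(mulrA x z y) -(mulrA x (z * y) z) -zyz !mulrA.
Qed.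

(** Representatives for the six cosets in S_4 of the subgroup of order 4 generated by two commuting
    transpositions. *)
Lemma A3_coset_mid x y z d : A3 x y z -> generated [set x; y; z] d ->
  exists e h, [/\ e \in [:: 1; y; x * y; z * y; x * (z * y); y * (x * (z * y))],
    generated [set x; z] h & d = e * h].
Proof.
set E := [:: _; _; _; _; _; _].
move=> a3; have [xx yy zz [xy yz xz]] := a3.
have xyx : x * y * x = y * x * y by rewrite -!mulrA.
have zyz : y * z * y = z * y * z by rewrite -!mulrA.
have hx h : generated [set x; z] h -> generated [set x; z] (x * h).
  by apply: generated_mul; apply: generated_incl; left.
have hz h : generated [set x; z] h -> generated [set x; z] (z * h).
  by apply: generated_mul; apply: generated_incl; right.
have fin e' h' u : u = e' * h' -> e' \in E ->
    generated [set x; z] h' ->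
    exists e h0, [/\ e \in E, generated [set x; z] h0 & u = e * h0].
  by move=> -> ? ?; exists e', h'.
have m1 : 1 \in E by rewrite !inE eqxx.
have m2 : y \in E by rewrite !inE eqxx ?orbT.
have m3 : x * y \in E by rewrite !inE eqxx ?orbT.
have m4 : z * y \in E by rewrite !inE eqxx ?orbT.
have m5 : x * (z * y) \in E by rewrite !inE eqxx ?orbT.
have m6 : y * (x * (z * y)) \in E by rewrite !inE eqxx ?orbT.
move: d; apply: (generated_indl (A3_invol a3)); first by apply: (fin 1 1); rewrite ?mulr1//; exact: generated_one.
move=> s d S [e [h [el hg ->]]]; move: el; rewrite !inE.
move=> /or4P[/eqP->|/eqP->|/eqP->|/or3P[]/eqP->]; case: S => [[->|->]|->].
- by apply: (fin 1 (x * h)); [rewrite !mul1r| |exact: hx].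
- by apply: (fin y h); rewrite // mul1r.
- by apply: (fin 1 (z * h)); [rewrite !mul1r| |exact: hz].
- by apply: (fin (x * y) h); rewrite // mulrA.
- by apply: (fin 1 h); rewrite // mulrA yy.
- by apply: (fin (z * y) h); rewrite // mulrA.
- by apply: (fin y h); rewrite // !mulrA xx mul1r.
- by apply: (fin (x * y) (x * h)); [rewrite !mulrA -xyx| |exact: hx].
- by apply: (fin (x * (z * y)) h); rewrite // !mulrA -xz.
- by apply: (fin (x * (z * y)) h); rewrite // !mulrA.
- by apply: (fin (z * y) (z * h)); [rewrite !mulrA zyz| |exact: hz].
- by apply: (fin y h); rewrite // !mulrA zz mul1r.
- by apply: (fin (z * y) h); rewrite // !mulrA xx mul1r.
- by apply: (fin (y * (x * (z * y))) h); rewrite // !mulrA.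
- by apply: (fin (x * y) h); rewrite // !mulrA -xz -(mulrA x z z) zz mulr1.
- apply: (fin (y * (x * (z * y))) (z * h)) => //; last exact: hz.
  by rewrite !mulrA xyx -(mulrA (y * x) y z) -(mulrA (y * x) (y * z) y) zyz !mulrA.
- by apply: (fin (x * (z * y)) h); rewrite // !mulrA yy mul1r.
- apply: (fin (y * (x * (z * y))) (x * h)) => //; last exact: hx.
  rewrite !mulrA -(mulrA (z * y) x z) xz mulrA -zyz.
  rewrite -(mulrA (y * z) y x) -(mulrA (y * z) (y * x) y) -xyx !mulrA.
  by rewrite -(mulrA y z x) -xz mulrA.
Qed.

Lemma generated_inprod S L D : (forall s, S s -> s * s = 1) ->
  (forall a b, L a -> L b -> L (a * b)) -> L 1 -> D 1 ->
  (forall s d, S s -> D d -> inprod L D (d * s)) ->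
  forall x, generated S x -> inprod L D x.
Proof.
move=> SS LM L1 D1 SD; apply: (generated_indr SS); first by exists 1, 1; rewrite mulr1.
move=> s _ Ss [a [d [La Dd ->]]]; have [a' [d' [La' Dd' e]]] := SD _ _ Ss Dd.
by exists (a * a'), d'; split=> //; [exact: LM|rewrite -mulrA e mulrA].
Qed.

(** To adjoin a to D it suffices to rewrite d a for d in D. As a commutes with K, the factor of d in
    K passes to the right of a, and only coset representatives e of K in D remain: finitely many
    words e a. *)
Lemma level_aux S0 D K (E : seq G) H a : (forall s, D s -> s * s = 1) -> a * a = 1 ->
  K `<=` D -> H 1 -> (forall u v, H u -> H v -> H (u * v)) ->
  (forall d, generated D d -> exists e h, [/\ e \in E, generated K h & d = e * h]) ->
  (forall s, K s -> a * s = s * a) ->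
  (forall e, e \in E -> inprod H (generated D) (e * a)) ->
  S0 = a |` D -> forall m, generated S0 m -> inprod H (generated D) m.
Proof.
move=> DD aa KD H1 HM coset aK hw ->.
apply: generated_inprod; [|exact: HM|exact: H1|exact: generated_one|].
  by move=> s [->|/DD].
move=> s d [->|Ds] Dd; last first.
  by exists 1, (d * s); rewrite mul1r; split=> //; apply: generated_mul => //; exact: generated_incl.
have [e [h [eE hg ->]]] := coset _ Dd.
have hA : h * a = a * h.
  move: h hg; apply: (generated_indl (S := K)); first by move=> t /KD/DD.
    by rewrite mul1r mulr1.
  by move=> t h Kt e'; rewrite -mulrA e' !mulrA aK.
have Dh : generated D h by apply: generated_sub hg => t /KD; exact: generated_incl.
have [u [v [Hu Dv eA]]] := hw _ eE.
exists u, (v * h); split=> //; first exact: generated_mul.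
by rewrite -mulrA hA !mulrA eA.
Qed.

Lemma level_end H a x y z : A3 x y z -> a * a = 1 -> a * x = x * a -> a * y = y * a ->
  H 1 -> (forall u v, H u -> H v -> H (u * v)) ->
  (forall e, e \in [:: 1; z; y * z; x * (y * z)] ->
     inprod H (generated [set x; y; z]) (e * a)) ->
  forall m, generated (a |` [set x; y; z]) m -> inprod H (generated [set x; y; z]) m.
Proof.
move=> a3 aa ax ay H1 HM hE.
have KD : [set x; y] `<=` [set x; y; z] by move=> s h; left.
apply: (level_aux (A3_invol a3) aa KD H1 HM _ _ hE) => //.
- by move=> d; exact: A3_coset_end.
- by move=> s [->|->].
Qed.

Lemma level_mid H a x y z : A3 x y z -> a * a = 1 -> a * x = x * a -> a * z = z * a ->
  H 1 -> (forall u v, H u -> H v -> H (u * v)) ->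
  (forall e, e \in [:: 1; y; x * y; z * y; x * (z * y); y * (x * (z * y))] ->
     inprod H (generated [set x; y; z]) (e * a)) ->
  forall m, generated (a |` [set x; y; z]) m -> inprod H (generated [set x; y; z]) m.
Proof.
move=> a3 aa ax az H1 HM hE.
have KD : [set x; z] `<=` [set x; y; z] by move=> s [->|->]; [left; left|right].
apply: (level_aux (A3_invol a3) aa KD H1 HM _ _ hE) => //.
- by move=> d; exact: A3_coset_mid.
- by move=> s [->|->].
Qed.

(** Factors from the subgroup of x and y already lie in U, so only the four coset representatives
    have to be rewritten. *)
Lemma crossing H U x y z : A3 x y z -> U x -> U y ->
  (forall e, e \in [:: 1; z; y * z; x * (y * z)] -> inprod H (generated U) e) ->
  forall d, generated [set x; y; z] d -> inprod H (generated U) d.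
Proof.
move=> a3 Ux Uy hE d /(A3_coset_end a3)[e [h [/hE[u [v [Hu Uv ->]]] hg ->]]].
exists u, (v * h); split=> //; last by rewrite mulrA.
apply: generated_mul => //; apply: generated_sub hg => s [->|->]; exact: generated_incl.
Qed.

End InvolutionGroups.

(** * Rewriting in the two base groups *)

Section BaseGroups.
Variable R : realType.
Local Notation r2 := (@r2 R).
Local Notation iso := (@iso R).

Definition zi (a b c d : int) : znum := (a, b, c, d).
Definition ztok (a b c d : znum) (s : bool) : token := (a, b, c, d, s).

(** The tokens [tA], [tB], [tC], [tS0], [tS1] are the reflections in Re = 0, Re = 1/2, Im = 1/2 and
    the unit hemispheres centred at 0 and - i sqrt 2, written with matrices of determinant 1. *)
Definition tA := ztok (zi 0 0 1 0) (zi 0 0 0 0) (zi 0 0 0 0) (zi 0 0 (-1) 0) true.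
Definition tB := ztok (zi 0 0 1 0) (zi 0 0 (-1) 0) (zi 0 0 0 0) (zi 0 0 (-1) 0) true.
Definition tC := ztok (zi 1 0 0 0) (zi 0 0 1 0) (zi 0 0 0 0) (zi 1 0 0 0) true.
Definition tS0 := ztok (zi 0 0 0 0) (zi 0 0 1 0) (zi 0 0 1 0) (zi 0 0 0 0) true.
Definition tS1 := ztok (zi 0 1 0 0) (zi 0 0 (-1) 0) (zi 0 0 1 0) (zi 0 1 0 0) true.

Definition ts := ztok (zi 1 0 0 0) (zi 0 0 0 0) (zi (-1) 0 0 0) (zi 1 0 0 0) false.
Definition ts' := ztok (zi 1 0 0 0) (zi 0 0 0 0) (zi 1 0 0 0) (zi 1 0 0 0) false.
Definition tt_ := ztok (zi 0 0 2 0) (zi 2 0 (-1) 0) (zi 0 0 1 0) (zi 1 0 (-1) 0) false.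
Definition tt' := ztok (zi 1 0 (-1) 0) (zi (-2) 0 1 0) (zi 0 0 (-1) 0) (zi 0 0 2 0) false.
Definition tg := ztok (zi (-1) 0 0 1) (zi 1 0 0 (-2)) (zi (-2) 0 0 0) (zi 3 0 0 (-1)) false.
Definition tg' := ztok (zi 3 0 0 (-1)) (zi (-1) 0 0 2) (zi 2 0 0 0) (zi (-1) 0 0 1) false.
Definition th := ztok (zi 0 0 0 2) (zi (-3) 0 0 (-1)) (zi (-3) 0 0 1) (zi 0 0 0 (-3)) false.
Definition th' := ztok (zi 0 0 0 (-3)) (zi 3 0 0 1) (zi 3 0 0 (-1)) (zi 0 0 0 2) false.

Lemma iso_anti (t : zmat) (e : 'cV[R]_4) :
  (forall p q x y, lorentz (zmev R t) *m hv p q x (- y) = rfl e *m hv p q x y) ->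
  iso (t, true) = rfl e.
Proof.
move=> h; apply: (@mulmx_inj4 R) => v; rewrite [v]hv_eta isoE /= -mulmxA refl_hv; exact: h.
Qed.

Lemma iso_tA : iso tA = rfl (hv 0 0 1 0).
Proof.
apply: iso_anti => p q x y; rewrite rfl_hv lorentzE /zmev barmx2 mx2T /herm !mx2M /unherm !mxE /=.
by rewrite /hv; congr vec4; field.
Qed.

Lemma iso_tB : iso tB = rfl (hv (-1) 0 (-1) 0).
Proof.
apply: iso_anti => p q x y; rewrite rfl_hv lorentzE /zmev barmx2 mx2T /herm !mx2M /unherm !mxE /=.
by rewrite /hv; congr vec4; field.
Qed.

Lemma iso_tC : iso tC = rfl (hv (-1) 0 0 (-1)).
Proof.
apply: iso_anti => p q x y; rewrite rfl_hv lorentzE /zmev barmx2 mx2T /herm !mx2M /unherm !mxE /=.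
by rewrite /hv; congr vec4; field.
Qed.

Lemma iso_tS0 : iso tS0 = rfl (sph_root R 0).
Proof.
apply: iso_anti => p q x y; rewrite /sph_root rfl_hv lorentzE /zmev barmx2 mx2T /herm !mx2M /unherm !mxE /=.
by rewrite /hv; congr vec4; field.
Qed.

Lemma iso_tS1 : iso tS1 = rfl (sph_root R 1).
Proof.
have r2r2 := @r2r2 R.
apply: iso_anti => p q x y; rewrite /sph_root rfl_hv lorentzE /zmev barmx2 mx2T /herm !mx2M /unherm !mxE /=.
by rewrite /hv; congr vec4; field: r2r2.
Qed.

Definition limage (S : set 'M[R[i]]_2) : set 'M[R]_4 := [set lorentz A | A in S].

Definition mat_group (H : set 'M[R]_4) :=
  [/\ H 1, forall x y, H x -> H y -> H (x * y) & forall x, H x -> H x^-1].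

Lemma generated_group (S : set 'M[R]_4) : mat_group (generated S).
Proof.
split; [exact: generated_one|exact: generated_mul|exact: generated_inv].
Qed.

Lemma limage_group S : (forall A, S A -> \det A = 1) -> mat_group (limage (generated S)).
Proof.
move=> S1; split.
- by exists 1; [exact: generated_one|exact: lorentz1].
- move=> _ _ [A GA <-] [B GB <-]; exists (A * B); first exact: generated_mul.
  exact: lorentzM.
- move=> _ [A GA <-]; exists A^-1; first exact: generated_inv.
  by apply: lorentzV; exact: generated_det GA.
Qed.

Lemma limage_sub S (H : set 'M[R]_4) : (forall A, S A -> \det A = 1) -> mat_group H ->
  (forall A, S A -> H (lorentz A)) -> limage (generated S) `<=` H.
Proof.
move=> S1 [H1 HM HV] SH _ [A GA <-]; elim: GA => {A} [A /SH//||A B GA hA GB hB|A GA hA].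
- by rewrite -[1]/(1%:M) lorentz1.
- by rewrite -[A * B]/(A *m B) lorentzM; exact: HM.
- by rewrite lorentzV; [exact: HV|exact: generated_det GA].
Qed.

Lemma group_prod (H : set 'M[R]_4) (gl l : seq token) : mat_group H ->
  (forall t, t \in gl -> H (iso t)) -> all (mem gl) l -> H (\prod_(t <- l) iso t).
Proof.
move=> [H1 HM _] Hg; elim: l => [|t l IH] /=; first by rewrite big_nil.
by move=> /andP[tl ll]; rewrite big_cons; apply: HM; [exact: Hg|exact: IH].
Qed.

(** A pair of words serves as a certificate: one in the group generators, one in the reflections,
    with product t up to sign. *)
Lemma inprod_word (H U : set 'M[R]_4) (gl ul lg lu : seq token) t : mat_group H -> mat_group U ->
  (forall t, t \in gl -> H (iso t)) -> (forall t, t \in ul -> U (iso t)) ->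
  [&& all (mem gl) lg, all (mem ul) lu & teq t (tprod (lg ++ lu))] ->
  inprod H U (iso t).
Proof.
move=> Hg Ug hg hu /and3P[h1 h2 /(iso_teq R) ->].
exists (\prod_(t <- lg) iso t), (\prod_(t <- lu) iso t); split.
- exact: group_prod h1.
- exact: group_prod h2.
- by rewrite iso_tprod big_cat.
Qed.

Let ctext (z w : R[i]) : complex.Re z = complex.Re w -> complex.Im z = complex.Im w -> z = w.
Proof. by case: z w => [x y] [x' y'] /= -> ->. Qed.

Lemma zmev_mx : [/\ zmev R ts.1 = mx_s R, zmev R tt_.1 = mx_t R, zmev R tg.1 = mx_g R &
  zmev R th.1 = mx_h R].
Proof.
rewrite /mx_s /mx_t /mx_g /mx_h /isqrt2 -/r2; split; rewrite /zmev /=; congr mx2; apply: ctext => /=; ring.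
Qed.

Lemma iso_hol (t : zmat) : iso (t, false) = lorentz (zmev R t).
Proof. by rewrite isoE /= mulmx1. Qed.

Lemma iso_inv (t t' : token) : teq (tprod [:: t; t']) tone -> teq (tprod [:: t'; t]) tone ->
  iso t' = (iso t)^-1.
Proof.
move=> h1 h2.
have e1 : iso t * iso t' = 1.
  by have := iso_teq R h1; rewrite iso_tprod !big_cons big_nil mulr1 iso_tone.
have e2 : iso t' * iso t = 1.
  by have := iso_teq R h2; rewrite iso_tprod !big_cons big_nil mulr1 iso_tone.
have u : iso t \is a GRing.unit by apply/unitrP; exists (iso t').
by apply: (mulrI u); rewrite divrr.
Qed.

Lemma GammaS_det A : [set mx_s R; mx_t R] A -> \det A = 1.
Proof.
by move=> [->|->]; rewrite det_mx2; apply: ctext => /=; ring.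
Qed.

Lemma GammaT0_det A : [set mx_f R; mx_g R; mx_h R] A -> \det A = 1.
Proof.
have r2r2 := @r2r2 R.
by move=> [[->|->]|->]; rewrite det_mx2 /isqrt2 -/r2; apply: ctext => /=; ring: r2r2.
Qed.

Lemma GamS_group : mat_group (limage (@GammaS R)).
Proof. exact/limage_group/GammaS_det. Qed.

Lemma GamT_group : mat_group (limage (@GammaT0 R)).
Proof. exact/limage_group/GammaT0_det. Qed.

Let GamS_tok t : t \in [:: ts; ts'; tt_; tt'] -> limage (@GammaS R) (iso t).
Proof.
have [_ _ GV] := GamS_group; have [e1 e2 _ _] := zmev_mx.
have hs : limage (@GammaS R) (iso ts).
  by rewrite iso_hol e1; exists (mx_s R) => //; apply: generated_incl; left.
have ht : limage (@GammaS R) (iso tt_).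
  by rewrite iso_hol e2; exists (mx_t R) => //; apply: generated_incl; right.
rewrite !inE => /or4P[] /eqP->; [exact: hs| |exact: ht|].
  by rewrite (@iso_inv ts); [exact: GV hs|vm_compute|vm_compute].
by rewrite (@iso_inv tt_); [exact: GV ht|vm_compute|vm_compute].
Qed.

Let GamT_tok t : t \in [:: ts; ts'; tg; tg'; th; th'] -> limage (@GammaT0 R) (iso t).
Proof.
have [_ _ GV] := GamT_group; have [e1 _ e2 e3] := zmev_mx.
have hs : limage (@GammaT0 R) (iso ts).
  by rewrite iso_hol e1; exists (mx_s R) => //; apply: generated_incl; left; left.
have hg : limage (@GammaT0 R) (iso tg).
  by rewrite iso_hol e2; exists (mx_g R) => //; apply: generated_incl; left; right.
have hh : limage (@GammaT0 R) (iso th).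
  by rewrite iso_hol e3; exists (mx_h R) => //; apply: generated_incl; right.
rewrite !inE => /or4P[/eqP->|/eqP->|/eqP->|/or3P[]/eqP->].
- exact: hs.
- by rewrite (@iso_inv ts); [exact: GV hs|vm_compute|vm_compute].
- exact: hg.
- by rewrite (@iso_inv tg); [exact: GV hg|vm_compute|vm_compute].
- exact: hh.
- by rewrite (@iso_inv th); [exact: GV hh|vm_compute|vm_compute].
Qed.

Definition isoset (l : seq token) : set 'M[R]_4 := [set iso t | t in [set` l]].

Let isoset_tok l t : t \in l -> generated (isoset l) (iso t).
Proof. by move=> tl; apply: generated_incl; exists t. Qed.

Let isoset_in l t : t \in l -> isoset l (iso t).
Proof. by move=> tl; exists t. Qed.

Lemma isoset3 a b c : isoset [:: a; b; c] = [set iso a; iso b; iso c].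
Proof.
apply/seteqP; split=> [_ [t tl <-]|_ /= [[->|->]|->]]; last 3 first.
- by exists a => //=; rewrite inE eqxx.
- by exists b => //=; rewrite !inE eqxx orbT.
- by exists c => //=; rewrite !inE eqxx !orbT.
by move: tl; rewrite /= !inE => /or3P[] /eqP->; [left; left|left; right|right].
Qed.

Let tok_invol t : t \in [:: tA; tB; tC; tS0; tS1] -> iso t * iso t = 1.
Proof.
move=> h; have : teq (tprod [:: t; t]) tone.
  by move: h; rewrite !inE => /or4P[/eqP->|/eqP->|/eqP->|/orP[]/eqP->]; vm_compute.
by move/(iso_teq R); rewrite iso_tprod !big_cons big_nil mulr1 iso_tone.
Qed.

Lemma A3_tok a b c : all (mem [:: tA; tB; tC; tS0; tS1]) [:: a; b; c] ->
  [&& teq (tmul a (tmul b a)) (tmul b (tmul a b)), teq (tmul b (tmul c b)) (tmul c (tmul b c)) &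
      teq (tmul a c) (tmul c a)] -> A3 (iso a) (iso b) (iso c).
Proof.
move=> /and4P[ha hb hc _] /and3P[h1 h2 h3].
by split; rewrite ?tok_invol//; split; rewrite -!isoM; exact: iso_teq.
Qed.

Let tokT t ul lg lu : [&& all (mem [:: ts; ts'; tg; tg'; th; th']) lg, all (mem ul) lu &
  teq t (tprod (lg ++ lu))] ->
  inprod (limage (@GammaT0 R)) (generated (isoset ul)) (iso t).
Proof.
apply: inprod_word; [exact: GamT_group|exact: generated_group|exact: GamT_tok|].
exact: isoset_tok.
Qed.

Let tokS t ul lg lu : [&& all (mem [:: ts; ts'; tt_; tt']) lg, all (mem ul) lu &
  teq t (tprod (lg ++ lu))] ->
  inprod (limage (@GammaS R)) (generated (isoset ul)) (iso t).
Proof.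
apply: inprod_word; [exact: GamS_group|exact: generated_group|exact: GamS_tok|].
exact: isoset_tok.
Qed.

Let commA t : teq (tmul tA t) (tmul t tA) -> iso tA * iso t = iso t * iso tA.
Proof. by move/(iso_teq R); rewrite !isoM. Qed.

Let set4 a b c d : iso a |` [set iso b; iso c; iso d] = isoset [:: a; b; c; d].
Proof.
apply/seteqP; split=> [_ [->|[[->|->]|->]]|_ [t tl <-]].
- by exists a => //; rewrite /= ?inE ?eqxx ?orbT.
- by exists b => //; rewrite /= ?inE ?eqxx ?orbT.
- by exists c => //; rewrite /= ?inE ?eqxx ?orbT.
- by exists d => //; rewrite /= ?inE ?eqxx ?orbT.
by move: tl; rewrite /= !inE => /or4P[] /eqP->; [left|right; left; left|right; left; right|right; right].
Qed.

Let invA : iso tA * iso tA = 1.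
Proof. exact: tok_invol. Qed.

Let crossing_tok H ul x y z : A3 (iso x) (iso y) (iso z) -> x \in ul -> y \in ul ->
  inprod H (generated (isoset ul)) (iso tone) -> inprod H (generated (isoset ul)) (iso z) ->
  inprod H (generated (isoset ul)) (iso (tmul y z)) ->
  inprod H (generated (isoset ul)) (iso (tmul x (tmul y z))) ->
  forall d, generated (isoset [:: x; y; z]) d -> inprod H (generated (isoset ul)) d.
Proof.
rewrite isoset3 !isoM iso_tone => a3 xu yu h1 h2 h3 h4.
apply: (crossing a3 (isoset_in xu) (isoset_in yu)) => e.
by rewrite !inE => /or4P[] /eqP->.
Qed.

Let level_end_tok H x y z : mat_group H -> A3 (iso x) (iso y) (iso z) ->
  teq (tmul tA x) (tmul x tA) -> teq (tmul tA y) (tmul y tA) ->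
  let U := generated (isoset [:: x; y; z]) in
  inprod H U (iso tA) -> inprod H U (iso (tmul z tA)) ->
  inprod H U (iso (tmul (tmul y z) tA)) -> inprod H U (iso (tmul (tmul x (tmul y z)) tA)) ->
  forall m, generated (isoset [:: tA; x; y; z]) m -> inprod H U m.
Proof.
move=> [H1 HM _] a3 /commA ax /commA ay; rewrite /= isoset3 -set4 !isoM => h1 h2 h3 h4.
apply: (level_end a3 invA ax ay H1 HM) => e.
by rewrite !inE => /or4P[] /eqP->; rewrite ?mul1r.
Qed.

Let level_mid_tok H x y z : mat_group H -> A3 (iso x) (iso y) (iso z) ->
  teq (tmul tA x) (tmul x tA) -> teq (tmul tA z) (tmul z tA) ->
  let U := generated (isoset [:: x; y; z]) in
  inprod H U (iso tA) -> inprod H U (iso (tmul y tA)) ->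
  inprod H U (iso (tmul (tmul x y) tA)) -> inprod H U (iso (tmul (tmul z y) tA)) ->
  inprod H U (iso (tmul (tmul x (tmul z y)) tA)) ->
  inprod H U (iso (tmul (tmul y (tmul x (tmul z y))) tA)) ->
  forall m, generated (isoset [:: tA; x; y; z]) m -> inprod H U m.
Proof.
move=> [H1 HM _] a3 /commA ax /commA az; rewrite /= isoset3 -set4 !isoM => h1 h2 h3 h4 h5 h6.
apply: (level_mid a3 invA ax az H1 HM) => e.
by rewrite !inE => /or4P[/eqP->|/eqP->|/eqP->|/or3P[] /eqP->]; rewrite ?mul1r.
Qed.

(* The words in the generators come from a computer search. *)
Lemma levelT_D m : generated (isoset [:: tA; tS0; tB; tS1]) m ->
  inprod (limage (@GammaT0 R)) (generated (isoset [:: tS0; tB; tS1])) m.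
Proof.
apply: (level_mid_tok GamT_group); [by apply: A3_tok; vm_compute|by vm_compute|by vm_compute|..].
- by apply: (tokT (ul := [:: tS0; tB; tS1]) (lg := [:: ts]) (lu := [:: tB; tS0; tB])); vm_compute.
- by apply: (tokT (ul := [:: tS0; tB; tS1]) (lg := [:: tg']) (lu := [:: tB; tS0; tB; tS1; tB; tS0])); vm_compute.
- by apply: (tokT (ul := [:: tS0; tB; tS1]) (lg := [:: ts']) (lu := [:: tS0])); vm_compute.
- by apply: (tokT (ul := [:: tS0; tB; tS1]) (lg := [:: th']) (lu := [:: tS0; tB; tS1; tB; tS0])); vm_compute.
- by apply: (tokT (ul := [:: tS0; tB; tS1]) (lg := [:: th]) (lu := [:: tB; tS1; tB; tS0])); vm_compute.
- by apply: (tokT (ul := [:: tS0; tB; tS1]) (lg := [:: tg]) (lu := [:: tB; tS0; tS1])); vm_compute.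
Qed.

(** For the octahedron, [tA] commutes with the end subgroup of [tC] and [tS0], leaving four words.
    For the cuboctahedron it commutes with [tS0] and [tS1], the ends of the A3 diagram, whence
    six. *)
Lemma levelS_D m : generated (isoset [:: tA; tC; tS0; tB]) m ->
  inprod (limage (@GammaS R)) (generated (isoset [:: tC; tS0; tB])) m.
Proof.
apply: (level_end_tok GamS_group); [by apply: A3_tok; vm_compute|by vm_compute|by vm_compute|..].
- by apply: (tokS (ul := [:: tC; tS0; tB]) (lg := [:: ts]) (lu := [:: tB; tS0; tB])); vm_compute.
- by apply: (tokS (ul := [:: tC; tS0; tB]) (lg := [:: tt_]) (lu := [:: tB; tC; tS0; tB])); vm_compute.
- by apply: (tokS (ul := [:: tC; tS0; tB]) (lg := [:: ts']) (lu := [:: tS0])); vm_compute.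
- by apply: (tokS (ul := [:: tC; tS0; tB]) (lg := [:: tt']) (lu := [:: tB; tS0])); vm_compute.
Qed.

(** The target is generated by reflections orthogonal to the plane Im = - sqrt 2: they form the (2,
    3, infinity) triangle group of the lower boundary plane of the tile. In [levelT_U0] and
    [levelS_U] the plane is Im = 0. *)
Lemma levelT_U1 d : generated (isoset [:: tS1; tB; tS0]) d ->
  inprod (limage (@GammaT0 R)) (generated (isoset [:: tA; tB; tS1])) d.
Proof.
apply: crossing_tok; [by apply: A3_tok; vm_compute|by vm_compute|by vm_compute|..].
- by apply: (tokT (ul := [:: tA; tB; tS1]) (lg := [:: ]) (lu := [:: ])); vm_compute.
- by apply: (tokT (ul := [:: tA; tB; tS1]) (lg := [:: th; tg]) (lu := [:: tB; tA; tS1; tB; tA; tB; tS1])); vm_compute.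
- by apply: (tokT (ul := [:: tA; tB; tS1]) (lg := [:: ts']) (lu := [:: tA; tB])); vm_compute.
- by apply: (tokT (ul := [:: tA; tB; tS1]) (lg := [:: tg]) (lu := [:: tB; tA; tB; tS1; tB])); vm_compute.
Qed.

Lemma levelT_U0 d : generated (isoset [:: tS0; tB; tS1]) d ->
  inprod (limage (@GammaT0 R)) (generated (isoset [:: tA; tB; tS0])) d.
Proof.
apply: crossing_tok; [by apply: A3_tok; vm_compute|by vm_compute|by vm_compute|..].
- by apply: (tokT (ul := [:: tA; tB; tS0]) (lg := [:: ]) (lu := [:: ])); vm_compute.
- by apply: (tokT (ul := [:: tA; tB; tS0]) (lg := [:: ts; tg]) (lu := [:: tB; tA; tS0; tB; tA])); vm_compute.
- by apply: (tokT (ul := [:: tA; tB; tS0]) (lg := [:: th'; th'; tg]) (lu := [:: tB; tA; tB; tA; tS0; tB; tA; tB])); vm_compute.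
- by apply: (tokT (ul := [:: tA; tB; tS0]) (lg := [:: tg]) (lu := [:: tB; tA; tB; tS0; tB])); vm_compute.
Qed.

Lemma levelS_U d : generated (isoset [:: tB; tS0; tC]) d ->
  inprod (limage (@GammaS R)) (generated (isoset [:: tA; tB; tS0])) d.
Proof.
apply: crossing_tok; [by apply: A3_tok; vm_compute|by vm_compute|by vm_compute|..].
- by apply: (tokS (ul := [:: tA; tB; tS0]) (lg := [:: ]) (lu := [:: ])); vm_compute.
- by apply: (tokS (ul := [:: tA; tB; tS0]) (lg := [:: tt']) (lu := [:: tB; tA; tB; tS0; tB])); vm_compute.
- by apply: (tokS (ul := [:: tA; tB; tS0]) (lg := [:: tt'; ts'; tt']) (lu := [:: tB; tA; tB; tS0; tB; tA; tB; tA; tB; tS0])); vm_compute.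
- by apply: (tokS (ul := [:: tA; tB; tS0]) (lg := [:: ts'; tt']) (lu := [:: tB; tA; tB; tS0; tB; tA; tB])); vm_compute.
Qed.

Lemma GamT_gen : limage (@GammaT0 R) `<=` generated (isoset [:: tA; tS0; tB; tS1]).
Proof.
have [_ _ e2 e3] := zmev_mx; have [e1 _ _ _] := zmev_mx.
have word t l : all (mem [:: tA; tS0; tB; tS1]) l -> teq t (tprod l) ->
    generated (isoset [:: tA; tS0; tB; tS1]) (iso t).
  move=> ll /(iso_teq R) ->; rewrite iso_tprod.
  apply: group_prod ll; [exact: generated_group|exact: isoset_tok].
apply: limage_sub; [exact: GammaT0_det|exact: generated_group|].
move=> _ [[->|->]|->].
- by rewrite -[mx_f R]e1 -iso_hol; apply: (word _ [:: tA; tB; tS0; tB]); vm_compute.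
- by rewrite -e2 -iso_hol; apply: (word _ [:: tB; tS0; tB; tS1; tB; tA; tS0; tB]); vm_compute.
- by rewrite -e3 -iso_hol; apply: (word _ [:: tS0; tB; tS1; tB; tA; tS0; tB; tS1]); vm_compute.
Qed.

Lemma GamS_gen : limage (@GammaS R) `<=` generated (isoset [:: tA; tB; tC; tS0]).
Proof.
have [e1 e2 _ _] := zmev_mx.
have word t l : all (mem [:: tA; tB; tC; tS0]) l -> teq t (tprod l) ->
    generated (isoset [:: tA; tB; tC; tS0]) (iso t).
  move=> ll /(iso_teq R) ->; rewrite iso_tprod.
  apply: group_prod ll; [exact: generated_group|exact: isoset_tok].
apply: limage_sub; [exact: GammaS_det|exact: generated_group|].
move=> _ [->|->].
- by rewrite -e1 -iso_hol; apply: (word _ [:: tA; tB; tS0; tB]); vm_compute.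
- by rewrite -e2 -iso_hol; apply: (word _ [:: tB; tA; tB; tS0; tB; tC]); vm_compute.
Qed.

End BaseGroups.

(** * The coset decomposition *)

Section Levels.
Variables (R : realType) (n : nat).
Local Notation r2 := (@r2 R).
Local Notation root := (@mirror_root R n).
Local Notation PG := (PGamma R n).
Implicit Types (Th : 'M[R]_4) (es : seq 'cV[R]_4).

Definition rfls es : set 'M[R]_4 := [set rfl e | e in [set` es]].

Local Notation eA := (hv 0 0 1 0 : 'cV[R]_4).
Local Notation eB := (hv (-1) 0 (-1) 0 : 'cV[R]_4).
Local Notation eC := (hv (-1) 0 0 (-1) : 'cV[R]_4).
Local Notation eS := (@sph_root R).

Lemma rfls_sub es es' : {subset es <= es'} -> generated (rfls es) `<=` generated (rfls es').
Proof. by move=> h; apply: generated_sub => _ [e ee <-]; apply: generated_incl; exists e => //; exact: h. Qed.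

Lemma conj_rfl Th e : isom3 Th -> Th * rfl e * Th^-1 = rfl (Th *m e).
Proof.
by move=> iT; rewrite isom_rfl// mulrK//; exact: isom3_unit.
Qed.

Lemma conj_generated Th es x : isom3 Th -> generated (rfls es) x ->
  generated (rfls [seq Th *m e | e <- es]) (Th * x * Th^-1).
Proof.
move=> iT; have Tu := isom3_unit iT; elim=> {x} [_ [e ee <-]||x y _ hx _ hy|x _ hx].
- rewrite conj_rfl//; apply: generated_incl; exists (Th *m e) => //.
  by apply: (map_f (fun e => Th *m e)).
- by rewrite mulr1 divrr//; exact: generated_one.
- rewrite (_ : Th * (x * y) * Th^-1 = (Th * x * Th^-1) * (Th * y * Th^-1)).
    exact: generated_mul.
  by rewrite !mulrA mulrVK.
- have [xu|xu] := boolP (x \is a GRing.unit).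
    rewrite (_ : Th * x^-1 * Th^-1 = (Th * x * Th^-1)^-1); first exact: generated_inv.
    by rewrite !invrM ?unitrMl ?unitrV// invrK mulrA.
  by rewrite invr_out.
Qed.

Lemma conj_inprod Th L es x : isom3 Th -> inprod L (generated (rfls es)) x ->
  inprod (conj_by Th L) (generated (rfls [seq Th *m e | e <- es])) (Th * x * Th^-1).
Proof.
move=> iT [a [b [La Gb ->]]]; exists (Th * a * Th^-1), (Th * b * Th^-1); split.
- by exists a.
- exact: conj_generated.
- by rewrite !mulrA mulrVK//; exact: isom3_unit.
Qed.

(** Conjugation by Th carries the rewriting of a base group to the level at which Th places it. *)
Lemma transfer Th L es es' : isom3 Th -> conj_by Th L `<=` PG ->
  (forall m, generated (rfls es) m -> inprod L (generated (rfls es')) m) ->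
  forall m, generated (rfls [seq Th *m e | e <- es]) m ->
    inprod PG (generated (rfls [seq Th *m e | e <- es'])) m.
Proof.
move=> iT TL h m Gm; have iV := isom3V iT; have Tu := isom3_unit iT.
have mE : m = Th * (Th^-1 * m * Th) * Th^-1 by rewrite !mulrA divrr// mul1r mulrK.
have : generated (rfls es) (Th^-1 * m * Th).
  have := conj_generated iV Gm; rewrite invrK -map_comp (eq_map (g := idfun)) ?map_id//.
  by move=> e /=; rewrite isom3_mulVK.
move=> /h/(conj_inprod iT)[a [b [La Gb e]]].
by exists a, b; split; [exact: TL|exact: Gb|rewrite mE e].
Qed.

Let rflsE (l : seq token) es : [seq iso R t | t <- l] = [seq rfl e | e <- es] -> isoset l = rfls es.
Proof.
move=> h; apply/seteqP; split=> [_ [t tl <-]|_ [e ee <-]].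
  have : iso R t \in [seq rfl e | e <- es] by rewrite -h map_f.
  by move=> /mapP[e ee ->]; exists e.
have : rfl e \in [seq iso R t | t <- l] by rewrite h map_f.
by move=> /mapP[t tl ->]; exists t.
Qed.

Let tokE := (iso_tA, iso_tB, iso_tC, iso_tS0, iso_tS1).

Section LevelT.
Variable Th : 'M[R]_4.
Hypotheses (iT : isom3 Th) (TA : Th *m eA = eA) (TB : Th *m eB = eB)
  (TG : conj_by Th (limage (@GammaT0 R)) `<=` PG).
Local Notation a := (Th *m eS 0).
Local Notation b := (Th *m eS 1).

Lemma levelT_D_at m : generated (rfls [:: eA; a; eB; b]) m ->
  inprod PG (generated (rfls [:: a; eB; b])) m.
Proof.
have h m' : generated (rfls [:: eA; eS 0; eB; eS 1]) m' ->
    inprod (limage (@GammaT0 R)) (generated (rfls [:: eS 0; eB; eS 1])) m'.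
  have := @levelT_D R m'.
  rewrite (@rflsE [:: tA; tS0; tB; tS1] [:: eA; eS 0; eB; eS 1]); last by rewrite [LHS]/= !tokE.
  by rewrite (@rflsE [:: tS0; tB; tS1] [:: eS 0; eB; eS 1]); last by rewrite [LHS]/= !tokE.
by have := @transfer Th _ _ _ iT TG h m; rewrite /= TA TB.
Qed.

Lemma levelT_U0_at m : generated (rfls [:: a; eB; b]) m ->
  inprod PG (generated (rfls [:: eA; eB; a])) m.
Proof.
have h m' : generated (rfls [:: eS 0; eB; eS 1]) m' ->
    inprod (limage (@GammaT0 R)) (generated (rfls [:: eA; eB; eS 0])) m'.
  have := @levelT_U0 R m'.
  rewrite (@rflsE [:: tA; tB; tS0] [:: eA; eB; eS 0]); last by rewrite [LHS]/= !tokE.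
  by rewrite (@rflsE [:: tS0; tB; tS1] [:: eS 0; eB; eS 1]); last by rewrite [LHS]/= !tokE.
by have := @transfer Th _ _ _ iT TG h m; rewrite /= TA TB.
Qed.

Lemma levelT_U1_at m : generated (rfls [:: b; eB; a]) m ->
  inprod PG (generated (rfls [:: eA; eB; b])) m.
Proof.
have h m' : generated (rfls [:: eS 1; eB; eS 0]) m' ->
    inprod (limage (@GammaT0 R)) (generated (rfls [:: eA; eB; eS 1])) m'.
  have := @levelT_U1 R m'.
  rewrite (@rflsE [:: tA; tB; tS1] [:: eA; eB; eS 1]); last by rewrite [LHS]/= !tokE.
  by rewrite (@rflsE [:: tS1; tB; tS0] [:: eS 1; eB; eS 0]); last by rewrite [LHS]/= !tokE.
by have := @transfer Th _ _ _ iT TG h m; rewrite /= TA TB.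
Qed.

End LevelT.

Lemma GamT_gen_at Th : isom3 Th -> Th *m eA = eA -> Th *m eB = eB ->
  conj_by Th (limage (@GammaT0 R)) `<=` generated (rfls [:: eA; Th *m eS 0; eB; Th *m eS 1]).
Proof.
move=> iT TA TB _ [x /GamT_gen Gx <-].
rewrite (@rflsE [:: tA; tS0; tB; tS1] [:: eA; eS 0; eB; eS 1]) in Gx; last by rewrite [LHS]/= !tokE.
by have := conj_generated iT Gx; rewrite /= TA TB.
Qed.

Section LevelS.
Variable Th : 'M[R]_4.
Hypotheses (iT : isom3 Th) (TA : Th *m eA = eA) (TB : Th *m eB = eB)
  (TG : conj_by Th (limage (@GammaS R)) `<=` PG).
Local Notation a := (Th *m eS 0).
Local Notation c := (Th *m eC).

Lemma levelS_D_at m : generated (rfls [:: eA; c; a; eB]) m ->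
  inprod PG (generated (rfls [:: c; a; eB])) m.
Proof.
have h m' : generated (rfls [:: eA; eC; eS 0; eB]) m' ->
    inprod (limage (@GammaS R)) (generated (rfls [:: eC; eS 0; eB])) m'.
  have := @levelS_D R m'.
  rewrite (@rflsE [:: tA; tC; tS0; tB] [:: eA; eC; eS 0; eB]); last by rewrite [LHS]/= !tokE.
  by rewrite (@rflsE [:: tC; tS0; tB] [:: eC; eS 0; eB]); last by rewrite [LHS]/= !tokE.
by have := @transfer Th _ _ _ iT TG h m; rewrite /= TA TB.
Qed.

Lemma levelS_U_at m : generated (rfls [:: eB; a; c]) m ->
  inprod PG (generated (rfls [:: eA; eB; a])) m.
Proof.
have h m' : generated (rfls [:: eB; eS 0; eC]) m' ->
    inprod (limage (@GammaS R)) (generated (rfls [:: eA; eB; eS 0])) m'.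
  have := @levelS_U R m'.
  rewrite (@rflsE [:: tA; tB; tS0] [:: eA; eB; eS 0]); last by rewrite [LHS]/= !tokE.
  by rewrite (@rflsE [:: tB; tS0; tC] [:: eB; eS 0; eC]); last by rewrite [LHS]/= !tokE.
by have := @transfer Th _ _ _ iT TG h m; rewrite /= TA TB.
Qed.

End LevelS.

Lemma GamS_gen_at Th : isom3 Th -> Th *m eA = eA -> Th *m eB = eB ->
  conj_by Th (limage (@GammaS R)) `<=` generated (rfls [:: eA; eB; Th *m eC; Th *m eS 0]).
Proof.
move=> iT TA TB _ [x /GamS_gen Gx <-].
rewrite (@rflsE [:: tA; tB; tC; tS0] [:: eA; eB; eC; eS 0]) in Gx; last by rewrite [LHS]/= !tokE.
by have := conj_generated iT Gx; rewrite /= TA TB.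
Qed.

Definition vdown (m : nat) : 'M[R]_4 := vshift (- (m%:R * r2)).
Definition vflip (m : nat) : 'M[R]_4 := vdown m * refl R.

Lemma vdownE m : vdown m = lorentz (mx_c R ^- m).
Proof. by rewrite mx_cVX. Qed.

Lemma mx_c_det m : \det (mx_c R ^- m) = 1.
Proof. by rewrite mx_cVX vshift_det. Qed.

Lemma vdown_isom3 m : isom3 (vdown m).
Proof. exact: vshift_isom3. Qed.

Lemma vflip_isom3 m : isom3 (vflip m).
Proof. by apply: isom3M; [exact: vshift_isom3|exact: refl_isom3]. Qed.

Lemma vdown_A m : vdown m *m eA = eA.
Proof. by rewrite /vdown vshift_hv; congr hv; ring. Qed.

Lemma vdown_B m : vdown m *m eB = eB.
Proof. by rewrite /vdown vshift_hv; congr hv; ring. Qed.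

Lemma vflip_A m : vflip m *m eA = eA.
Proof. by rewrite /vflip -mulmxA refl_hv oppr0 vdown_A. Qed.

Lemma vflip_B m : vflip m *m eB = eB.
Proof. by rewrite /vflip -mulmxA refl_hv oppr0 vdown_B. Qed.

Lemma vdown_S m j : vdown m *m eS j = eS (j + m).
Proof.
have r2r2 := @r2r2 R.
by rewrite /vdown /sph_root vshift_hv natrD; congr hv; ring: r2r2.
Qed.

Lemma vflip_S m j : (j <= m)%N -> vflip m *m eS j = eS (m - j).
Proof.
move=> jm; have r2r2 := @r2r2 R.
by rewrite /vflip -mulmxA /sph_root refl_hv /vdown vshift_hv natrB//; congr hv; ring: r2r2.
Qed.

Lemma vflip_C : vflip (2 * n) *m eC = root (MBot n).
Proof.
by rewrite /vflip -mulmxA refl_hv /vdown vshift_hv /= natrM; congr hv; ring.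
Qed.

Lemma conj_lorentz (A B : 'M[R[i]]_2) : \det A = 1 ->
  lorentz A * lorentz B * (lorentz A)^-1 = lorentz (A * B * A^-1).
Proof.
move=> dA; rewrite -lorentzV// -[A * B * A^-1]/((A *m B) *m A^-1) !lorentzM.
by [].
Qed.

(** Conjugation by [refl] conjugates matrix entries, so the barred groups are conjugates of the
    original ones by [vflip]. *)
Lemma conj_vflip m (A : 'M[R[i]]_2) :
  vflip m * lorentz A * (vflip m)^-1 = lorentz (mx_c R ^- m * barmx A * (mx_c R ^- m)^-1).
Proof.
have rr : refl R * refl R = 1 by exact: reflK.
have ru : refl R \is a GRing.unit by apply/unitrP; exists (refl R).
have rV : (refl R)^-1 = refl R by apply: (mulrI ru); rewrite divrr.
have du := isom3_unit (vdown_isom3 m).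
rewrite /vflip invrM// rV -conj_lorentz ?mx_c_det// -vdownE.
have : refl R * lorentz A = lorentz (barmx A) * refl R by exact: refl_lorentz.
move: (lorentz A) (lorentz (barmx A)) (refl R) (vdown m) rr => a b r d rr e.
by rewrite -(mulrA d) e !mulrA -(mulrA (d * b)) rr mulr1.
Qed.

Lemma odd_level i : (i < n)%N -> conj_by (vdown (2 * i)) (limage (@GammaT0 R)) `<=` PG.
Proof.
move=> iN _ [_ [A GA <-] <-]; rewrite vdownE conj_lorentz ?mx_c_det//.
eexists; last by [].
apply: generated_incl; left; right; exists i.+1; first by [].
by rewrite /GammaTi subn1 /=; exists A => //; apply: generated_incl; left.
Qed.

(** The second half of the (i+1)-st copy of Gamma_T: the inner conjugation by c^(-2) adds 2 to the
    shift 2 i. *)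
Lemma even_level i : (i < n)%N -> conj_by (vflip (2 * i + 2)) (limage (@GammaT0 R)) `<=` PG.
Proof.
move=> iN _ [_ [A GA <-] <-]; rewrite conj_vflip; eexists; last by [].
apply: generated_incl; left; right; exists i.+1; first by [].
rewrite /GammaTi subn1 /=; exists (mx_c R ^- 2 * barmx A * (mx_c R ^- 2)^-1).
  by apply: generated_incl; right; exists (barmx A) => //; exists A.
have e : mx_c R ^- (2 * i + 2) = mx_c R ^- (2 * i) * mx_c R ^- 2.
  by rewrite !mx_cVX -[RHS]/(_ *m _) -[RHS]/(_ * _) vshift_mxM natrD; congr vshift_mx; ring.
have u k : mx_c R ^- k \is a GRing.unit.
  by change (mx_c R ^- k \in unitmx); rewrite unitmxE mx_c_det unitr1.
by rewrite e (invrM (u _) (u _)) !mulrA.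
Qed.

Lemma last_level : conj_by (vflip (2 * n)) (limage (@GammaS R)) `<=` PG.
Proof.
move=> _ [_ [A GA <-] <-]; rewrite conj_vflip; eexists; last by [].
by apply: generated_incl; right; exists (barmx A) => //; exists A.
Qed.

Lemma first_level : conj_by 1 (limage (@GammaS R)) `<=` PG.
Proof.
move=> _ [_ [A GA <-] <-]; exists A; first by apply: generated_incl; left; left.
by rewrite invr1 mul1r mulr1.
Qed.

End Levels.

(** * Passing from tile to tile *)

Section CosetDecomposition.
Variables (R : realType) (n : nat).
Local Notation root := (@mirror_root R n).
Local Notation W := (wgrp root).
Local Notation PG := (PGamma R n).
Local Notation eA := (hv 0 0 1 0 : 'cV[R]_4).
Local Notation eB := (hv (-1) 0 (-1) 0 : 'cV[R]_4).
Local Notation eC := (hv (-1) 0 0 (-1) : 'cV[R]_4).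
Local Notation eS := (@sph_root R).
Local Notation vdown := (@vdown R).
Local Notation vflip := (@vflip R).
Local Notation nrm := (@tile_normal R n).

Definition wall_lo k : 'cV[R]_4 := if k == 0%N then eC else eS k.-1.
Definition wall_hi k : 'cV[R]_4 := if (k <= 2 * n)%N then eS k else root (MBot n).

(* Mirrors of the symmetries of tile k. *)
Definition tile_walls k : seq 'cV[R]_4 := [:: eB; wall_lo k; wall_hi k].

Local Notation D k := (generated (rfls (tile_walls k))).
Local Notation U k := (generated (rfls [:: eA; eB; eS k])).

Lemma inprod_mono (L V V' : set 'M[R]_4) x : V `<=` V' -> inprod L V x -> inprod L V' x.
Proof. by move=> VV [a [b [La Vb e]]]; exists a, b; split=> //; exact: VV. Qed.

Let sub_tac (es es' : seq 'cV[R]_4) : all (mem es') es -> {subset es <= es'}.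
Proof. by move=> /allP. Qed.

(** The two halves of the (i+1)-st copy of Gamma_T act at tiles 2 i + 1 and 2 i + 2, and the two
    copies of Gamma_S at the end tiles. *)
Lemma level_cases k : (k < (2 * n).+2)%N ->
  [\/ k = 0%N, exists2 i, (i < n)%N & k = (2 * i).+1, exists2 i, (i < n)%N & k = (2 * i).+2 |
      k = (2 * n).+1].
Proof.
case: k => [|k] kn; first by constructor 1.
have [kE|kE] := eqVneq k (2 * n)%N; first by constructor 4; rewrite kE.
have [ok|ok] := boolP (odd k).
  by constructor 3; exists (k %/ 2)%N; lia.
by constructor 2; exists (k %/ 2)%N; lia.
Qed.

(** The last two facts lead from tile k to the planes bounding it above and below. The first leads
    back, since the group of either plane is generated by [eA] and walls of the tile. *)
Definition level_facts k :=
  [/\ forall m, generated (rfls (eA :: tile_walls k)) m -> inprod PG (D k) m,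
      k != 0%N -> forall d, D k d -> inprod PG (U k.-1) d &
      (k <= 2 * n)%N -> forall d, D k d -> inprod PG (U k) d].

(** A translation keeps the order of the two hemispheres and a flip exchanges them, hence the two
    alternatives for a and b. *)
Let level_facts_T (Th : 'M[R]_4) k a b : isom3 Th -> Th *m eA = eA -> Th *m eB = eB ->
  conj_by Th (limage (@GammaT0 R)) `<=` PG -> k != 0%N -> (k <= 2 * n)%N ->
  Th *m eS 0 = a -> Th *m eS 1 = b ->
  (a = eS k.-1 /\ b = eS k) \/ (a = eS k /\ b = eS k.-1) ->
  level_facts k.
Proof.
move=> iT TA TB TG k0 kn Ta Tb ab.
have h1 := levelT_D_at iT TA TB TG; have h2 := levelT_U0_at iT TA TB TG.
have h3 := levelT_U1_at iT TA TB TG; rewrite Ta Tb in h1 h2 h3.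
have DE : tile_walls k = [:: eB; eS k.-1; eS k].
  by rewrite /tile_walls /wall_lo /wall_hi (negbTE k0) kn.
rewrite /level_facts DE.
split.
- move=> m Gm; apply: (inprod_mono (V := generated (rfls [:: a; eB; b]))).
    by apply/rfls_sub/sub_tac; case: ab => -[-> ->]; rewrite /= !inE !eqxx ?orbT.
  by apply: h1; move: Gm; apply/rfls_sub/sub_tac; case: ab => -[-> ->]; rewrite /= !inE !eqxx ?orbT.
- move=> _ d Gd; case: ab => -[aE bE]; rewrite aE bE in h2 h3.
    by apply: h2; move: Gd; apply/rfls_sub/sub_tac; rewrite /= !inE !eqxx ?orbT.
  by apply: h3; move: Gd; apply/rfls_sub/sub_tac; rewrite /= !inE !eqxx ?orbT.
- move=> _ d Gd; case: ab => -[aE bE]; rewrite aE bE in h2 h3.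
    by apply: h3; move: Gd; apply/rfls_sub/sub_tac; rewrite /= !inE !eqxx ?orbT.
  by apply: h2; move: Gd; apply/rfls_sub/sub_tac; rewrite /= !inE !eqxx ?orbT.
Qed.

Let level_facts_first : level_facts 0.
Proof.
have i1 := @isom3_1 R.
have h1 := levelS_D_at i1 (mul1mx _) (mul1mx _) (@first_level R n).
have h2 := levelS_U_at i1 (mul1mx _) (mul1mx _) (@first_level R n).
rewrite !mul1mx in h1 h2.
rewrite /level_facts /tile_walls /wall_lo /wall_hi /=; split=> //.
- move=> m Gm; apply: (inprod_mono (V := generated (rfls [:: eC; eS 0; eB]))).
    by apply/rfls_sub/sub_tac; rewrite /= !inE !eqxx ?orbT.
  by apply: h1; move: Gm; apply/rfls_sub/sub_tac; rewrite /= !inE !eqxx ?orbT.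
- move=> _ d Gd; apply: h2; move: Gd.
  by apply/rfls_sub/sub_tac; rewrite /= !inE !eqxx ?orbT.
Qed.

Let level_facts_last : level_facts (2 * n).+1.
Proof.
have iT := @vflip_isom3 R (2 * n).
have h1 := levelS_D_at iT (@vflip_A R _) (@vflip_B R _) (@last_level R n).
have h2 := levelS_U_at iT (@vflip_A R _) (@vflip_B R _) (@last_level R n).
rewrite vflip_C vflip_S// subn0 in h1 h2.
rewrite /level_facts /tile_walls /wall_lo /wall_hi ltnn [_ == _]/= [_.-1]/=; split; [|by move=> _; exact: h2|by []].
move=> m Gm; apply: (inprod_mono (V := generated (rfls [:: root (MBot n); eS (2 * n); eB]))).
  by apply/rfls_sub/sub_tac; rewrite /= !inE !eqxx ?orbT.
by apply: h1; move: Gm; apply/rfls_sub/sub_tac; rewrite /= !inE !eqxx ?orbT.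
Qed.

Lemma level_factsP k : (k < (2 * n).+2)%N -> level_facts k.
Proof.
case/level_cases => [->|[i iN ->]|[i iN ->]|->].
- exact: level_facts_first.
- apply: (level_facts_T (vdown_isom3 R _) (@vdown_A R _) (@vdown_B R _) (odd_level iN)) => //.
  + by lia.
  + by left; rewrite !vdown_S add0n add1n.
- have := even_level (R := R) iN; rewrite addn2 => el.
  apply: (level_facts_T (vflip_isom3 R _) (@vflip_A R _) (@vflip_B R _) el) => //.
  + by lia.
  + by right; rewrite !vflip_S// subn0 subn1.
- exact: level_facts_last.
Qed.

Lemma PG_group : mat_group PG.
Proof.
apply: limage_group => A SA; apply: (@Gamma_det R n); exact: generated_incl.
Qed.

Let PGM x y : PG x -> PG y -> PG (x * y). Proof. by have [_ h _] := PG_group; exact: h. Qed.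

Let inprod_PG (V V' : set 'M[R]_4) x : inprod PG V x -> (forall d, V d -> inprod PG V' d) ->
  inprod PG V' x.
Proof.
move=> [a [b [Ga Vb ->]]] h; have [a' [b' [Ga' Vb' ->]]] := h _ Vb.
by exists (a * a'), b'; split; [exact: PGM|exact: Vb'|rewrite mulrA].
Qed.

Let step_up k x : (k <= 2 * n)%N -> inprod PG (D k) x -> inprod PG (D k.+1) x.
Proof.
move=> kn h; have [_ _ h3] : level_facts k by apply: level_factsP; lia.
have [h1 _ _] : level_facts k.+1 by apply: level_factsP; lia.
apply: inprod_PG (inprod_PG h (h3 kn)) _ => d Ud; apply: h1; move: Ud.
apply/rfls_sub/sub_tac; rewrite /= /wall_lo /= !inE !eqxx ?orbT //.
Qed.

Let step_down k x : (k <= 2 * n)%N -> inprod PG (D k.+1) x -> inprod PG (D k) x.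
Proof.
move=> kn h; have [h1 _ _] : level_facts k by apply: level_factsP; lia.
have [_ h2 _] : level_facts k.+1 by apply: level_factsP; lia.
apply: inprod_PG (inprod_PG h (h2 isT)) _ => d Ud; apply: h1; move: Ud.
apply/rfls_sub/sub_tac; rewrite /tile_walls /wall_hi kn /= !inE !eqxx ?orbT //.
Qed.

Let from0 k x : (k < (2 * n).+2)%N -> inprod PG (D 0) x -> inprod PG (D k) x.
Proof.
elim: k => // k IH kn h; apply: step_up; first by lia.
by apply: IH => //; lia.
Qed.

Let to0 k x : (k < (2 * n).+2)%N -> inprod PG (D k) x -> inprod PG (D 0) x.
Proof.
elim: k => // k IH kn h; apply: IH; first by lia.
by apply: step_down => //; lia.
Qed.

Let closed_wall k e x : (k < (2 * n).+2)%N -> e \in tile_walls k -> inprod PG (D 0) x ->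
  inprod PG (D 0) (x * rfl e).
Proof.
move=> kn ee /(from0 kn)[a [d [Ga Dd ->]]]; apply: (to0 kn).
exists a, (d * rfl e); split=> //; last by rewrite mulrA.
by apply: generated_mul => //; apply: generated_incl; exists e.
Qed.

(** The product sets for all tiles agree with the one for tile 0. Every wall of the polyhedron other
    than Re = 0 belongs to some tile, and Re = 0 is covered by the first of the level facts. *)
Lemma wgrp_decomposition w k : W w -> (k < (2 * n).+2)%N -> inprod PG (D k) w.
Proof.
move=> Ww kn; apply: from0 kn _; elim/wgrp_ind: w / Ww => [|w i _ IH].
  have [G1 _ _] := PG_group.
  by exists 1, 1; split; [exact: G1|exact: generated_one|rewrite mulr1].
case: i => [||||j].
- have [a [d [Ga Dd ->]]] := IH; have [h1 _ _] : level_facts 0 by apply: level_factsP.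
  rewrite -mulrA; apply: (inprod_PG (V := [set (d * rfl eA)%R])).
    by exists a, (d * rfl eA); split.
  move=> _ ->; apply: h1; apply: generated_mul.
    by move: Dd; apply/rfls_sub/sub_tac; rewrite /= !inE !eqxx ?orbT.
  by apply: generated_incl; exists eA => //; rewrite /= inE eqxx.
- by apply: (closed_wall (k := 0)) => //; rewrite !inE eqxx.
- by apply: (closed_wall (k := 0)) => //; rewrite !inE eqxx orbT.
- apply: (closed_wall (k := (2 * n).+1)) => //.
  by rewrite /tile_walls /wall_hi ltnn !inE eqxx !orbT.
- have jn := ltn_ord j; apply: (closed_wall (k := j)) => //; first by lia.
  by rewrite /tile_walls /wall_hi -ltnS jn !inE eqxx !orbT.
Qed.

Let sphW k : (k <= 2 * n)%N -> W (rfl (eS k)).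
Proof. by move=> kn; exact: (wgrp_r root (MSph (Ordinal (kn : (k < (2 * n).+1)%N)))). Qed.

Let genW es : (forall e, e \in es -> W (rfl e)) -> generated (rfls es) `<=` W.
Proof.
move=> h x; elim=> {x} [_ [e ee <-]||x y _ ? _ ?|x _ ?]; first exact: h.
- exact: wgrp1.
- exact: wgrpM.
- exact: (wgrpV (@cox_root R n)).
Qed.

Lemma PG_wgrp : PG `<=` W.
Proof.
have WA : W (rfl eA) := wgrp_r root (MRe0 n).
have WB : W (rfl eB) := wgrp_r root (MRe1 n).
have WC : W (rfl eC) := wgrp_r root (MTop n).
have WD : W (rfl (root (MBot n))) := wgrp_r root (MBot n).
have gW : mat_group W.
  by split; [exact: wgrp1|exact: wgrpM|move=> x; exact: (wgrpV (@cox_root R n))].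
apply: limage_sub => //; first by move=> A SA; apply: (@Gamma_det R n); exact: generated_incl.
move=> A [[SA|[k /= kn]]|].
- have := GamS_gen_at (@isom3_1 R) (mul1mx _) (mul1mx _).
  rewrite !mul1mx => /(_ (lorentz A)) h; apply: (@genW [:: eA; eB; eC; eS 0]).
    by move=> e; rewrite !inE => /or4P[] /eqP-> //; exact: sphW.
  apply: h; exists (lorentz A); first by exists A.
  by rewrite invr1 mul1r mulr1.
- rewrite /GammaTi => -[B TB <-].
  have [i iE] : exists i, k = i.+1 by exists k.-1; lia.
  rewrite {}iE in kn *; rewrite subn1 /=.
  (* Working with the preimage of W under conjugation allows the generators of Gamma_T to be checked
     before they are shifted. *)
  set H := [set M | W (vdown (2 * i) * M * (vdown (2 * i))^-1)].
  have du := isom3_unit (@vdown_isom3 R (2 * i)).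
  have Hg : mat_group H.
    split; rewrite /H /=.
    - by rewrite mulr1 divrr//; exact: wgrp1.
    - move=> x y hx hy; have := wgrpM hx hy.
      by rewrite !mulrA mulrVK// -!mulrA.
    - move=> x hx; have [xu|xu] := boolP (x \is a GRing.unit); last by rewrite invr_out.
      have := wgrpV (@cox_root R n) hx.
      by rewrite !invrM ?unitrMl ?unitrV// invrK mulrA.
  have dS A' : (@GammaT0 R `|` conj_by (mx_c R ^- 2) (bar (@GammaT0 R))) A' -> \det A' = 1.
    have dT0 : forall B', @GammaT0 R B' -> \det B' = 1 by move=> B'; apply: generated_det; exact: GammaT0_det.
    move=> [/dT0//|]; apply: conj_by_det; first exact: mx_c_det.
    exact: bar_det.
  have HS A' : (@GammaT0 R `|` conj_by (mx_c R ^- 2) (bar (@GammaT0 R))) A' -> H (lorentz A').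
    move=> [TA'|[_ [B' TB' <-] <-]]; rewrite /H /=.
      apply: (@genW [:: eA; vdown (2 * i) *m eS 0; eB; vdown (2 * i) *m eS 1]).
        by move=> e; rewrite !inE !vdown_S => /or4P[] /eqP-> //; apply: sphW; lia.
      apply: GamT_gen_at; [exact: vdown_isom3|exact: vdown_A|exact: vdown_B|].
      by exists (lorentz A') => //; exists A'.
    rewrite vdownE conj_lorentz ?mx_c_det//.
    rewrite (_ : mx_c R ^- (2 * i) * _ / _ =
        mx_c R ^- (2 * i + 2) * barmx B' * (mx_c R ^- (2 * i + 2))^-1); last first.
      have e : mx_c R ^- (2 * i + 2) = mx_c R ^- (2 * i) * mx_c R ^- 2.
        by rewrite !mx_cVX -[RHS]/(_ *m _) -[RHS]/(_ * _) vshift_mxM natrD; congr vshift_mx; ring.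
      have u m : mx_c R ^- m \is a GRing.unit.
        by change (mx_c R ^- m \in unitmx); rewrite unitmxE mx_c_det unitr1.
      by rewrite e (invrM (u _) (u _)) !mulrA.
    rewrite -conj_vflip.
    apply: (@genW [:: eA; vflip (2 * i + 2) *m eS 0; eB; vflip (2 * i + 2) *m eS 1]).
      by move=> e; rewrite !inE !vflip_S ?addn2// => /or4P[] /eqP-> //; apply: sphW; lia.
    apply: GamT_gen_at; [exact: vflip_isom3|exact: vflip_A|exact: vflip_B|].
    by exists (lorentz B') => //; exists B'.
  have : H (lorentz B) by apply: (limage_sub dS Hg HS); exists B.
  by rewrite /H /= vdownE conj_lorentz ?mx_c_det.
- move=> [_ [B SB <-] <-]; rewrite -conj_vflip.
  have := GamS_gen_at (@vflip_isom3 R (2 * n)) (@vflip_A R _) (@vflip_B R _).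
  rewrite vflip_C vflip_S// subn0 => h.
  apply: (@genW [:: eA; eB; root (MBot n); eS (2 * n)]).
    by move=> e; rewrite !inE => /or4P[] /eqP-> //; exact: sphW.
  by apply: h; exists (lorentz B) => //; exists B.
Qed.

Lemma tile_walls_normal k e : (k < (2 * n).+2)%N -> e \in tile_walls k -> mink (nrm k) e = 0.
Proof.
move=> kn; have r2r2 := @r2r2 R; rewrite /tile_walls /wall_lo /wall_hi !inE.
rewrite /tile_normal /theta /base_ev /octa.
have [k0|kp] := posnP k.
  by rewrite k0 /= mul1mx => /or3P[] /eqP->; rewrite /ev /sph_root mink_hv; by field.
have [kl|kl] := leqP k (2 * n).
  rewrite /= => /or3P[] /eqP->; rewrite /ev vshift_hv /sph_root mink_hv; first by field.
    by field: r2r2.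
  have -> : k%:R = k.-1%:R + 1 :> R by rewrite natr1 prednK.
  by field: r2r2.
have -> : k = (2 * n).+1 by lia.
rewrite /= -mulmxA => /or3P[] /eqP->; rewrite /ev refl_hv vshift_hv /sph_root ?natrM mink_hv; by field: r2r2.
Qed.

(** The factor from the symmetry group of the tile fixes the normal, leaving the factor from
    Gamma_n. *)
Lemma tile_orbit w k : W w -> (k < (2 * n).+2)%N ->
  exists2 g, PG g & w *m nrm k = g *m nrm k.
Proof.
move=> Ww kn; have [g [d [Gg Dd ->]]] := wgrp_decomposition Ww kn.
exists g => //; rewrite -mulmxA; congr (_ *m _); apply: generated_fix Dd.
move=> _ [e ee <-]; rewrite rflE (tile_walls_normal kn ee) mulr0 scale0r subr0 //.
Qed.

Lemma tiles_normals : tiles R n = [set tile_of (@orbit_oo R n) N | N in @normals R n].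
Proof. by apply: tilesE; [exact: PG_wgrp|exact: tile_orbit]. Qed.

End CosetDecomposition.

(** * The commensurator *)

Section Commensurability.
Variable R : realType.
Implicit Types (H K L : set 'M[R]_4) (x y : 'M[R]_4).

(** Finite index without requiring K to be a subgroup of H; in this form the relation is transitive
    and compatible with conjugation. *)
Definition covered_by H K := exists2 F : set 'M[R]_4, finite_set F &
  forall h, H h -> exists d k, [/\ F d, K k & h = d * k].

Lemma covered_trans H K L : covered_by H K -> covered_by K L -> covered_by H L.
Proof.
move=> [F fF HF] [F' fF' KF]; exists [set a * b | a in F & b in F'].
  exact: finite_image2.
move=> h /HF[d [k [Fd /KF[d' [l [Fd' Ll ->]]] ->]]]; exists (d * d'), l; split=> //.
  by exists d => //; exists d'.
by rewrite mulrA.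
Qed.

Lemma covered_sub H H' K : H `<=` H' -> covered_by H' K -> covered_by H K.
Proof. by move=> HH [F fF h]; exists F => // x /HH/h. Qed.

Lemma conj_byM x y H : x \is a GRing.unit -> y \is a GRing.unit ->
  conj_by (x * y) H = conj_by x (conj_by y H).
Proof.
move=> xu yu; apply/seteqP; split=> [_ [h Hh <-]|_ [_ [h Hh <-] <-]].
  by exists (y * h * y^-1); [exists h|rewrite invrM// !mulrA].
by exists h => //; rewrite invrM// !mulrA.
Qed.

Lemma conj_byK x H : x \is a GRing.unit -> conj_by x^-1 (conj_by x H) = H.
Proof.
move=> xu; rewrite -conj_byM ?unitrV// mulVr//.
apply/seteqP; split=> [_ [h Hh <-]|h Hh]; first by rewrite invr1 mul1r mulr1.
by exists h => //; rewrite invr1 mul1r mulr1.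
Qed.

Lemma covered_conj x H K : x \is a GRing.unit -> covered_by H K ->
  covered_by (conj_by x H) (conj_by x K).
Proof.
move=> xu [F fF h]; exists [set x * d * x^-1 | d in F]; first exact: finite_image.
move=> _ [y /h[d [k [Fd Kk ->]]] <-]; exists (x * d * x^-1), (x * k * x^-1); split.
- by exists d.
- by exists k.
- by rewrite !mulrA mulrVK.
Qed.

Definition units H := forall x, H x -> x \is a GRing.unit.

Lemma finite_indexP H K : mat_group H -> mat_group K -> units H -> units K ->
  finite_index H (H `&` K) <-> covered_by H K.
Proof.
move=> [H1 HM HV] [K1 KM KV] Hu Ku; split=> [fi|[F fF h]].
  (* A choice of coset representative; the default 1 does not occur, cosets being nonempty. *)
  pose rep (C : set 'M[R]_4) := xget 1 C.
  exists (rep @` [set [set h * k | k in H `&` K] | h in H]); first exact: finite_image.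
  move=> h Hh; have hC : [set h * k | k in H `&` K] h by exists 1 => //; rewrite mulr1.
  have [k [Hk Kk] kE] : [set h * k | k in H `&` K] (rep [set h * k | k in H `&` K]).
    exact: (xgetPex 1 (ex_intro _ h hC)).
  exists (rep [set h * k | k in H `&` K]), k^-1; split.
  - by exists [set h * k | k in H `&` K] => //; exists h.
  - exact: KV.
  - by rewrite -kE mulrK//; exact: Ku.
apply: sub_finite_set (finite_image (fun d => [set x | H x /\ exists2 k, K k & x = d * k]) fF).
move=> _ [x Hx <-]; have [d [k [Fd Kk xE]]] := h _ Hx.
have ku := Ku _ Kk; have xu := Hu _ Hx.
exists d => //; apply/seteqP; split=> [y [Hy [l Kl yE]]|_ [l [Hl Kl] <-]].
  exists (k^-1 * l); last by rewrite yE xE mulrA mulrK.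
  split; last by apply: KM => //; exact: KV.
  have -> : k^-1 * l = x^-1 * (d * l).
    by apply: (mulrI xu); rewrite [RHS]mulVKr// xE mulrA mulrK.
  by apply: HM; [exact: HV|rewrite -yE].
split; first exact: HM.
by exists (k * l); [exact: KM|rewrite xE mulrA].
Qed.

Variable Gam : set 'M[R]_4.
Hypotheses (Gg : mat_group Gam) (Gi : Gam `<=` @isom3 R).

Lemma conj_group x : x \is a GRing.unit -> mat_group (conj_by x Gam).
Proof.
have [G1 GM GV] := Gg; move=> xu; split.
- by exists 1 => //; rewrite mulr1 divrr.
- move=> _ _ [a Ga <-] [b Gb <-]; exists (a * b); first exact: GM.
  by rewrite !mulrA mulrVK.
- move=> _ [a Ga <-]; have au := isom3_unit (Gi Ga).
  exists a^-1; first exact: GV.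
  by rewrite !invrM ?unitrMl ?unitrV// invrK mulrA.
Qed.

Let Gu : units Gam. Proof. by move=> x /Gi/isom3_unit. Qed.

Let conj_units x : x \is a GRing.unit -> units (conj_by x Gam).
Proof. by move=> xu _ [a /Gu au <-]; rewrite !unitrMl ?unitrV. Qed.

Lemma CommP x : Comm Gam x <->
  [/\ isom3 x, covered_by Gam (conj_by x Gam) & covered_by (conj_by x Gam) Gam].
Proof.
split=> -[ix h1 h2]; have xu := isom3_unit ix; split=> //.
- by apply/finite_indexP => //; [exact: conj_group|exact: conj_units].
- by apply/finite_indexP => //; [exact: conj_group|exact: conj_units|rewrite setIC].
- by apply/finite_indexP => //; [exact: conj_group|exact: conj_units].
- by rewrite setIC; apply/finite_indexP => //; [exact: conj_group|exact: conj_units].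
Qed.

Lemma CommM x y : Comm Gam x -> Comm Gam y -> Comm Gam (x * y).
Proof.
move=> /CommP[ix x1 x2] /CommP[iy y1 y2]; have xu := isom3_unit ix; have yu := isom3_unit iy.
apply/CommP; rewrite conj_byM//; split; first exact: isom3M.
  exact: covered_trans x1 (covered_conj xu y1).
exact: covered_trans (covered_conj xu y2) x2.
Qed.

Lemma CommV x : Comm Gam x -> Comm Gam x^-1.
Proof.
move=> /CommP[ix x1 x2]; have xu := isom3_unit ix.
apply/CommP; split; first exact: isom3V.
  have := covered_conj (x := x^-1) _ x2; rewrite unitrV conj_byK//; exact.
by have := covered_conj (x := x^-1) _ x1; rewrite unitrV conj_byK//; exact.
Qed.

(** For x in W, both Gam and its conjugate by x lie in W, and W is covered by finitely many cosets
    of either. *)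
Lemma Comm_sub (W : set 'M[R]_4) : Gam `<=` W -> mat_group W -> W `<=` @isom3 R ->
  covered_by W Gam -> W `<=` Comm Gam.
Proof.
move=> GW [W1 WM WV] Wi WG x Wx; have xu := isom3_unit (Wi _ Wx).
apply/CommP; split; first exact: Wi.
  have := covered_conj xu WG; apply: covered_sub => y /GW Wy.
  exists (x^-1 * y * x); first by apply: (WM) => //; apply: WM => //; exact: WV.
  by rewrite !mulrA divrr// mul1r mulrK.
apply: covered_sub WG => _ [y /GW Wy <-]; apply: (WM); last exact: WV.
exact: WM.
Qed.

Lemma Comm_isom3 x : Comm Gam x -> isom3 x. Proof. by case. Qed.

(* Pigeonhole on the cosets of Gam. *)
Lemma Comm_power x y : Comm Gam x -> Gam y -> exists2 m, (0 < m)%N & Gam (x * y ^+ m * x^-1).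
Proof.
have [G1 GM GV] := Gg.
move=> /CommP[ix _ [F fF h]] Gy; have xu := isom3_unit ix.
have yu := Gu Gy.
have Gyn m : Gam (y ^+ m).
  by elim: m => [|m IH]; rewrite ?expr0// exprS; exact: GM.
have hm (m : nat) : {d | F d & exists2 k, Gam k & x * y ^+ m * x^-1 = d * k}.
  apply: cid2; have [d [k [Fd Gk e]]] := h _ (ex_intro2 _ _ _ (Gyn m) erefl).
  by exists d => //; exists k.
pose f m := s2val (hm m).
have [l lF] : exists l : seq 'M[R]_4, F = [set` l] by apply/finite_seqP.
have Fl d : F d -> d \in l by rewrite lF.
have fl m : f m \in l by apply: Fl; exact: s2valP (hm m).
have [i [j [ij fij]]] : exists i j : nat, (i < j)%N /\ f i = f j.
  apply: contrapT => nij.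
  have finj : injective f.
    move=> i j fij; case: (ltngtP i j) => // ij; exfalso; apply: nij.
      by exists i, j.
    by exists j, i.
  have : (size [seq f i | i <- iota 0 (size l).+1] <= size l)%N.
    apply: uniq_leq_size; first by rewrite map_inj_uniq// iota_uniq.
    by move=> _ /mapP[i _ ->].
  by rewrite size_map size_iota ltnn.
have [k Gk kE] := s2valP' (hm i); have [k' Gk' kE'] := s2valP' (hm j).
rewrite -/(f i) in kE; rewrite -/(f j) -fij in kE'.
exists (j - i)%N; first by rewrite subn_gt0.
have cu m : x * y ^+ m * x^-1 \is a GRing.unit by rewrite !unitrMl ?unitrV ?unitrX.
have ku := Gu Gk; have fu : f i \is a GRing.unit.
  by have := cu i; rewrite kE unitrMl.
rewrite (_ : x * y ^+ (j - i) * x^-1 = k^-1 * k'); first by apply: GM => //; exact: GV.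
apply: (mulrI ku); rewrite mulVKr//; apply: (mulrI fu).
rewrite -kE' mulrA -kE -[in RHS](subnKC (ltnW ij)) exprD.
by rewrite !mulrA mulrVK.
Qed.

End Commensurability.

(** * Finiteness of the symmetry group of a tile *)

Section A2.
Variable G : unitRingType.

Lemma A2_elements (x y h : G) : x * x = 1 -> y * y = 1 -> x * (y * x) = y * (x * y) ->
  generated [set x; y] h -> h \in [:: 1; x; y; x * y; y * x; x * (y * x)].
Proof.
move=> xx yy xy; move: h; apply: generated_indl.
- by move=> s [->|->].
- by rewrite !inE eqxx.
- move=> s h Ss; rewrite !inE => /or4P[/eqP->|/eqP->|/eqP->|/or3P[]/eqP->]; case: Ss => ->.
  + by rewrite mulr1 eqxx ?orbT.
  + by rewrite mulr1 eqxx ?orbT.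
  + by rewrite xx eqxx ?orbT.
  + by rewrite eqxx ?orbT.
  + by rewrite eqxx ?orbT.
  + by rewrite yy eqxx ?orbT.
  + by rewrite mulrA xx mul1r eqxx ?orbT.
  + by rewrite -xy eqxx ?orbT.
  + by rewrite eqxx ?orbT.
  + by rewrite mulrA yy mul1r eqxx ?orbT.
  + by rewrite mulrA xx mul1r eqxx ?orbT.
  + by rewrite xy mulrA yy mul1r eqxx ?orbT.
Qed.

Lemma A3_finite (x y z : G) : A3 x y z -> finite_set (generated [set x; y; z]).
Proof.
move=> a3; have [xx yy zz [xy yz xz]] := a3.
apply: (@sub_finite_set _ _ [set a * b | a in [set` [:: 1; z; y * z; x * (y * z)]] &
    b in [set` [:: 1; x; y; x * y; y * x; x * (y * x)]]]).
  move=> d /(A3_coset_end a3)[e [h [eE hg ->]]]; exists e => //.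
  by exists h => //; exact: A2_elements.
by apply: finite_image2; apply/finite_seqP; eexists.
Qed.

End A2.

(** * Parabolic elements *)

Section ParabolicVertices.
Variables (R : realType) (n : nat).
Local Notation root := (@mirror_root R n).
Local Notation W := (wgrp root).
Local Notation PG := (PGamma R n).
Local Notation oo := (@oo R).
Local Notation cP := (@cox_root R n).

Lemma wgrp_group : mat_group W.
Proof. by split; [exact: wgrp1|exact: wgrpM|move=> x; exact: (wgrpV cP)]. Qed.

Lemma tile_walls_finite : finite_set (generated (rfls (@tile_walls R n 0))).
Proof.
have a3 : A3 (iso R tB) (iso R tS0) (iso R tC) by apply: A3_tok; vm_compute.
rewrite iso_tB iso_tS0 iso_tC in a3.
apply: sub_finite_set (A3_finite a3); apply: generated_sub => _ [e + <-].
rewrite /tile_walls /wall_lo /wall_hi /= !inE => h; apply: generated_incl.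
by case/or3P: h => /eqP->; [left; left|right|left; right].
Qed.

(** W is Gamma_n times the group of tile 0, which is finite as it satisfies the relations of S_4. *)
Lemma wgrp_Comm : W `<=` Comm PG.
Proof.
apply: Comm_sub; [exact: PG_group|exact: PGamma_isom3|exact: PG_wgrp|exact: wgrp_group| |].
  exact: (wgrp_isom3 cP).
exists [set d^-1 | d in generated (rfls (@tile_walls R n 0))].
  by apply: finite_image; exact: tile_walls_finite.
move=> w Ww; have [G1 GM GV] := @PG_group R n.
(* Decomposing the inverse of w puts the finite factor on the left, where [covered_by] expects
   it. *)
have [a [d [Ga Dd e]]] := wgrp_decomposition (wgrpV cP Ww) (ltn0Sn _ : (0 < (2 * n).+2)%N).
have au := isom3_unit (PGamma_isom3 Ga).
have wu := wgrp_unit cP Ww.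
have du : d \is a GRing.unit by have := wu; rewrite -(unitrV w) e unitrMr.
exists d^-1, a^-1; split; [by exists d|exact: GV|].
by rewrite -invrM// -e invrK.
Qed.

Lemma lightlike_gt0 (u : 'cV[R]_4) : Lplus u -> u != 0 -> 0 < u 3 0.
Proof. by move=> Lu u0; have [] := lightlike_orth Lu Lu (proj1 Lu) u0. Qed.

Lemma oo_Lplus : Lplus oo.
Proof. by rewrite /Lplus /= mink_hv !mxE /=; split; lra. Qed.

Lemma oo_neq0 : oo != 0.
Proof.
apply/eqP => /(congr1 (fun v : 'cV[R]_4 => v 3 0)); rewrite !mxE /=; lra.
Qed.

Lemma isom3_neq0 M (u : 'cV[R]_4) : isom3 M -> u != 0 -> M *m u != 0.
Proof.
move=> iM; apply: contra_neq => h; by rewrite -(isom3_mulVK u iM) h mulmx0.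
Qed.

Lemma lightlike_mink_le (p u v : 'cV[R]_4) : H3 p -> Lplus u -> Lplus v -> v != 0 ->
  - mink u v <= 2 * (mink u p * mink v p).
Proof.
move=> [pp p3] [uu u3] Lv v0; have v3 := lightlike_gt0 Lv v0; have [vv _] := Lv.
have pv : mink p v < 0 by apply: mink_lt0 => //; rewrite ?pp ?vv//; lra.
(* The image of v under the point reflection in p is again future-directed. *)
pose v' := - v - (2 * mink v p) *: p.
have vv' : mink v' v' = 0.
  by rewrite /v' !minkE pp vv (minkC p v); ring.
have pv' : mink p v' = mink p v by rewrite /v' !minkE pp (minkC v p); ring.
have v3' : 0 <= v' 3 0.
  rewrite leNgt; apply/negP => h.
  have : mink p (- v') <= 0.
    apply: mink_causal_le0; [rewrite pp; lra|exact: ltW|by rewrite minkNl minkNr vv' !oppr0|].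
    by rewrite [leRHS]mxE oppr_ge0 ltW.
  by rewrite minkNr pv'; lra.
have : mink u v' <= 0 by apply: mink_causal_le0; rewrite ?uu ?vv'.
by rewrite /v' !minkE (minkC u p); lra.
Qed.

(* A parabolic fixing the light ray of u moves every point y along a horosphere
   based there, with cosh of the displacement quadratic in <u, y>. *)
Definition horospheric (M : 'M[R]_4) u (k : R) :=
  forall y, mink (M *m y) y = mink y y - k * mink u y ^+ 2.

Lemma horospheric_conj g M u k : isom3 g -> horospheric M u k ->
  horospheric (g * M * g^-1) (g *m u) k.
Proof.
move=> ig h y; have [gm _] := ig.
rewrite -[in LHS](isom3_mulKV y ig) -!mulmxA isom3_mulVK// gm h -gm.
by rewrite -(gm u) !isom3_mulKV.
Qed.

(** Take p far out towards u and an orbit vector v with - <p, v> <= 1. Then <u, v> is so small that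
    <M v, v> = - k <u, v>^2 exceeds -1/2, and the gap in the orbit of [oo] forces M v = v. Thus <u,
    v> = 0, and orthogonal null vectors are proportional. *)
Lemma horospheric_vertex M u k : W M -> 0 < k -> horospheric M u k -> Lplus u -> u != 0 ->
  exists w c, [/\ W w, 0 < c & u = c *: (w *m oo)].
Proof.
move=> WM k0 hM Lu u0; have c0 := lightlike_gt0 Lu u0; have [uu _] := Lu.
set c := u 3 0 in c0.
pose y0 : 'cV[R]_4 := vec4 0 0 0 1.
have yy : mink y0 y0 = -1 by rewrite /mink !mxE /=; ring.
have uy : mink u y0 = - c by rewrite /mink !mxE /= /c; ring.
have D0 : 0 < 1 + 8 * k * c ^+ 2.
  by have := mulr_gt0 k0 (exprn_gt0 2 c0); lra.
(* Chosen so that k (2 b c)^2 < 1/2, where 2 b c will bound - <u, v>. *)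
pose b := (1 + 8 * k * c ^+ 2)^-1.
have b0 : 0 < b by rewrite invr_gt0.
have bD : b * (1 + 8 * k * c ^+ 2) = 1 by rewrite mulVf ?gt_eqF.
have kc := mulr_gt0 k0 (exprn_gt0 2 c0).
have b1 : b < 1 by have := mulr_gt0 b0 kc; lra.
(* Makes a u + b y0 a unit timelike vector: its norm is - 2 a b c - b^2. *)
pose a := (1 - b ^+ 2) / (2 * b * c).
have aE : 2 * (a * (b * c)) = 1 - b ^+ 2.
  by rewrite /a; field; rewrite !gt_eqF.
have bc := mulr_gt0 b0 c0.
have a0 : 0 <= a by rewrite divr_ge0//; [rewrite expr2; nra|rewrite -mulrA; lra].
pose p := a *: u + b *: y0.
have Hp : H3 p.
  split; first by rewrite /p !minkE uu yy (minkC y0) uy; lra.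
  by rewrite /p !mxE /= -/c; have := mulr_ge0 a0 (ltW c0); lra.
have [v Vv pv] := deep_vertex n Hp.
have [w Ww vE] := Vv.
have iw := wgrp_isom3 cP Ww.
have v0 : v != 0 by rewrite -vE; apply: isom3_neq0 => //; exact: oo_neq0.
have Lv : Lplus v := orbit_oo_Lplus Vv.
have h1 := lightlike_mink_le Hp Lu Lv v0.
have h2 : 0 <= - mink u v.
  by rewrite oppr_ge0; apply: mink_causal_le0; (case: (Lu); case: (Lv)) => // *; lra.
have up : mink u p = - (b * c) by rewrite /p !minkE uu uy; ring.
have h3 : - mink u v <= 2 * (b * c).
  apply: le_trans h1 _; rewrite up (minkC v); nra.
have h4 : k * mink u v ^+ 2 < 1 / 2.
  have : mink u v ^+ 2 <= 4 * (b ^+ 2 * c ^+ 2) by rewrite !expr2; nra.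
  move=> h5; have : k * mink u v ^+ 2 <= k * (4 * (b ^+ 2 * c ^+ 2)) by rewrite ler_pM2l.
  move: kc bD; set d := k * c ^+ 2; rewrite (_ : 8 * k * c ^+ 2 = 8 * d); last by rewrite /d; ring.
  rewrite (_ : k * (4 * (b ^+ 2 * c ^+ 2)) = 4 * d * b ^+ 2); last by rewrite /d; ring.
  by rewrite !expr2 => d0 ? ?; nra.
have vv : mink v v = 0 by case: Lv.
have oo0 : mink oo oo = 0 by rewrite mink_hv; ring.
have [e|] := orbit_gap_pair cP (@dom_oo R n) (ltW (divr_gt0 ltr01 (ltr0n R 2))) (wgrpM WM Ww) Ww erefl.
  rewrite -mulmxA vE in e.
  have /eqP := hM v; rewrite e vv sub0r eq_sym oppr_eq0 mulf_eq0 gt_eqF//= sqrf_eq0 => /eqP uv.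
  have uv' : mink v u = 0 by rewrite minkC.
  have [v3 uE] := lightlike_orth Lv Lu uv' v0.
  by exists w, (u 3 0 / v 3 0); split=> //; [rewrite divr_gt0|rewrite vE].
by rewrite -mulmxA vE hM vv oo0; lra.
Qed.

Local Notation tau := (lorentz (mx_s R)).

Lemma lorentz_s p q x y : tau *m hv p q x y = hv p (q + p - 2 * x) (x - p) y.
Proof.
by rewrite lorentzE barmx2 mx2T /herm !mx2M /unherm !mxE /= /hv; congr vec4; field.
Qed.

Lemma lorentz_s_pow m p q x y : tau ^+ m *m hv p q x y =
  hv p (q + m%:R ^+ 2 * p - 2 * m%:R * x) (x - m%:R * p) y.
Proof.
elim: m p q x y => [|m IH] p q x y; first by rewrite expr0 mul1mx; congr hv; ring.
by rewrite exprS -mulmxA IH lorentz_s -natr1; congr hv; ring.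
Qed.

Lemma horospheric_s m : horospheric (tau ^+ m) (hv 0 1 0 0) (2 * m%:R ^+ 2).
Proof.
by move=> y; rewrite [y]hv_eta lorentz_s_pow !mink_hv; field.
Qed.

(** A power of the parabolic s fixing 0 is conjugated into Gamma_n by x composed with the reflection
    exchanging 0 and [oo]. The conjugate is a horospheric element of W at the image of [oo] under
    x. *)
Lemma Comm_oo x : Comm PG x -> exists w c, [/\ W w, 0 < c & x *m oo = c *: (w *m oo)].
Proof.
move=> Cx; pose s : 'M[R]_4 := rfl (sph_root R 0).
have WS : W s := wgrp_r root (MSph ord0).
have s1 : s *m hv 0 1 0 0 = oo.
  by rewrite /s /sph_root rfl_hv; congr hv; ring.
have Cxs : Comm PG (x * s).
  by apply: (CommM (@PG_group R n) (@PGamma_isom3 R n)) => //; exact: wgrp_Comm.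
have Gs : PG tau.
  by exists (mx_s R) => //; apply: generated_incl; left; left; apply: generated_incl; left.
have [m m0 Gm] := Comm_power (@PG_group R n) (@PGamma_isom3 R n) Cxs Gs.
have ixs := Comm_isom3 Cxs.
have -> : x *m oo = (x * s) *m hv 0 1 0 0 by rewrite -mulmxA s1.
apply: (horospheric_vertex (PG_wgrp Gm) (k := 2 * m%:R ^+ 2)).
- by rewrite mulr_gt0// exprn_gt0// ltr0n.
- exact/horospheric_conj/horospheric_s.
- apply: isom3_Lplus => //; rewrite /Lplus /= mink_hv !mxE /=; split; lra.
- apply: isom3_neq0 => //; apply/eqP => /(congr1 (fun v : 'cV[R]_4 => v 3 0)).
  by rewrite !mxE /=; lra.
Qed.

End ParabolicVertices.

(** * The orbit of the commensurator *)

Section CommensuratorOrbit.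
Variables (R : realType) (n : nat).
Local Notation root := (@mirror_root R n).
Local Notation W := (wgrp root).
Local Notation PG := (PGamma R n).
Local Notation V := (@orbit_oo R n).
Local Notation oo := (@oo R).
Local Notation cP := (@cox_root R n).
Local Notation eA := (hv 0 0 1 0 : 'cV[R]_4).
Local Notation CM := (CommM (@PG_group R n) (@PGamma_isom3 R n)).
Local Notation CV := (CommV (@PG_group R n) (@PGamma_isom3 R n)).

(* The parabolic fixing oo that translates along a, for a orthogonal to oo. *)
Definition para (a v : 'cV[R]_4) : 'cV[R]_4 :=
  v + (2 * mink v a) *: oo - (2 * mink v oo) *: a - (2 * mink a a * mink v oo) *: oo.

Lemma htrans_para v : @htrans R n *m v = para eA v.
Proof.
have := @htransE R n 1 (v 3 0 + v 2 0) (v 3 0 - v 2 0) (v 0 0) (v 1 0).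
rewrite expr1 -hv_eta => ->; rewrite /para [in RHS](hv_eta v).
by rewrite !mink_hv !hvZ !(hvN, hvD); congr hv; field.
Qed.

(** If y scales [oo] by k, conjugation by y multiplies the length of a translation fixing [oo] by
    k. *)
Lemma para_conj y (k : R) v : isom3 y -> y *m oo = k *: oo ->
  y *m @htrans R n *m y^-1 *m v = para (k *: (y *m eA)) v.
Proof.
move=> iy yk; have [ym _] := iy.
rewrite -mulmxA -mulmxA htrans_para /para -[in RHS](isom3_mulKV v iy).
set w := y^-1 *m v.
have e (z : 'cV[R]_4) : mink (y *m w) (k *: z) = k * mink (y *m w) z by rewrite minkZr.
have h1 : k * mink (y *m w) oo = mink w oo by rewrite -minkZr -yk ym.
rewrite !(mulmxDr, mulmxN) -!scalemxAr yk !minkZl !minkZr !ym -h1 !scalerA.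
move: (mink w eA) (mink (y *m w) oo) (mink eA eA) => ? ? ?.
by congr (_ + _ *: _ - _ *: _ - _ *: _); ring.
Qed.

Lemma para_hv P s t p q x y :
  para (hv P 0 s t) (hv p q x y) =
  hv (p + 2 * (x * s + y * t) + (s ^+ 2 + t ^+ 2) * q) q (x + q * s) (y + q * t).
Proof. by rewrite /para !mink_hv !hvZ !(hvN, hvD); congr hv; field. Qed.

Lemma Comm_expr x m : Comm PG x -> Comm PG (x ^+ m).
Proof.
move=> Cx; elim: m => [|m IH]; first by rewrite expr0; apply: wgrp_Comm; exact: wgrp1.
by rewrite exprS; exact: CM.
Qed.

Lemma scale_expr y (k : R) m : y *m oo = k *: oo -> y ^+ m *m oo = k ^+ m *: oo.
Proof.
move=> yk; elim: m => [|m IH]; first by rewrite !expr0 mul1mx scale1r.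
by rewrite exprS -[y * _]/(y *m _) -mulmxA IH -scalemxAr yk scalerA exprSr.
Qed.

Hypothesis Comm_discrete : discrete_group (Comm PG).

(* Otherwise the conjugates of a parabolic by the powers of y accumulate at 1. *)
Lemma Comm_scale_ge1 y (k : R) : Comm PG y -> 0 < k -> y *m oo = k *: oo -> 1 <= k.
Proof.
move=> Cy k0 yk; rewrite leNgt; apply/negP => k1.
have C1 : Comm PG 1 by apply: wgrp_Comm; exact: wgrp1.
have [_ [U /nbhs_ballP[e /= e0 eU] U1]] := Comm_discrete C1.
(* A translation of length eps <= 1 differs from the identity by less than 3 eps in each matrix
   entry. *)
have [m me] : exists m, k ^+ m < Num.min 1 (e / 3).
  have : k ^+ m @[m --> \oo] --> 0 by apply: cvg_expr; rewrite gtr0_norm.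
  move=> /cvgr_lt/(_ (Num.min 1 (e / 3))).
  rewrite lt_min ltr01 divr_gt0// => /(_ isT)[m _ h].
  by exists m; apply: h => /=.
move: me; rewrite lt_min => /andP[m1 me].
have Cym := Comm_expr m Cy; have iym := Comm_isom3 Cym.
have ymk := scale_expr m yk.
pose g := y ^+ m * @htrans R n * (y ^+ m)^-1.
have Cg : Comm PG g.
  apply: CM; last exact: CV.
  by apply: CM => //; apply: wgrp_Comm; have := htrans_wgrp R n 1; rewrite expr1.
have gE v : g *m v = para (k ^+ m *: (y ^+ m *m eA)) v by exact: para_conj.
clearbody g; set eps := k ^+ m in m1 me gE ymk; have eps0 : 0 < eps by exact: exprn_gt0.
(* The image of [eA] is still of norm 1 and orthogonal to [oo]; so, after scaling by eps, the
   conjugate is a horizontal translation of length eps. *)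
have [P [s [t [aE st]]]] : exists P s t, eps *: (y ^+ m *m eA) = hv P 0 s t /\
    s ^+ 2 + t ^+ 2 = eps ^+ 2.
  have [ym _] := iym.
  have := ym eA oo; have := ym eA eA; rewrite ymk; move: (y ^+ m *m eA) => z.
  rewrite [z]hv_eta; move: (z 3 0 + _) (z 3 0 - _) (z 0 0) (z 1 0) => p q s t; rewrite minkZr !mink_hv => h1 h2.
  have q0 : q = 0 by nra.
  exists (eps * p), (eps * s), (eps * t); rewrite hvZ q0 mulr0; split=> //.
  by rewrite !exprMn -mulrDr -[RHS]mulr1; congr (_ * _); move: h1; rewrite q0 !expr2; lra.
have s1 : -eps <= s <= eps by apply/andP; split; nra.
have t1 : -eps <= t <= eps by apply/andP; split; nra.
have g1 : g = 1.
  have : [set (1 : 'M[R]_4)] g; last by [].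
  rewrite -U1; split=> //; apply: eU; split=> // i j; rewrite -ball_normE /=.
  pose d : 'cV[R]_4 := delta_mx j 0.
  have -> : g i j = (g *m d) i 0 by rewrite /d -colE [RHS]mxE.
  have -> : (1 : 'M[R]_4) i j = d i 0 by rewrite !mxE andbT.
  have dl l : 0 <= d l 0 <= 1 by rewrite !mxE andbT; case: (l == j) => /=; lra.
  have dp : 0 <= d 3 0 + d 2 0 <= 1.
    by rewrite !mxE; case: j {d dl} => [[|[|[|[|//]]]] ?] /=; lra.
  have dq : -1 <= d 3 0 - d 2 0 <= 1.
    by have := dl 3; have := dl 2; lra.
  move: (dl 0) (dl 1) dp dq (hv_eta d).
  move: (d 3 0 + _) (d 3 0 - _) (d 0 0) (d 1 0) => p q x z x1 z1 p1 q1 dE.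
  rewrite gE aE dE para_hv st.
  have e2 : eps ^+ 2 <= eps by rewrite expr2; nra.
  have b (c r : R) : -1 <= c <= 1 -> - eps <= r <= eps -> - eps <= c * r <= eps by nra.
  have xs : - eps <= x * s <= eps by apply: b => //; lra.
  have zt : - eps <= z * t <= eps by apply: b => //; lra.
  have qs : - eps <= q * s <= eps by apply: b => //; lra.
  have qt : - eps <= q * t <= eps by apply: b => //; lra.
  have eq2 : - eps <= q * eps ^+ 2 <= eps by apply: b => //; have := sqr_ge0 eps; lra.
  rewrite (mulrC (eps ^+ 2)) ltr_norml.
  case: i => [[|[|[|[|//]]]] hi]; rewrite !mxE /=; lra.
(* A nontrivial translation moves 0: the first coordinate becomes eps^2. *)
have := gE (hv 0 1 0 0); rewrite g1 mul1mx aE para_hv st => /hv_inj[h _ _ _].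
by have := exprn_gt0 2 eps0; lra.
Qed.

Lemma Comm_scale1 y (k : R) : Comm PG y -> 0 < k -> y *m oo = k *: oo -> k = 1.
Proof.
move=> Cy k0 yk; apply/eqP; rewrite eq_le (Comm_scale_ge1 Cy k0 yk) andbT.
rewrite -invf_ge1//; apply: (Comm_scale_ge1 (CV Cy)); first by rewrite invr_gt0.
have iy := Comm_isom3 Cy.
by rewrite -[oo in LHS](scalerK (lt0r_neq0 k0)) -yk -scalemxAr isom3_mulVK.
Qed.

(** If x sends the vector of w0 to c times that of w, then the product of w^-1, x and w0 scales [oo]
    by c, so c = 1. *)
Lemma Comm_orbit w0 (k : R) : W w0 -> 0 < k ->
  [set M *m (k *: (w0 *m oo)) | M in Comm PG] = [set k *: u | u in V].
Proof.
move=> Ww0 k0; apply/seteqP; split=> [_ [x Cx <-]|_ [_ [w Ww <-] <-]].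
  have Cxw : Comm PG (x * w0) by apply: CM => //; exact: wgrp_Comm.
  have [w [c [Ww c0 e]]] := Comm_oo Cxw.
  have c1 : c = 1.
    have WVw := wgrpV cP Ww.
    apply: (Comm_scale1 (y := w^-1 * (x * w0))) => //.
      by apply: CM => //; exact: wgrp_Comm.
    by rewrite -mulmxA e -scalemxAr isom3_mulVK//; exact: (wgrp_isom3 cP).
  exists (w *m oo); first by exists w.
  by rewrite -scalemxAr mulmxA -[x *m w0]/(x * w0) e c1 scale1r.
exists (w * w0^-1); first by apply: wgrp_Comm; apply: wgrpM => //; exact: (wgrpV cP).
by rewrite -scalemxAr -mulmxA isom3_mulVK//; exact: (wgrp_isom3 cP).
Qed.

End CommensuratorOrbit.

(** * Peripheral vectors *)

Section Peripheral.
Variable R : realType.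
Local Notation oo := (@oo R).
Implicit Types (A B : 'M[R[i]]_2).

Lemma ideal_fix_conj g M (u : 'cV[R]_4) : isom3 g -> ideal_fix (g^-1 * M * g) u ->
  ideal_fix M (g *m u).
Proof.
move=> ig [Lu u0 [k e]]; split; [exact: isom3_Lplus|exact: isom3_neq0|].
by exists k; rewrite scalemxAr -e -!mulmxA isom3_mulKV.
Qed.

Lemma parabolic_conj g (M : 'M[R]_4) : isom3 g -> parabolic M -> parabolic (g^-1 * M * g).
Proof.
move=> ig [iM M3 [v fv vM]]; have iV := isom3V ig; split.
- by apply: isom3M => //; exact: isom3M.
- move=> x Hx e; apply: (M3 (g *m x)); first by have [_] := ig; apply.
  by rewrite -[in RHS]e -!mulmxA isom3_mulKV.
- exists (g^-1 *m v).
    apply: ideal_fix_conj => //; rewrite invrK.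
    by rewrite !mulrA divrr ?isom3_unit// mul1r mulrK ?isom3_unit.
  move=> w /(ideal_fix_conj ig)/vM[k e]; exists k.
  by rewrite scalemxAr -e isom3_mulVK.
Qed.

Lemma lightlike_lorentz (v : 'cV[R]_4) : Lplus v -> v != 0 ->
  exists B k, [/\ \det B = 1, 0 < k & v = k *: (lorentz B *m oo)].
Proof.
move=> Lv v0; have := lightlike_gt0 Lv v0; have [+ _] := Lv; rewrite [v]hv_eta.
move: (v 3 0 + _) (v 3 0 - _) (v 0 0) (v 1 0) => p q x y; rewrite mink_hv !mxE /= => e pq.
have h := sqr_ge0 x; have h' := sqr_ge0 y; rewrite !expr2 in h h'.
have [q0|q0] := eqVneq q 0.
  have [x0 y0] : x = 0 /\ y = 0 by split; nra.
  exists 1, p; split; [exact: det1|lra|].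
  by rewrite lorentz1 mul1mx hvZ q0 x0 y0 !mulr0 mulr1.
have q1 : 0 < q by rewrite lt0r q0 /=; nra.
(* A matrix with first column (z, 1) sends oo to z. *)
exists (mx2 ((x / q) +i* (y / q)) (-1) 1 0), q; split=> //; first by rewrite det_mx2; ring.
rewrite lorentzE barmx2 mx2T /herm !mx2M /unherm !mxE /= /hv.
have -> : p = (x * x + y * y) / q by apply: (mulIf q0); rewrite divfK//; lra.
by apply: vec4_ext; rewrite !mxE /=; field.
Qed.

Lemma lorentz_fix_oo (a b c d : R[i]) (k : R) :
  lorentz (mx2 a b c d) *m oo = k *: oo -> c = 0.
Proof.
case: a b c d => [a a'] [b b'] [c c'] [d d'].
rewrite lorentzE barmx2 mx2T /herm !mx2M /unherm !mxE /= => e.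
have h i := congr1 (fun u : 'cV[R]_4 => u i 0) e.
have := h 3; have := h 2; rewrite !mxE /= => h2 h3.
have cc : c * c + c' * c' = 0 by lra.
by have [-> ->] : c = 0 /\ c' = 0 by split; nra.
Qed.

(** The sign accounts for the two lifts to SL_2 of a translation. *)
Lemma lorentz_unipotent (s : bool) (b b' : R) :
  horospheric (lorentz (mx2 ((-1) ^+ s) (b +i* b') 0 ((-1) ^+ s))) oo (2 * (b ^+ 2 + b' ^+ 2)).
Proof.
move=> y; rewrite [y]hv_eta; move: (y 3 0 + _) (y 3 0 - _) (y 0 0) (y 1 0) => p q x z.
have -> : lorentz (mx2 ((-1) ^+ s) (b +i* b') 0 ((-1) ^+ s)) *m hv p q x z =
    hv (p + 2 * (-1) ^+ s * (b * x + b' * z) + (b ^+ 2 + b' ^+ 2) * q) q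
       (x + (-1) ^+ s * b * q) (z + (-1) ^+ s * b' * q).
  rewrite lorentzE barmx2 mx2T /herm !mx2M /unherm !mxE /hv.
  by case: s; rewrite ?expr0 ?expr1 /=; congr vec4; field.
by rewrite !mink_hv; case: s; rewrite ?expr0 ?expr1; field.
Qed.

(** The matrix is upper triangular. Distinct diagonal entries would give the second fixed point b /
    (d - a), against uniqueness; so the diagonal is 1 or -1 twice. The constant 2 |b|^2 is positive,
    since b = 0 would fix all of hyperbolic space. *)
Lemma parabolic_fix_oo A : \det A = 1 -> parabolic (lorentz A) ->
  lorentz A *m oo = oo -> exists2 k, 0 < k & horospheric (lorentz A) oo k.
Proof.
rewrite [A]mx2_eta; move: (A 0 0) (A 0 1) (A 1 0) (A 1 1) => a b c d; rewrite det_mx2 => ad1.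
move=> [_ M3 [v [_ v0 _] vM]] Moo.
have c0 : c = 0 by apply: (@lorentz_fix_oo a b c d 1); rewrite scale1r.
rewrite {}c0 mulr0 subr0 in M3 vM Moo ad1 *.
have d0 : d != 0 by apply: contra_eq_neq ad1 => ->; rewrite mulr0 eq_sym oner_neq0.
have [da|da] := eqVneq d a; last first.
  exfalso; pose z := b / (d - a).
  have da' : d - a != 0 by rewrite subr_eq0.
  have nz : 0 * z + d != 0 by rewrite mul0r add0r.
  have ad1' : a * d - b * 0 = 1 by rewrite mulr0 subr0.
  have [k k0 e] := lorentz_ideal ad1' nz.
  rewrite (_ : (a * z + b) / (0 * z + d) = z) in e; last by rewrite /z; field; rewrite d0 da'.
  have [k1 e1] : exists k1 : R, oo = k1 *: v.
    by apply: vM; split; [exact: oo_Lplus|exact: oo_neq0|exists 1; rewrite scale1r].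
  have zE : ideal_vec (Some z) = hv (complex.Re z ^+ 2 + complex.Im z ^+ 2) 1 (complex.Re z) (complex.Im z).
    by rewrite -ideal_hv; case: (z).
  have [k2 e2] : exists k2 : R, ideal_vec (Some z) = k2 *: v.
    apply: vM; split; last by exists k.
      rewrite zE /Lplus /= mink_hv !mxE /=; split; first by field.
      by rewrite divr_ge0// addr_ge0// addr_ge0 ?sqr_ge0.
    rewrite zE; apply/eqP => h; have := congr1 (fun u : 'cV[R]_4 => mink u oo) h.
    by rewrite /= mink0l mink_hv; lra.
  have h1 := congr1 (fun u : 'cV[R]_4 => mink u oo) e2.
  rewrite /= zE minkZl mink_hv in h1.
  have h2 := congr1 (fun u : 'cV[R]_4 => mink u oo) e1.
  rewrite /= minkZl mink_hv in h2.
  have k10 : k1 != 0 by apply/eqP => k10; move: e1; rewrite k10 scale0r; apply/eqP/oo_neq0.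
  have : mink v oo = 0 by apply: (mulfI k10); lra.
  by move=> h3; move: h1; rewrite h3; lra.
have [s sE] : exists s : bool, a = (-1) ^+ s.
  have : a ^+ 2 = 1 by rewrite expr2 -ad1 da.
  by move/eqP; rewrite sqrf_eq1 => /orP[]/eqP->; [exists false|exists true].
rewrite da {}sE in M3 *; case: b {vM Moo ad1} M3 => b b' M3.
exists (2 * (b ^+ 2 + b' ^+ 2)); last exact: lorentz_unipotent.
have := sqr_ge0 b; have := sqr_ge0 b' => h h'.
case: (ltrP 0 (2 * (b ^+ 2 + b' ^+ 2))) => // h3; exfalso.
have [b0 b0'] : b = 0 /\ b' = 0 by rewrite !expr2 in h h' h3; split; nra.
have [x Hx] := @H3_exists R; apply: (M3 _ Hx).
rewrite b0 b0' lorentzE barmx2 mx2T /herm !mx2M /unherm !mxE.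
by case: s {M3}; rewrite ?expr0 ?expr1; apply: vec4_ext; rewrite !mxE /=; field.
Qed.

(** Conjugating the fixed ray to [oo] inside SL_2 shows that the parabolic is horospheric, and
    [horospheric_vertex] then places its ray in the orbit. *)
Lemma peripheral_vertex n v : peripheral_vec (PGamma R n) v ->
  exists w k, [/\ wgrp (@mirror_root R n) w, 0 < k & v = k *: (w *m oo)].
Proof.
move=> [Lv v0 [M [GM pM Mv]]]; have [A GA AM] := GM.
have dA := Gamma_det GA.
have [B [c [dB c0 vE]]] := lightlike_lorentz Lv v0.
have iB := lorentz_isom3 dB; have Bu := isom3_unit iB.
pose A' := B^-1 *m A *m B.
have ME : lorentz A' = (lorentz B)^-1 * M * lorentz B.
  by rewrite /A' !lorentzM lorentzV// AM.
have dA' : \det A' = 1 by rewrite /A' !det_mulmx -[B^-1]/(invmx B) det_inv dB dA invr1 !mul1r.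
have pA' : parabolic (lorentz A') by rewrite ME; exact: parabolic_conj.
have foo : lorentz A' *m oo = oo.
  apply: (scalerI (lt0r_neq0 c0)).
  by rewrite ME scalemxAr -!mulmxA -scalemxAr -vE Mv vE -scalemxAr isom3_mulVK.
have [k k0 hk] := parabolic_fix_oo dA' pA' foo.
have hM : horospheric M (lorentz B *m oo) k.
  have := horospheric_conj iB hk; rewrite ME !mulrA divrr// mul1r mulrK//.
have [||w [c' [Ww c'0 e]]] := horospheric_vertex (PG_wgrp GM) k0 hM.
- by apply: isom3_Lplus => //; exact: oo_Lplus.
- by apply: isom3_neq0 => //; exact: oo_neq0.
by exists w, (c * c'); split=> //; [exact: mulr_gt0|rewrite vE e scalerA].
Qed.

End Peripheral.

Theorem theorem4 (R : realType) (n : nat) (n_gt0 : (0 < n)%N)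
    (Comm_discrete : discrete_group (Comm (PGamma R n))) :
  is_tiling (tiles R n) /\
  (forall v : 'cV[R]_4, peripheral_vec (PGamma R n) v ->
     tiles R n = canonical_tiles (Comm (PGamma R n)) v).
Proof.
have VN := @facet_normals_orbit R n; split.
  by rewrite tiles_normals; apply: tiling_of_normals VN _; exact: normals_lf.
move=> v /peripheral_vertex[w [k [Ww k0 ->]]].
by rewrite /canonical_tiles Comm_orbit// (facets_of_normals VN k0) tiles_normals.
Qed.
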